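(* Let $p$ be an odd prime and let $n\ge2$. Let $G$ be the group generated by $\{\sigma,\tau,z,U',V'\}$, omitting $V'$ if $n=2$, subject to the following relations. Then $G$ is isomorphic to $\Omega(2n+1,p)$. (i) Defining relations for $\langle U',V'\rangle$ as the group of signed permutation matrices of determinant $1$ and degree $n$ (for $n=2$: $U'^4=1$); $[z,U'^{V'}]=1$ if $n>2$; $[z,V'U'^{-1}]=1$ if $n>3$; $z^2=1$; $[z,U'^2]=1$; $[z,z^{U'}]=1$. (ii) Relations stating that $\tau$ is centralised by: $U'^{V'}$ if $n>2$; $V'U'^{-1}$ if $n>3$; $U'^2z^{U'}$. (iii) Relations that present $\mathrm{SL}(2,p)$ on $\{\sigma,U'\}$. (iv) Relations that present $\mathrm{PSL}(2,p)$ on $\{\tau,z\}$. (v) (a) if $n>2$ then $[\sigma,\sigma^{V'}]=\sigma^{V'U'^{-1}}$; (b) if $n>2$ then $[\sigma,\sigma^{V'U'^{-1}}]=1$; (c) if $n>2$ then $[\sigma,\sigma^W]=1$, where $W=U'^{V'U'^{-1}}$; (d) if $n>3$ then $[\sigma,\sigma^{V'^2}]=1$; (e) $[\sigma,\sigma^{z^{U'}}]=1$; (f) $[\tau,\tau^{U'}]=\sigma^{2z^{U'}}$; (g) $[\sigma,\tau]=1$; (h) $[\sigma^z,\tau]=\sigma\tau^{zU'}$; (j) if $n>2$ then $[\sigma,\tau^{V'^2}]=1$. (vi) If $n=p=3$ then $[\tau,\sigma^{V'}]=1$.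
   Context: Conventions: $x^y=y^{-1}xy$, $[x,y]=x^{-1}y^{-1}xy$, $x^{ky}=(x^k)^y$ for $k$ an integer and $x,y$ group elements (so $\sigma^{2z^{U'}}=(\sigma^2)^{(z^{U'})}$). Linear maps act on the right and fix unmentioned basis vectors. Generators of the presented group are denoted by the same symbols as the corresponding matrices. ''Relations that present (defining relations for) a group on given elements $g_1,\dots,g_k$'' means any set of relators in the free group on $k$ letters whose normal closure is the kernel of the natural map onto $\langle g_1,\dots,g_k\rangle$. Signed cycles: $(v_1,\dots,v_m)^{\epsilon}$ denotes $v_i\mapsto v_{i+1}$ ($i<m$), $v_m\mapsto\epsilon v_1$; $\epsilon_m=(-1)^{m+1}$. Matrices: the natural module of $\Omega(2n+1,p)$ has basis $(e_1,f_1,\dots,e_n,f_n,w)$ with symmetric bilinear form $e_i.f_i=f_i.e_i=1$, $w.w=-2$, all other products zero. $\sigma=(e_1\mapsto e_1+e_2,\ f_2\mapsto f_2-f_1)$; $\tau=(e_1\mapsto e_1+f_1+w,\ w\mapsto w+2f_1)$; $z=(e_1\mapsto f_1,\ f_1\mapsto e_1,\ w\mapsto-w)$; $U'=(e_1,e_2)^-(f_1,f_2)^-$; $V'=(e_1,\dots,e_n)^{\epsilon_n}(f_1,\dots,f_n)^{\epsilon_n}$. In (i) $U'$ and $V'$ correspond to the signed permutations $(1,2)^-$ and $(1,\dots,n)^{\epsilon_n}$. In (iii), $\sigma,U'$ act on $(e_1,e_2)$ as $\begin{pmatrix}1&1\\0&1\end{pmatrix}$, $\begin{pmatrix}0&1\\-1&0\end{pmatrix}$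 and generate a copy of $\mathrm{SL}(2,p)$; in (iv), $\tau,z$ generate a copy of $\mathrm{PSL}(2,p)\cong\Omega(3,p)$ acting on $\langle e_1,f_1,w\rangle$. *)

(* Defs.v *)
From HB Require Import structures.
From mathcomp Require Import all_boot all_order all_fingroup all_algebra all_solvable.
From mathcomp Require Import generic_quotient boolp classical_sets.

Set Implicit Arguments.
Unset Strict Implicit.
Unset Printing Implicit Defensive.

Import GRing.Theory.
Local Open Scope group_scope.
Local Open Scope classical_set_scope.

(* A letter (x, false) stands for x, and (x, true) for x^-1; an element of the
   free group is a freely reduced word. *)
Section FreeGroupWords.
Variable T : choiceType.
Implicit Types (a b : T * bool) (s w : seq (T * bool)).

Definition flip a := (a.1, ~~ a.2).

Definition reduced w := sorted (fun a b => b != flip a) w.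

Definition push a s :=
  if s is b :: s' then (if b == flip a then s' else a :: s) else [:: a].

Definition winv w := rev (map flip w).

Lemma flipK : involutive flip.
Proof. by case=> x b; rewrite /flip /= negbK. Qed.

Lemma reduced_tail a s : reduced (a :: s) -> reduced s.
Proof. by case: s => //= b s /andP[]. Qed.

Lemma push_reduced a s : reduced s -> reduced (push a s).
Proof.
case: s => //= b s; case: eqP => [_ /reduced_tail //|/eqP nab rbs].
by rewrite /reduced /= nab.
Qed.

Lemma pushK a s : reduced s -> push (flip a) (push a s) = s.
Proof.
case: s => [|b s] /=; first by rewrite flipK eqxx.
case: (eqVneq b (flip a)) => [-> |nb] /=; last by rewrite flipK eqxx.
by case: s => //= c s /andP[/negPf-> _].
Qed.

Lemma push_cons a s : reduced (a :: s) -> push a s = a :: s.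
Proof. by case: s => //= b s /andP[/negPf-> _]. Qed.

Lemma foldr_push_reduced w s : reduced s -> reduced (foldr push s w).
Proof. by move=> rs; elim: w => //= a w; apply: push_reduced. Qed.

Lemma foldr_push_nil w : reduced w -> foldr push [::] w = w.
Proof.
elim: w => //= a w IHw raw.
by rewrite IHw ?push_cons //; apply: reduced_tail raw.
Qed.

Lemma foldr_push_push a w s : reduced s -> reduced w ->
  foldr push s (push a w) = push a (foldr push s w).
Proof.
move=> rs; case: w => [//|b w] /= rbw.
case: (eqVneq b (flip a)) => [->|//] /=.
have := @pushK (flip a) (foldr push s w); rewrite flipK => -> //.
exact: foldr_push_reduced.
Qed.

Lemma foldr_pushA w1 w2 s : reduced s -> reduced w2 ->
  foldr push s (foldr push w2 w1) = foldr push (foldr push s w2) w1.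
Proof.
move=> rs rw2; elim: w1 => //= a w1 IHw.
by rewrite foldr_push_push ?IHw // foldr_push_reduced.
Qed.

Lemma winv_reduced w : reduced w -> reduced (winv w).
Proof.
rewrite /reduced /winv rev_sorted sorted_map.
by apply: sub_sorted => a b /=; rewrite flipK eq_sym.
Qed.

Lemma winvK w s : reduced s -> foldr push (foldr push s w) (winv w) = s.
Proof.
move=> rs; elim: w => //= a w IHw.
rewrite /winv /= rev_cons -cats1 foldr_cat /= pushK ?IHw //.
exact: foldr_push_reduced.
Qed.

End FreeGroupWords.

Record freegroup (T : choiceType) :=
  FreeGroup { fgword :> seq (T * bool); fgwordP : reduced fgword }.

Section FreeGroup.
Variable T : choiceType.
Local Notation F := (freegroup T).

HB.instance Definition _ := [isSub for @fgword T].
HB.instance Definition _ := [Choice of F by <:].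

Definition fg_one : F := @FreeGroup T [::] isT.
Definition fg_mul (x y : F) : F :=
  FreeGroup (foldr_push_reduced x (fgwordP y)).
Definition fg_inv (x : F) : F := FreeGroup (winv_reduced (fgwordP x)).

Lemma fg_mulA : associative fg_mul.
Proof. by move=> x y z; apply: val_inj; rewrite /= foldr_pushA ?fgwordP. Qed.

Lemma fg_mul1 : left_id fg_one fg_mul.
Proof. by move=> x; apply: val_inj. Qed.

Lemma fg_mul1r : right_id fg_one fg_mul.
Proof. by move=> x; apply: val_inj; rewrite /= foldr_push_nil ?fgwordP. Qed.

Lemma fg_mulV : left_inverse fg_one fg_inv fg_mul.
Proof.
move=> x; apply: val_inj => /=.
by have := @winvK T x [::] isT; rewrite foldr_push_nil ?fgwordP.
Qed.

Lemma fg_mulVr : right_inverse fg_one fg_inv fg_mul.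
Proof.
move=> x; rewrite -[LHS]fg_mul1 -{1}(fg_mulV (fg_inv x)).
by rewrite -fg_mulA (fg_mulA (fg_inv x)) fg_mulV fg_mul1 fg_mulV.
Qed.

HB.instance Definition _ :=
  isGroup.Build F fg_mulA fg_mul1 fg_mul1r fg_mulV fg_mulVr.

Definition fgen (x : T) : F := @FreeGroup T [:: (x, false)] isT.

Section Eval.
Variables (G : groupType) (g : T -> G).

Definition lval (a : T * bool) : G := if a.2 then (g a.1)^-1 else g a.1.

(* The homomorphism from the free group that extends g. *)
Definition feval (w : F) : G := \prod_(a <- fgword w) lval a.

Lemma lval_flip a : lval (flip a) = (lval a)^-1.
Proof. by case: a => x []; rewrite /lval //= invgK. Qed.

Lemma lval_push a w :
  \prod_(b <- push a w) lval b = lval a * \prod_(b <- w) lval b.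
Proof.
case: w => [|b w] /=; first by rewrite big_seq1 big_nil mulg1.
case: eqP => [->|_]; last by rewrite big_cons.
by rewrite big_cons lval_flip mulKVg.
Qed.

Lemma fevalM : {morph feval : x y / x * y >-> x * y}.
Proof.
move=> x y; rewrite /feval /=; elim: (fgword x) => /= [|a w IHw].
  by rewrite big_nil mul1g.
by rewrite lval_push IHw big_cons mulgA.
Qed.

Lemma feval1 : feval 1 = 1.
Proof. by rewrite /feval big_nil. Qed.

HB.instance Definition _ :=
  isUMagmaMorphism.Build F G feval (conj feval1 fevalM).

Lemma feval_gen x : feval (fgen x) = g x.
Proof. by rewrite /feval big_seq1. Qed.

End Eval.
End FreeGroup.

Section NormalClosure.
Variable G : groupType.
Implicit Types N R : set G.

Definition normal_subgroup N :=
  [/\ N 1, forall x y, N x -> N y -> N (x * y^-1)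
         & forall x y, N x -> N (x ^ y)].

Definition normal_closure R : set G :=
  [set x | forall N, normal_subgroup N -> R `<=` N -> N x].

Lemma normal_closureP R : normal_subgroup (normal_closure R).
Proof.
split=> [N [] //|x y Rx Ry N nN sRN|x y Rx N nN sRN].
  by case: (nN) => _ NB _; apply: NB; [apply: Rx | apply: Ry].
by case: (nN) => _ _ NJ; apply: NJ; apply: Rx.
Qed.

End NormalClosure.

Section Presented.
Variables (T : choiceType) (R : set (freegroup T)).
Local Notation F := (freegroup T).
Local Notation N := (normal_closure R).

Definition ncl_rel (x y : F) : bool := `[< N (x * y^-1) >].

Lemma ncl_relP x y : reflect (N (x * y^-1)) (ncl_rel x y).
Proof. exact: asboolP. Qed.

Lemma ncl1 : N 1. Proof. by case: (normal_closureP R). Qed.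

Lemma nclB x y : N x -> N y -> N (x * y^-1).
Proof. by case: (normal_closureP R) => _ NB _; apply: NB. Qed.

Lemma nclV x : N x -> N x^-1.
Proof. by move=> Nx; rewrite -[x^-1]mul1g; apply: nclB => //; apply: ncl1. Qed.

Lemma nclM x y : N x -> N y -> N (x * y).
Proof. by move=> Nx Ny; rewrite -[y]invgK; apply: nclB => //; apply: nclV. Qed.

Lemma nclJ x y : N x -> N (x ^ y).
Proof. by case: (normal_closureP R) => _ _ NJ; exact: NJ. Qed.

Lemma ncl_rel_refl : reflexive ncl_rel.
Proof. by move=> x; apply/ncl_relP; rewrite mulgV; apply: ncl1. Qed.

Lemma ncl_rel_sym : symmetric ncl_rel.
Proof.
by move=> x y; apply/idP/idP=> /ncl_relP/nclV Nxy; apply/ncl_relP;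
   rewrite invgM invgK in Nxy.
Qed.

Lemma ncl_rel_trans : transitive ncl_rel.
Proof.
move=> y x z /ncl_relP Nxy /ncl_relP Nyz; apply/ncl_relP.
by have := nclM Nxy Nyz; rewrite -mulgA mulKg.
Qed.

Canonical ncl_equiv := EquivRel ncl_rel ncl_rel_refl ncl_rel_sym ncl_rel_trans.

(* The group < T | R >, that is, the free group on T modulo the normal closure
   of R. *)
Definition presented : Type := {eq_quot ncl_equiv}%qT.

HB.instance Definition _ := EqQuotient.on presented.
HB.instance Definition _ := Choice.on presented.

Definition pres_proj (x : F) : presented := (\pi_presented x)%qT.

Lemma pres_projP x y : pres_proj x = pres_proj y <-> N (x * y^-1).
Proof.
by split=> [/eqP|/ncl_relP Nxy]; [rewrite eqmodE => /ncl_relP|apply/eqP; rewrite eqmodE].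
Qed.

Lemma pres_projK (x : presented) : pres_proj (repr x) = x.
Proof. exact: reprK. Qed.

Definition pres_one : presented := pres_proj 1.
Definition pres_mul (x y : presented) : presented :=
  pres_proj (repr x * repr y).
Definition pres_inv (x : presented) : presented := pres_proj (repr x)^-1.

Lemma pres_projM x y : pres_proj (x * y) = pres_mul (pres_proj x) (pres_proj y).
Proof.
apply/pres_projP; set x' := repr _; set y' := repr _.
have Nx : N (x * x'^-1) by apply/pres_projP; rewrite pres_projK.
have Ny : N (y * y'^-1) by apply/pres_projP; rewrite pres_projK.
have := nclM (nclJ x^-1 Ny) Nx.
by rewrite /conjg invgK invgM !mulgA !mulgVK.
Qed.

Lemma pres_projV x : pres_proj x^-1 = pres_inv (pres_proj x).
Proof.
apply/pres_projP; set x' := repr _.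
have Nx : N (x' * x^-1) by apply/pres_projP; rewrite pres_projK.
by have := nclJ x Nx; rewrite /conjg mulgVK invgK.
Qed.

Lemma pres_mulA : associative pres_mul.
Proof.
move=> x y z; rewrite -[x]pres_projK -[y]pres_projK -[z]pres_projK.
by rewrite -!pres_projM mulgA.
Qed.

Lemma pres_mul1 : left_id pres_one pres_mul.
Proof. by move=> x; rewrite -[x]pres_projK -pres_projM mul1g. Qed.

Lemma pres_mul1r : right_id pres_one pres_mul.
Proof. by move=> x; rewrite -[x]pres_projK -pres_projM mulg1. Qed.

Lemma pres_mulV : left_inverse pres_one pres_inv pres_mul.
Proof.
by move=> x; rewrite -[x]pres_projK -pres_projV -pres_projM mulVg.
Qed.

Lemma pres_mulVr : right_inverse pres_one pres_inv pres_mul.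
Proof.
by move=> x; rewrite -[x]pres_projK -pres_projV -pres_projM mulgV.
Qed.

HB.instance Definition _ :=
  isGroup.Build presented pres_mulA pres_mul1 pres_mul1r pres_mulV pres_mulVr.

End Presented.

(* The normal closure of R is the kernel of the natural map from the free group
   onto the subgroup generated by the elements g x. *)
Definition presents (T : choiceType) (G : groupType) (g : T -> G)
    (R : set (freegroup T)) : Prop :=
  normal_closure R = [set w | feval g w = 1].

Definition isomorphic (G H : groupType) : Prop :=
  exists f : {multiplicative G -> H}, bijective f.

Definition pair2 (A : Type) (x y : A) : bool -> A := fun b => if b then y else x.

Section Matrices.
Variables n p : nat.
Local Notation dim := n.*2.+1.
Local Notation V := 'rV['F_p]_dim.
Local Open Scope ring_scope.

(* The basis (e_1, f_1, ..., e_n, f_n, w), with e_k and f_k indexed from 0. *)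
Definition be (k : nat) : V := delta_mx 0 (inord k.*2).
Definition bf (k : nat) : V := delta_mx 0 (inord k.*2.+1).
Definition bw : V := delta_mx 0 ord_max.

(* The matrix, acting on row vectors on the right, that maps e_k to E k,
   f_k to F k and w to W. *)
Definition linmx (E F : nat -> V) (W : V) : 'M['F_p]_dim :=
  \matrix_(i < dim)
    if i == n.*2 :> nat then W else if odd i then F i./2 else E i./2.

Definition upd (b : nat -> V) (k : nat) (x : V) : nat -> V :=
  fun i => if i == k then x else b i.

(* The images of b_0, b_1, ... under the signed cycle
   (b_0, ..., b_(m-1))^eps. *)
Definition scycle (m : nat) (eps : 'F_p) (b : nat -> V) : nat -> V :=
  fun i => if (i.+1 < m)%N then b i.+1
           else if i.+1 == m then eps *: b 0%N else b i.

Definition sigma_mx := linmx (upd be 0 (be 0 + be 1)) (upd bf 1 (bf 1 - bf 0)) bw.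
Definition tau_mx := linmx (upd be 0 (be 0 + bf 0 + bw)) bf (bw + 2 *: bf 0).
Definition z_mx := linmx (upd be 0 (bf 0)) (upd bf 0 (be 0)) (- bw).
Definition scycle_mx m eps := linmx (scycle m eps be) (scycle m eps bf) bw.
Definition U_mx := scycle_mx 2 (-1).
Definition V_mx := scycle_mx n ((-1) ^+ n.+1).

(* The row of e_k is the row vector f_k, as e_k is paired with f_k only, and
   vice versa; w.w = -2. *)
Definition gram_mx : 'M['F_p]_dim := linmx bf be ((-2) *: bw).

Local Notation GL := {'GL_dim['F_p]}.

Definition toGL (M : 'M['F_p]_dim) : GL := insubd (1%g : GL) M.

Definition sigma := toGL sigma_mx.
Definition tau := toGL tau_mx.
Definition zel := toGL z_mx.
Definition Uel := toGL U_mx.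
Definition Vel := toGL V_mx.

(* By toGLK and the lemmas on unitmx below, toGL does not take its default
   value on these five matrices. *)

Lemma toGLK M : M \in unitmx -> GLval (toGL M) = M.
Proof. by move=> uM; rewrite /toGL -[LHS]/(val _) insubdK. Qed.

Lemma be_linmx E F W k : (k < n)%N -> be k *m linmx E F W = E k.
Proof.
move=> lt_kn; rewrite -rowE rowK inordK ?ltnS ?leq_double ?(ltnW lt_kn) //.
by rewrite (inj_eq double_inj) ltn_eqF // odd_double doubleK.
Qed.

Lemma bf_linmx E F W k : (k < n)%N -> bf k *m linmx E F W = F k.
Proof.
move=> lt_kn; rewrite -rowE rowK.
have lt2 : (k.*2.+1 < n.*2)%N by rewrite ltn_Sdouble.
rewrite inordK ?ltnS 1?ltnW // ltn_eqF //= odd_double /=.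
by rewrite uphalf_double.
Qed.

Lemma bw_linmx E F W : bw *m linmx E F W = W.
Proof. by rewrite -rowE rowK /= eqxx. Qed.

Lemma linmx_mul E F W M :
  linmx E F W *m M =
  linmx (fun k => E k *m M) (fun k => F k *m M) (W *m M).
Proof. by apply/row_matrixP=> i; rewrite row_mul !rowK; do 2?case: ifP. Qed.

Lemma linmx1 E F W : (forall k, (k < n)%N -> E k = be k) ->
  (forall k, (k < n)%N -> F k = bf k) -> W = bw -> linmx E F W = 1%:M.
Proof.
move=> eE eF ->; apply/row_matrixP=> i; rewrite rowK row1.
have := ltn_ord i; rewrite ltnS leq_eqVlt; case: eqP => [ei _|_ /= lti].
  by congr delta_mx; apply: val_inj.
have lt2 : (i./2 < n)%N.
  by rewrite -ltn_double (leq_ltn_trans _ lti) // -{2}(odd_double_half i) leq_addl.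
have := odd_double_half i; case: ifP => _ ei; rewrite ?eE ?eF //.
  by rewrite /bf -[X in inord X]/(true + i./2.*2)%N ei inord_val.
by rewrite /be -[X in inord X]/(false + i./2.*2)%N ei inord_val.
Qed.

Lemma sigma_unit : (1 < n)%N -> sigma_mx \in unitmx.
Proof.
move=> n1; have n0 := ltnW n1.
suff /mulmx1_unit[] : sigma_mx *m
  linmx (upd be 0 (be 0 - be 1)) (upd bf 1 (bf 1 + bf 0)) bw = 1%:M by [].
rewrite linmx_mul; apply: linmx1 => [k lk|k lk|]; last exact: bw_linmx.
- rewrite /upd; case: eqP => [->|/eqP/negPf ne].
    by rewrite mulmxDl !be_linmx //= subrK.
  by rewrite be_linmx ?ne.
- rewrite /upd; case: eqP => [->|/eqP/negPf ne].
    by rewrite mulmxBl !bf_linmx //= addrK.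
  by rewrite bf_linmx ?ne.
Qed.

Lemma tau_unit : (0 < n)%N -> tau_mx \in unitmx.
Proof.
move=> n0; suff /mulmx1_unit[] : tau_mx *m
  linmx (upd be 0 (be 0 + bf 0 - bw)) bf (bw - 2 *: bf 0) = 1%:M by [].
rewrite linmx_mul; apply: linmx1 => [k lk|k lk|]; last 1 first.
- by rewrite mulmxDl -scalemxAl bw_linmx bf_linmx // subrK.
- rewrite /upd; case: eqP => [->|/eqP/negPf ne]; last by rewrite be_linmx ?ne.
  rewrite !mulmxDl be_linmx // bf_linmx // bw_linmx /=.
  rewrite scaler_nat mulr2n addrA [_ + bf 0 + bw]addrAC subrK.
  by rewrite -(addrA (be 0)) addrK.
- by rewrite bf_linmx.
Qed.

Lemma z_unit : (0 < n)%N -> z_mx \in unitmx.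
Proof.
move=> n0; suff /mulmx1_unit[] : z_mx *m z_mx = 1%:M by [].
rewrite linmx_mul; apply: linmx1 => [k lk|k lk|].
- rewrite {1}/upd; case: eqP => [->|/eqP/negPf ne].
    by rewrite bf_linmx.
  by rewrite be_linmx // /upd ne.
- rewrite {1}/upd; case: eqP => [->|/eqP/negPf ne].
    by rewrite be_linmx.
  by rewrite bf_linmx // /upd ne.
- by rewrite mulNmx bw_linmx opprK.
Qed.

Lemma scycle_unit m eps :
  (0 < m <= n)%N -> eps * eps = 1 -> scycle_mx m eps \in unitmx.
Proof.
case/andP=> m0 le_mn eps2.
pose inv (b : nat -> V) i :=
  if (i < m)%N then if i is j.+1 then b j else eps *: b m.-1 else b i.
suff /mulmx1_unit[] : scycle_mx m eps *m linmx (inv be) (inv bf) bw = 1%:M.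
  by [].
have aux (b : nat -> V) M k : (k < n)%N ->
    (forall i, (i < n)%N -> b i *m M = inv b i) -> scycle m eps b k *m M = b k.
  move=> lk bM; rewrite /scycle; case: ifP => [ltm|/negbT].
    by rewrite bM /inv ?ltm // (leq_trans ltm).
  rewrite -leqNgt => lem; case: eqP => [em|/eqP nem].
    rewrite -scalemxAl bM ?(leq_trans _ lk) // /inv m0 -em /=.
    by rewrite scalerA eps2 scale1r.
  by rewrite bM // /inv ltnNge -ltnS ltn_neqAle eq_sym nem lem.
rewrite linmx_mul; apply: linmx1 => [k lk|k lk|]; last exact: bw_linmx.
- by apply: aux => // i; apply: be_linmx.
- by apply: aux => // i; apply: bf_linmx.
Qed.

Lemma U_unit : (1 < n)%N -> U_mx \in unitmx.
Proof. by move=> n1; apply: scycle_unit; rewrite ?n1 // mulrNN mulr1. Qed.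

Lemma V_unit : (0 < n)%N -> V_mx \in unitmx.
Proof.
by move=> n0; apply: scycle_unit; rewrite ?n0 ?leqnn // -expr2 sqrr_sign.
Qed.

Definition SOset : {set GL} :=
  [set g : GL | (GLval g *m gram_mx *m (GLval g)^T == gram_mx)
              & (\det (GLval g) == 1)]%SET.

Lemma SO_group_set : group_set SOset.
Proof.
apply/group_setP; split=> [|g h].
  by rewrite inE GL_1E mul1mx trmx1 mulmx1 det1 !eqxx.
rewrite !inE => /andP[/eqP gB /eqP g1] /andP[/eqP hB /eqP h1].
rewrite GL_MxE trmx_mul det_mulmx g1 h1 mulr1 eqxx andbT.
rewrite -[X in _ == X]gB -[X in _ == _ *m X *m _]hB.
by rewrite !mulmxA.
Qed.

Canonical SO := group SO_group_set.

(* Omega(2n+1, p), as the derived subgroup of SO(2n+1, p). *)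
Definition Omega : {group GL} := (SO^`(1))%G.

End Matrices.

Inductive gens (n : nat) := Gsigma | Gtau | Gz | GU | GV of (2 < n)%N.

Section GensChoice.
Variable n : nat.

Definition gens_code (g : gens n) : nat :=
  match g with Gsigma => 0 | Gtau => 1 | Gz => 2 | GU => 3 | GV _ => 4 end.

Definition gens_decode (k : nat) : option (gens n) :=
  match k with
  | 0 => Some (Gsigma n) | 1 => Some (Gtau n) | 2 => Some (Gz n)
  | 3 => Some (GU n)
  | _ => if boolP (2 < n) is AltTrue h then Some (GV h) else None
  end.

Lemma gens_codeK : pcancel gens_code gens_decode.
Proof.
case=> //= h; case: {-}_ / boolP => [h'|]; last by rewrite h.
by congr (Some (GV _)); apply: bool_irrelevance.
Qed.

HB.instance Definition _ := Choice.copy (gens n) (pcan_type gens_codeK).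
End GensChoice.

(* Meant for 2 < n only, as all the relators in which it occurs. *)
Definition Vgen (n : nat) : freegroup (gens n) :=
  if boolP (2 < n) is AltTrue h then fgen (GV h) else 1.

Lemma VgenE n (h : 2 < n) : Vgen n = fgen (GV h).
Proof.
rewrite /Vgen; case: {-}_ / boolP => [h'|]; last by rewrite h.
by congr (fgen (GV _)); apply: bool_irrelevance.
Qed.

Section Relators.
Variables n p : nat.
Local Notation F := (freegroup (gens n)).

Let s : F := fgen (Gsigma n).
Let t : F := fgen (Gtau n).
Let z : F := fgen (Gz n).
Let u : F := fgen (GU n).
Let v : F := Vgen n.

Definition when (b : bool) (l : seq F) : seq F := if b then l else [::].

(* A relation x = y is encoded by the relator x * y^-1. The parameters R are
   relators on two letters, false and true: in rels_i they are to present the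
   group generated by Uel and Vel, isomorphic (by restriction to the span of
   the e_k) to the signed permutation matrices of degree n and determinant 1;
   in rels_iii, the copy of SL(2, p) generated by sigma and Uel; in rels_iv,
   the copy of PSL(2, p) generated by tau and zel. *)

Definition rels_i (R : set (freegroup bool)) : set F :=
  (if 2 < n then feval (pair2 u v) @` R else [set u ^+ 4]) `|`
  [set` when (2 < n) [:: [~ z, u ^ v]] ++
        when (3 < n) [:: [~ z, v * u^-1]] ++
        [:: z ^+ 2; [~ z, u ^+ 2]; [~ z, z ^ u]]].

Definition rels_ii : set F :=
  [set` when (2 < n) [:: [~ t, u ^ v]] ++
        when (3 < n) [:: [~ t, v * u^-1]] ++
        [:: [~ t, u ^+ 2 * z ^ u]]].

Definition rels_iii (R : set (freegroup bool)) : set F :=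
  feval (pair2 s u) @` R.

Definition rels_iv (R : set (freegroup bool)) : set F :=
  feval (pair2 t z) @` R.

Definition rels_v : set F :=
  [set` when (2 < n) [:: [~ s, s ^ v] * (s ^ (v * u^-1))^-1;
                         [~ s, s ^ (v * u^-1)];
                         [~ s, s ^ (u ^ (v * u^-1))]] ++
        when (3 < n) [:: [~ s, s ^ (v ^+ 2)]] ++
        [:: [~ s, s ^ (z ^ u)];
            [~ t, t ^ u] * ((s ^+ 2) ^ (z ^ u))^-1;
            [~ s, t];
            [~ s ^ z, t] * (s * t ^ (z * u))^-1] ++
        when (2 < n) [:: [~ s, t ^ (v ^+ 2)]]].

Definition rels_vi : set F :=
  [set` when ((n == 3) && (p == 3)) [:: [~ t, s ^ v]]].

Definition relators (Rsgn RSL RPSL : set (freegroup bool)) : set F :=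
  rels_i Rsgn `|` rels_ii `|` rels_iii RSL `|` rels_iv RPSL `|`
  rels_v `|` rels_vi.

End Relators.

Arguments relators : clear implicits.

(* Main.v *)
From HB Require Import structures.
Require Import Defs.
From mathcomp Require Import all_boot all_fingroup all_algebra commutator.
From mathcomp Require Import generic_quotient zify ring boolp classical_sets.
Set Implicit Arguments.
Unset Strict Implicit.
Unset Printing Implicit Defensive.
Import GRing.Theory.

Local Open Scope group_scope.

Section GroupFacts.
Variable G : groupType.
Implicit Types x y z : G.

Lemma conj_commute x y : commute x y -> x ^ y = x.
Proof. by move=> cxy; rewrite /conjg cxy mulKg. Qed.

Lemma commute_conj x y : x ^ y = x -> commute x y.
Proof. by move=> xy; rewrite /commute conjgC xy. Qed.

Lemma commuteJ x y z : commute x y -> commute (x ^ z) (y ^ z).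
Proof. by rewrite /commute -!conjMg => ->. Qed.

Lemma commuteMl x y z : commute x z -> commute y z -> commute (x * y) z.
Proof.
move=> xz yz; apply: commute_sym; apply: commuteM; exact: commute_sym.
Qed.

Lemma commuteVl x y : commute x y -> commute x^-1 y.
Proof. by move=> xy; apply: commute_sym; apply: commuteV; apply: commute_sym. Qed.

Lemma commg_eq x y c : [~ x, y] = c -> x ^ y = x * c.
Proof. by move <-; rewrite commgEl mulVKg. Qed.

Lemma commg_eqV x y c : [~ x, y] = c -> y ^ x = y * c^-1.
Proof. by move <-; rewrite invgR commgEl mulVKg. Qed.

(** In a group element of odd order the square root is a power, so whatever
    commutes with the square commutes with the element. *)
Lemma sqrt_expg x p : odd p -> x ^+ p = 1 -> (x ^+ 2) ^+ p.+1./2 = x.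
Proof.
move=> op xp; rewrite -expgnA mul2n even_halfK /= ?op //.
by rewrite expgS xp mulg1.
Qed.

Lemma sqrt_commute x y p : odd p -> x ^+ p = 1 ->
  commute (x ^+ 2) y -> commute x y.
Proof.
move=> op xp xy; rewrite -(sqrt_expg op xp).
by apply: commute_sym; apply: commuteX; apply: commute_sym.
Qed.

Lemma comm1P x y : [~ x, y] = 1 <-> commute x y.
Proof.
split=> [e|c]; last by rewrite commgEl (conj_commute c) mulVg.
by apply: commute_conj; rewrite -[x ^ y](mulKVg x) -commgEl e mulg1.
Qed.

Lemma commgMl x y z : [~ x * y, z] = [~ x, z] ^ y * [~ y, z].
Proof. by rewrite !commgEr conjgM mulgA -conjMg mulgK. Qed.

Lemma commgMr x y z : [~ x, y * z] = [~ x, z] * [~ x, y] ^ z.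
Proof. by rewrite !commgEl conjgM -mulgA -conjMg mulKVg. Qed.

Lemma commgXX x y i j : commute [~ x, y] x -> commute [~ x, y] y ->
  [~ x ^+ i, y ^+ j] = ([~ x, y] ^+ (i * j)).
Proof.
move=> cx cy; have Jy : (x ^ y = x * [~ x, y]) by rewrite commgEl mulKVg.
have cJ m : (x ^ (y ^+ m) = x * [~ x, y] ^+ m).
  elim: m => [|m IH]; first by rewrite !expg0 conjg1 mulg1.
  rewrite expgSr conjgM IH conjMg Jy (conj_commute (commute_sym (commuteX m (commute_sym cy)))).
  by rewrite -mulgA -expgS.
rewrite commgEl conjXg cJ expgMn; last by apply: commuteX; apply: commute_sym.
by rewrite mulKg -expgnA mulnC.
Qed.
Lemma mulgV1_eq (g h : G) : (g * h^-1 = 1) -> g = h.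
Proof. by move=> e; rewrite -[g](mulgVK h) e mul1g. Qed.
End GroupFacts.

Section RankTwo.
Variables (G : groupType) (p : nat) (A a z u : G).
Hypotheses (p_odd : odd p) (Ap : A ^+ p = 1) (ap : a ^+ p = 1).
Hypotheses (z2 : z ^+ 2 = 1) (u4 : u ^+ 4 = 1).
Hypothesis (zE : z = a * a ^ z * a).
Hypothesis Ag : commute A a.
Variables d w b c X C : G.
Hypotheses (dE : u ^+ 2 = d) (wE : z ^ u = w) (bE : a ^ u = b).
Hypotheses (cE : a ^ (z * u) = c) (XE : A ^ z = X) (CE : A ^ (u * (z * w)) = C).
Hypotheses (zd : commute z d) (zw : commute z w) (a_cent : commute a (d * w)).
Hypothesis A_cent : commute A d.
Hypothesis Af : [~ a, b] = (A ^+ 2) ^ w.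
Hypothesis Ah : [~ X, a] = A * c.

Let zz : z * z = 1. Proof. by rewrite -expg2. Qed.
Let ww : w * w = 1. Proof. by rewrite -wE -conjMg zz conj1g. Qed.
Let dd : d * d = 1. Proof. by rewrite -dE -expgnDr. Qed.
Let ud : commute u d. Proof. by rewrite -dE; apply: commuteX. Qed.
Let zu_ : z * u = u * w. Proof. by rewrite conjgC wE. Qed.
Let wu : w * u = u * z.
Proof. by rewrite -wE conjgE -!mulgA -expg2 dE zd -dE expg2 -mulgA mulKg. Qed.
Let wd : commute w d.
Proof.
by apply: commute_conj; rewrite -wE conjJg (conj_commute zd) (conj_commute ud).
Qed.
Let adw : (a ^ d) ^ w = a.
Proof. by rewrite -conjgM; exact: conj_commute. Qed.
Let aw : a ^ w = a ^ d.
Proof. by rewrite -{1}adw -conjgM ww conjg1. Qed.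
Let bw : b ^ w = c. Proof. by rewrite -bE -conjgM -zu_. Qed.
Let Ad : A ^ d = A. Proof. exact: conj_commute. Qed.
Let Xd : X ^ d = X. Proof. by rewrite -XE -conjgM zd conjgM Ad. Qed.
Let Cd : C ^ d = C.
Proof.
have e : commute (u * (z * w)) d by do 2?apply: commuteMl.
by rewrite -CE -conjgM e conjgM Ad.
Qed.
Let dK x : (x ^ d) ^ d = x. Proof. by rewrite -conjgM dd conjg1. Qed.
Let cdE : c ^ d = (a ^ d) ^ (z * u).
Proof.
have e : commute (z * u) d by apply: commuteMl.
by rewrite -cE -!conjgM e.
Qed.
Let zuz : z * u * z = w * (z * u).
Proof. by rewrite zu_ -!mulgA -zw mulgA -wu -mulgA. Qed.
Let cz : c ^ z = c ^ d.
Proof. by rewrite cdE -cE -conjgM zuz conjgM aw. Qed.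

Let X_a : X ^ a = X * (A * c). Proof. exact: commg_eq. Qed.
Let X_a' : X ^ (a ^ d) = X * (A * c ^ d).
Proof. by rewrite -{1}Xd -conjJg X_a !conjMg Xd Ad. Qed.
Let ca' : [~ a ^ d, c] = A ^+ 2.
Proof. by rewrite -aw -bw -conjRg Af -conjgM ww conjg1. Qed.
Let c'a : [~ a, c ^ d] = A ^+ 2.
Proof. by rewrite -[in LHS](dK a) -conjRg ca' conjXg Ad. Qed.
Let c_a' : c ^ (a ^ d) = c * (A ^+ 2)^-1. Proof. exact: commg_eqV. Qed.
Let c'_a : (c ^ d) ^ a = c ^ d * (A ^+ 2)^-1. Proof. exact: commg_eqV. Qed.
Let A_as : A ^ (a ^ z) = A * (X * c ^ d).
Proof.
have Xz : X ^ z = A by rewrite -XE -conjgM zz conjg1.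
by rewrite -{1}Xz -conjJg X_a !conjMg Xz XE cz.
Qed.
(* z = a * a ^ z * a sends A to X, which determines c * c ^ d *)
Let XA : X = A * (X * (A * c) * (c ^ d * (A ^+ 2)^-1)).
Proof.
have e : A ^ z = ((A ^ a) ^ (a ^ z)) ^ a by rewrite -!conjgM mulgA -zE.
by rewrite -{1}XE e (conj_commute Ag) A_as conjMg (conjMg X) X_a c'_a (conj_commute Ag).
Qed.
Let ccE : c * c ^ d = A^-1 * X^-1 * A^-1 * X * A ^+ 2.
Proof. by rewrite {2}XA expg2; move: (c ^ d) => c'; rewrite !gnorm. Qed.
Let cc : commute c (c ^ d).
Proof.
have e : (c * c ^ d) ^ d = c * c ^ d.
  by rewrite ccE !conjMg !conjVg ?conjXg Ad Xd.
by rewrite /commute -[LHS]e conjMg dK.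
Qed.
Let aa : commute a (a ^ d).
Proof.
by apply: (@conjg_inj _ (z * u)); rewrite (conjMg a) conjMg -cdE cE.
Qed.
Let c_a : [~ c, a] = C ^+ 2.
Proof.
have e : [~ b, a ^ d] = (A ^+ 2) ^ (w * u).
  have au : a ^ d = b ^ u by rewrite -bE -conjgM -expg2 dE.
  by rewrite conjgM -Af conjRg bE au.
have := congr1 (conjg^~ w) e.
rewrite conjRg bw adw => ->; rewrite -conjgM wu -mulgA.
by rewrite conjXg CE.
Qed.
Let Cc' : commute C (c ^ d).
Proof.
have e : a ^ (u * (z * w)) = c ^ d.
  by rewrite mulgA -wu -mulgA -zu_ conjgM aw cdE.
by have := commuteJ (u * (z * w)) Ag; rewrite e CE.
Qed.
Let Cc : commute C c. Proof. by have := commuteJ d Cc'; rewrite dK Cd. Qed.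
Let c_aE : c ^ a = c * C ^+ 2. Proof. exact: commg_eq. Qed.
Let a_c : a ^ c = a * (C ^+ 2)^-1. Proof. exact: commg_eqV. Qed.
Let a_c' : a ^ (c ^ d) = a * A ^+ 2. Proof. exact: commg_eq. Qed.
Let C2c' : commute (C ^+ 2) (c ^ d).
Proof. by apply: commute_sym; apply: commuteX; apply: commute_sym. Qed.
Let A2c : (A ^+ 2) ^ c = C ^+ 2 * A ^+ 2 * (C ^+ 2)^-1.
Proof.
have := congr1 (conjg a) cc; rewrite (conjgM a c) conjgM a_c a_c' (conjMg a) conjMg conjVg a_c a_c'.
rewrite (conj_commute C2c'); move: (A ^+ 2) (C ^+ 2) => A2 C2.
by rewrite -!(mulgA a) -(mulgA C2) => /mulgI->; rewrite mulKVg.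
Qed.
(* c ^ a = c * C ^+ 2 commutes with A, which a centralises; hence so does c *)
Let A2_c : commute (A ^+ 2) c.
Proof.
have A2a : commute (A ^+ 2) a.
  by apply: commute_sym; apply: commuteX; apply: commute_sym.
apply: (@conjg_inj _ a); rewrite (conjMg c) (conjMg (A ^+ 2)) (conj_commute A2a) c_aE.
rewrite (mulgA (A ^+ 2)) (conjgC (A ^+ 2) c) A2c.
by move: (A ^+ 2) (C ^+ 2) => A2 C2; rewrite !gnorm.
Qed.
Let A2C : commute (A ^+ 2) (C ^+ 2).
Proof.
apply: commute_sym; apply: (@mulIg _ (C ^+ 2)^-1).
by rewrite -A2c (conj_commute A2_c) mulgK.
Qed.
Let A_c : commute A c. Proof. exact: sqrt_commute p_odd Ap A2_c. Qed.
Let A_c' : commute A (c ^ d).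
Proof. by have := commuteJ d A_c; rewrite Ad. Qed.
Let Ac : commute A (c * c ^ d). Proof. exact: commuteM. Qed.
Let cdz : (c ^ d) ^ z = c.
Proof. by rewrite -conjgM -zd conjgM cz dK. Qed.
Let Xc : commute X (c * c ^ d).
Proof. by have := commuteJ z Ac; rewrite (conjMg c) XE cz cdz cc. Qed.
Let ccR : c * c ^ d = [~ X, A].
Proof.
have e : A * (c * c ^ d) = X^-1 * A^-1 * X * A * A.
  by rewrite ccE expg2 !gnorm.
by apply: (@mulIg _ A); rewrite -Ac e /commg /conjg !gnorm.
Qed.
Let ccR' : c * c ^ d = [~ A, X].
Proof.
have := congr1 (conjg^~ z) ccR; rewrite conjRg XE.
have -> : X ^ z = A by rewrite -XE -conjgM zz conjg1.
by move <-; rewrite (conjMg c) cz cdz cc.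
Qed.
Let c_p : c ^+ p = 1. Proof. by rewrite -cE -conjXg ap conj1g. Qed.
Let cc1 : c * c ^ d = 1.
Proof.
have k2 : (c * c ^ d) ^+ 2 = 1 by rewrite expg2 {1}ccR ccR' -invgR mulVg.
have kp : (c * c ^ d) ^+ p = 1 by rewrite expgMn // -conjXg c_p conj1g mulg1.
by rewrite -(sqrt_expg p_odd kp) k2 expg1n.
Qed.

Lemma short_root_inv : a ^ d = a^-1.
Proof.
apply: (@mulgI _ a); rewrite mulgV; apply: (@conjg_inj _ (z * u)).
by rewrite (conjMg a) -cdE cE cc1 conj1g.
Qed.

Lemma long_root_comm_short : commute A c.
Proof. exact: A_c. Qed.

Lemma long_root_square : A ^+ 2 = [~ a, c^-1].
Proof. by rewrite -c'a; congr [~ _, _]; rewrite cdE short_root_inv conjVg cE. Qed.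

End RankTwo.

Section Cycle.
Variables (G : groupType) (n : nat) (u v : G).
Hypothesis uvn : commute u (v ^+ n).
Hypothesis far : forall k, 2 <= k -> k.+2 <= n -> commute u (u ^ (v ^+ k)).

Let expgD_conj x i j : x ^ (v ^+ (i + j)) = (x ^ (v ^+ i)) ^ (v ^+ j).
Proof. by rewrite expgnDr conjgM. Qed.

(* conjugation by v ^+ n fixes y, so v may be seen as a rotation of order n *)
Let rot x y k : k <= n -> commute y (v ^+ n) ->
  commute x (y ^ (v ^+ (n - k))) -> commute (x ^ (v ^+ k)) y.
Proof.
move=> kn yn /(commuteJ (v ^+ k)).
by rewrite -[(y ^ _) ^ _]expgD_conj subnK // (conj_commute yn).
Qed.

Section Shift.
Variable x : G.
Hypothesis xvu : commute x (v * u^-1).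
Hypothesis xuv : 2 < n -> commute x (u ^ v).

Let xu : x ^ u = x ^ v.
Proof.
have e : v = v * u^-1 * u by rewrite mulgVK.
by rewrite e conjgM (conj_commute xvu).
Qed.

Lemma shift_commute k : 0 < k -> k.+2 <= n -> commute x (u ^ (v ^+ k)).
Proof.
elim: k => // [[|k]] IH _ kn; first by apply: xuv; lia.
have := commuteJ (v * u^-1) (IH isT (ltnW kn)).
rewrite (conj_commute xvu) -conjgM mulgA -expgSr conjgM.
by rewrite (conj_commute (commuteV (commute_sym (far _ kn)))).
Qed.

Lemma shift_r_up i : (x ^ (v ^+ i)) ^ (u ^ (v ^+ i)) = x ^ (v ^+ i.+1).
Proof. by rewrite -conjJg xu -conjgM -(expgS v i). Qed.

Lemma shift_r_down i :
  (x ^ (v ^+ i.+1)) ^ (u ^ (v ^+ i)) = (x ^ (u ^+ 2)) ^ (v ^+ i).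
Proof. by rewrite (expgS v i) (conjgM x) -conjJg -xu -(conjgM x u u). Qed.

Lemma shift_r_fix i j : i.+1 < n -> j < n -> j != i -> j != i.+1 ->
  (x ^ (v ^+ j)) ^ (u ^ (v ^+ i)) = x ^ (v ^+ j).
Proof.
move=> i_n j_n ji ji1; apply: conj_commute; case: (ltngtP j i) => [lt|lt|e].
- rewrite -[in u ^ _](subnK (ltnW lt)) expgD_conj; apply: commuteJ.
  by apply: shift_commute; lia.
- rewrite -[in x ^ _](subnK (ltnW lt)) expgD_conj; apply: commuteJ.
  apply: rot; [lia | by [] |].
  by apply: shift_commute; lia.
- by rewrite e eqxx in ji.
Qed.

End Shift.

Section Flip.
Variables x z : G.
Hypothesis xvu : commute x (v * u^-1).
Hypothesis zvu : commute z (v * u^-1).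
Hypothesis zuv : 2 < n -> commute z (u ^ v).
Hypothesis zvn : commute z (v ^+ n).
Hypothesis xz1 : x ^ (z ^ u) = x^-1.

Let zJ k : 0 < k -> k < n -> x ^ (z ^ (v ^+ k)) = x^-1.
Proof.
have zu : z ^ u = z ^ v.
  have e : v = v * u^-1 * u by rewrite mulgVK.
  by rewrite e conjgM (conj_commute zvu).
elim: k => // [[|k]] IH _ kn; first by rewrite expg1 -zu.
have := congr1 (conjg^~ (v * u^-1)) (IH isT (ltnW kn)).
rewrite conjVg conjJg (conj_commute xvu) -(conjgM z) mulgA -expgSr (conjgM z).
move <-; congr (_ ^ _); symmetry; apply: conj_commute; apply: commuteV.
by apply: (rot (ltnW kn) uvn); apply: shift_commute => //; lia.
Qed.

Lemma shift_flip i j : i < n -> j < n -> j != i ->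
  (x ^ (v ^+ j)) ^ (z ^ (v ^+ i)) = (x ^ (v ^+ j))^-1.
Proof.
move=> i_n j_n ji; case: (ltngtP j i) => [lt|lt|e]; last by rewrite e eqxx in ji.
- rewrite -[in z ^ _](subnK (ltnW lt)) expgD_conj -conjJg zJ ?conjVg //; lia.
- rewrite -[in x ^ _](subnK (ltnW lt)) expgD_conj -conjJg.
  have -> : (x ^ (v ^+ (j - i))) ^ z = (x ^ (v ^+ (j - i)))^-1.
    rewrite -[z in LHS](conj_commute zvn).
    have kn : j - i <= n by lia.
    rewrite -[in z ^ _](subnK kn) expgD_conj -conjJg zJ ?conjVg //; lia.
  by rewrite conjVg.
Qed.
End Flip.
End Cycle.

Ltac case_eqs := repeat match goal with |- context [?a == ?b] =>
  lazymatch a with context [if _ then _ else _] => fail | _ => idtac end;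
  case: (a =P b) => ? /= end.

Section UpToInverse.
Variable G : groupType.
Implicit Types x y : G.

Definition eqi x y := x = y \/ x = y^-1.

Lemma eqi_refl x : eqi x x. Proof. by left. Qed.
Lemma eqi_V x : eqi x^-1 x. Proof. by right. Qed.
Lemma eqi_sym x y : eqi x y -> eqi y x.
Proof. by case=> ->; [left|right; rewrite invgK]. Qed.
Lemma eqi_trans y x z : eqi x y -> eqi y z -> eqi x z.
Proof. by case=> -> [->|->]; rewrite ?invgK; by [left|right]. Qed.
Lemma eqiJ g x y : eqi x y -> eqi (x ^ g) (y ^ g).
Proof. by case=> ->; [left|right; rewrite conjVg]. Qed.
Lemma eqiX k x y : eqi x y -> eqi (x ^+ k) (y ^+ k).
Proof. by case=> ->; [left|right; rewrite expVgn]. Qed.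

Lemma eqi_commute x x' y y' : eqi x x' -> eqi y y' -> commute x y -> commute x' y'.
Proof.
move=> /eqi_sym[]-> /eqi_sym[]-> // xy; do 2?[apply: commuteV|apply: commuteVl] => //.
Qed.

(* x and y generate a group of class at most two *)
Definition class2 x y := commute x [~ x, y] /\ commute y [~ x, y].

Lemma class2_sym x y : class2 x y -> class2 y x.
Proof. by rewrite /class2 -(invgR x y) => -[cx cy]; split; apply: commuteV. Qed.

Lemma commgV_class2 x y : class2 x y -> [~ x, y^-1] = [~ x, y]^-1.
Proof.
move=> [_ cy]; apply: (@conjg_inj _ y); rewrite conjVg.
rewrite [in RHS](conj_commute (commute_sym cy)) /commg /conjg !gnorm //.
Qed.

Lemma class2V x y : class2 x y -> class2 x y^-1.
Proof.
move=> c; rewrite /class2 commgV_class2 //; case: c => cx cy.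
by split; do ?[exact: commuteV|apply: commuteV|apply: commuteVl].
Qed.

Lemma commVg_class2 x y : class2 x y -> [~ x^-1, y] = [~ x, y]^-1.
Proof.
by move=> /class2_sym c; rewrite -invgR commgV_class2 // invgR.
Qed.

Lemma class2_eqi x x' y y' : eqi x x' -> eqi y y' ->
  class2 x y -> class2 x' y' /\ eqi [~ x, y] [~ x', y'].
Proof.
move=> /eqi_sym ex /eqi_sym ey c.
have [c1 e1] : class2 x y' /\ eqi [~ x, y] [~ x, y'].
  case: ey => -> //; first by split=> //; left.
  by split; [apply: class2V | rewrite commgV_class2 //; right; rewrite invgK].
case: ex => ->; first by [].
split; first by apply/class2_sym/class2V/class2_sym.
by rewrite commVg_class2 //; case: e1 => ->; [right; rewrite invgK|left].
Qed.

Lemma class2J g x y : class2 x y -> class2 (x ^ g) (y ^ g).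
Proof. by move=> [cx cy]; split; rewrite -conjRg; apply: commuteJ. Qed.
End UpToInverse.

Record typeB_relations (G : groupType) (n p : nat) (A a z u v : G) : Prop := {
  rB_uvn : commute u (v ^+ n);
  rB_far : forall k, 2 <= k -> k.+2 <= n -> commute u (u ^ (v ^+ k));
  rB_braid : 2 < n -> u * u ^ v * u = u ^ v * u * u ^ v;
  rB_vn : v ^+ n = (v * u) ^+ n.-1;
  rB_u4 : u ^+ 4 = 1;
  rB_z2 : z ^+ 2 = 1;
  rB_zuu : commute z (u ^+ 2);
  rB_zzu : commute z (z ^ u);
  rB_zvu : commute z (v * u^-1);
  rB_zuv : 2 < n -> commute z (u ^ v);
  rB_avu : commute a (v * u^-1);
  rB_auv : 2 < n -> commute a (u ^ v);
  rB_a_cent : commute a (u ^+ 2 * z ^ u);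
  rB_ap : a ^+ p = 1;
  rB_zE : z = a * a ^ z * a;
  rB_Ap : A ^+ p = 1;
  rB_A_cent : commute A (u ^+ 2);
  rB_uE : u = A * A ^ u * A;
  rB_b : 2 < n -> commute A (A ^ (v * u^-1));
  rB_e : commute A (A ^ (z ^ u));
  rB_f : [~ a, a ^ u] = (A ^+ 2) ^ (z ^ u);
  rB_g : commute A a;
  rB_h : [~ A ^ z, a] = A * a ^ (z * u);
  rB_j : 2 < n -> commute A (a ^ (v ^+ 2)) }.

Section Transposition.
Local Open Scope nat_scope.

Definition transp i j x : nat := if x == i then j else if x == j then i else x.

Lemma transpK i j : involutive (transp i j).
Proof. by move=> x; rewrite /transp; case_eqs; lia. Qed.

Lemma transp_lt n i j x : i < n -> j < n -> x < n -> transp i j x < n.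
Proof. by rewrite /transp; case_eqs. Qed.

Lemma transpL i j : transp i j i = j.
Proof. by rewrite /transp eqxx. Qed.

Lemma transp_fix i j x : x != i -> x != j -> transp i j x = x.
Proof. by rewrite /transp => /negPf-> /negPf->. Qed.

Lemma transp_eq i j x y : (transp i j x == y) = (x == transp i j y).
Proof. by rewrite -[in LHS](transpK i j y) (inj_eq (can_inj (transpK i j))). Qed.
End Transposition.

Section Roots.
Variables (G : groupType) (n p : nat) (A a z u v : G).
Hypotheses (n_ge2 : 2 <= n) (p_odd : odd p).
Hypothesis rB : typeB_relations n p A a z u v.

Definition short (x : nat * bool) : G :=
  (if x.2 then a else (a ^ z)^-1) ^ (v ^+ x.1).
Definition swapel i : G := u ^ (v ^+ i).
Definition flipel i : G := z ^ (v ^+ i).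
Definition long x y : G := [~ short x, short y] ^+ p.+1./2.
Definition opp (x : nat * bool) := (x.1, ~~ x.2).

Let zvn : commute z (v ^+ n).
Proof.
rewrite (rB_vn rB); apply: commuteX.
have -> : v * u = v * u^-1 * u ^+ 2 by rewrite expg2 !gnorm.
by apply: commuteM; [exact: rB_zvu rB|exact: rB_zuu rB].
Qed.

Let az : commute (a ^ z) (v * u^-1).
Proof.
by have := commuteJ z (rB_avu rB); rewrite (conj_commute (commute_sym (rB_zvu rB))).
Qed.

Let ad : a ^ (u ^+ 2) = a^-1.
Proof. by case: rB => *; apply: (@short_root_inv _ p A a z u). Qed.

Let Ac : commute A (a ^ (z * u)).
Proof. by case: rB => *; apply: (@long_root_comm_short _ p A a z u). Qed.

Let A2 : A ^+ 2 = [~ a, (a ^ (z * u))^-1].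
Proof. by case: rB => *; apply: (@long_root_square _ p A a z u). Qed.

Let xu x : commute x (v * u^-1) -> x ^ u = x ^ v.
Proof.
move=> xvu; have e : v = v * u^-1 * u by rewrite mulgVK.
by rewrite e conjgM (conj_commute xvu).
Qed.

Let cE : short (1%N, false) = (a ^ (z * u))^-1.
Proof. by rewrite /short /= expg1 conjVg -(xu az) -conjgM. Qed.

Let zz : z * z = 1. Proof. by rewrite -expg2 (rB_z2 rB). Qed.
Let zzu : z ^ u = z ^ v. Proof. exact: xu (rB_zvu rB). Qed.

(* the two root elements, a and its image under z, from which all the short
   root elements are obtained by conjugation with powers of v *)
Let base s := if s then a else (a ^ z)^-1.
Let shortE i s : short (i, s) = base s ^ (v ^+ i). Proof. by []. Qed.

Let base_vu s : commute (base s) (v * u^-1).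
Proof. by case: s => /=; [exact: rB_avu rB|exact: commuteVl]. Qed.

Let base_uv s : 2 < n -> commute (base s) (u ^ v).
Proof.
move=> n3; have auv := rB_auv rB n3; have zuv := rB_zuv rB n3.
case: s => //=; apply: commuteVl; rewrite -(conj_commute (commute_sym zuv)).
exact: commuteJ.
Qed.

Let base_d s : base s ^ (u ^+ 2) = (base s)^-1.
Proof.
case: s => //=; rewrite conjVg -conjgM (rB_zuu rB) conjgM ad conjVg //.
Qed.

Let base_zu s : base s ^ (z ^ u) = (base s)^-1.
Proof.
have e : a ^ (z ^ u) = a^-1.
  have e := conj_commute (rB_a_cent rB); rewrite conjgM ad in e.
  by rewrite -[LHS]invgK -conjVg e.
by case: s => //=; rewrite conjVg -conjgM (rB_zzu rB) conjgM e conjVg.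
Qed.

Lemma short_exp x : short x ^+ p = 1.
Proof.
case: x => i s; rewrite shortE -conjXg; case: s => /=.
  by rewrite (rB_ap rB) conj1g.
by rewrite expVgn -conjXg (rB_ap rB) conj1g invg1 conj1g.
Qed.

Lemma swap_up i s : short (i, s) ^ swapel i = short (i.+1, s).
Proof. exact: (shift_r_up (base_vu s)). Qed.

Lemma swap_down i s : short (i.+1, s) ^ swapel i = (short (i, s))^-1.
Proof. by rewrite (shift_r_down (base_vu s)) base_d conjVg. Qed.

Lemma swap_fix i j s : i.+1 < n -> j < n -> j != i -> j != i.+1 ->
  short (j, s) ^ swapel i = short (j, s).
Proof.
by apply: (shift_r_fix (rB_uvn rB) (rB_far rB) (base_vu s) (base_uv s)).
Qed.

Lemma flip_same i s : short (i, s) ^ flipel i = (short (i, ~~ s))^-1.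
Proof.
rewrite !shortE -conjVg -conjJg; congr (_ ^ _).
case: s => /=; first by rewrite invgK.
by rewrite conjVg -conjgM zz conjg1.
Qed.

Lemma flip_other i j s : i < n -> j < n -> j != i ->
  short (j, s) ^ flipel i = (short (j, s))^-1.
Proof.
exact: (shift_flip (rB_uvn rB) (rB_far rB) (base_vu s) (rB_zvu rB)
         (rB_zuv rB) zvn (base_zu s)).
Qed.

Lemma flip_swap_up i : flipel i ^ swapel i = flipel i.+1.
Proof. exact: (shift_r_up (rB_zvu rB)). Qed.

Lemma flip_swap_down i : flipel i.+1 ^ swapel i = flipel i.
Proof.
rewrite (shift_r_down (rB_zvu rB)); congr (_ ^ _).
exact: conj_commute (rB_zuu rB).
Qed.

Lemma flip_square i : flipel i * flipel i = 1.
Proof. by rewrite -conjMg zz conj1g. Qed.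

Lemma flip_word i :
  flipel i = short (i, true) * (short (i, false))^-1 * short (i, true).
Proof. by rewrite !shortE -conjVg -!conjMg /= invgK -(rB_zE rB). Qed.

Lemma swap_braid i : i.+2 < n ->
  swapel i * swapel i.+1 * swapel i = swapel i.+1 * swapel i * swapel i.+1.
Proof.
by move=> ?; rewrite /swapel (expgS v i) conjgM -!conjMg (rB_braid rB) //; lia.
Qed.

(** ** Moving an arbitrary pair or triple of indices to the first ones *)

Definition realizes g (f : nat * bool -> nat * bool) :=
  forall x, x.1 < n -> (f x).1 < n /\ eqi (short x ^ g) (short (f x)).

Lemma realizesM g h f k : realizes g f -> realizes h k ->
  realizes (g * h) (fun x => k (f x)).
Proof.
move=> gf hk x /gf[/hk[lt kf] fx]; split=> //.
by rewrite conjgM; apply: eqi_trans kf; apply: eqiJ.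
Qed.

Lemma realizes_ext g f k : realizes g f ->
  (forall x, x.1 < n -> f x = k x) -> realizes g k.
Proof. by move=> gf fk x xn; rewrite -fk //; apply: gf. Qed.

Definition swapi i j (x : nat * bool) := (transp i j x.1, x.2).
Definition flipi i b (x : nat * bool) := (x.1, x.2 (+) (b && (x.1 == i))).

Lemma realize_adj i : i.+1 < n -> realizes (swapel i) (swapi i i.+1).
Proof.
move=> lt [j s] /= jn; rewrite /swapi /transp /=.
case: (eqVneq j i) => [->|ji]; first by rewrite swap_up; split=> //; left.
case: (eqVneq j i.+1) => [->|ji1]; last by rewrite swap_fix //; split=> //; left.
by rewrite swap_down; split; [exact: ltnW|right].
Qed.

Lemma realize_swap i j : i < n -> j < n -> exists g, realizes g (swapi i j).
Proof.
have H k : forall i, i + k < n -> exists g, realizes g (swapi i (i + k)).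
  elim: k => [|k IH] {}i lt.
    exists 1 => x xn; rewrite conjg1 /swapi /transp addn0; case: eqP => [<-|_].
      by case: x xn => /= *; split=> //; left.
    by case: x xn => /= *; split=> //; left.
  have [|g gP] := IH i; first by lia.
  have aP : realizes (swapel (i + k)) (swapi (i + k) (i + k).+1).
    by apply: realize_adj; lia.
  case: k => [|k] in lt g gP aP IH *.
    by exists (swapel i); rewrite addn1; apply: realize_adj; lia.
  exists (swapel (i + k.+1) * g * swapel (i + k.+1)).
  apply: realizes_ext (realizesM (realizesM aP gP) aP) _ => -[x s] /= xn.
  by rewrite /swapi /transp /=; congr (_, _); case_eqs; lia.
move=> ilt jlt; case: (leqP i j) => ij.
  by rewrite -(subnKC ij); apply: H; rewrite subnKC.
have [|g gP] := H (i - j) j; first by lia.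
exists g; apply: realizes_ext gP _ => -[x s] /= xn; rewrite subnKC; last exact: ltnW.
by rewrite /swapi /transp /=; congr (_, _); case_eqs; lia.
Qed.

Lemma realize_flip i b : i < n -> exists g, realizes g (flipi i b).
Proof.
move=> lt; case: b; last first.
  exists 1 => -[x s] /= xn; rewrite conjg1 /flipi /= addbF; split=> //; exact: eqi_refl.
exists (flipel i) => -[x s] /= xn; rewrite /flipi /=; split=> //.
case: (eqVneq x i) => [->|ne] /=; last by rewrite flip_other // addbF; right.
by rewrite flip_same addbT; right.
Qed.

(** Pairs and triples of distinct signed indices are moved to one another by
    monomial elements; only finitely many relations between root elements then
    have to be given. *)
Lemma realize_pair i s j s' : i < n -> j < n -> i != j ->
  exists g f, [/\ realizes g f,
    forall b, f (0%N, b) = (i, ~~ b (+) s), forall b, f (1%N, b) = (j, b (+) s')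
    & forall x, (f x).1 = transp 0 i (transp 1%N (transp 0 i j) x.1)].
Proof.
move=> ilt jlt ij.
have n0 : 0%N < n by lia.
have n1 : 1%N < n by lia.
have [g1 g1P] := realize_swap n1 (transp_lt n0 ilt jlt).
have [g2 g2P] := realize_swap n0 ilt.
have [g3 g3P] := realize_flip (~~ s) ilt.
have [g4 g4P] := realize_flip s' jlt.
have j0 : transp 0 i j != 0%N.
  by rewrite transp_eq transpL eq_sym.
exists (g1 * g2 * g3 * g4); eexists; split.
- by do 2![apply: realizesM; last eassumption]; apply: realizesM; eassumption.
- move=> b; rewrite /flipi /swapi /= (transp_fix (x := 0)) //; last by rewrite eq_sym.
  by rewrite transpL eqxx (negPf ij) andbT andbF addbF; congr (_, _); case: (b); case: (s).
- move=> b; rewrite /flipi /swapi /= transpL transpK eqxx.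
  by rewrite eq_sym (negPf ij) andbT andbF addbF.
- by [].
Qed.

Lemma realize_triple i s j s' k s'' : 2 < n ->
  i < n -> j < n -> k < n -> i != j -> i != k -> j != k ->
  exists g f, [/\ realizes g f, f (0%N, true) = (i, s), f (1%N, false) = (j, s')
    & f (2, true) = (k, s'')].
Proof.
move=> n3 ilt jlt klt ij ik jk.
have [g [f [gP f0 f1 fE]]] := realize_pair s s' ilt jlt ij.
pose k' := transp 1%N (transp 0 i j) (transp 0 i k).
have n0 : 0%N < n by lia.
have n1 : 1%N < n by lia.
have klt' : k' < n by do ![apply: transp_lt => //].
have j0 : transp 0 i j != 0%N.
  by rewrite transp_eq transpL eq_sym.
have k0 : k' != 0%N.
  rewrite transp_eq (transp_fix (x := 0)) //; last by rewrite eq_sym.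
  by rewrite transp_eq transpL eq_sym.
have k1 : k' != 1%N.
  by rewrite transp_eq transpL (inj_eq (can_inj (transpK 0 i))) eq_sym.
have [g1 g1P] := realize_swap n3 klt'.
have fk : (f (k', true)).1 = k by rewrite fE /= !transpK.
have [g2 g2P] := realize_flip (s'' (+) (f (k', true)).2) klt.
exists (g1 * g * g2); eexists; split.
- by apply: realizesM; last eassumption; apply: realizesM; eassumption.
- rewrite /swapi /= transp_fix //; last by rewrite eq_sym.
  by rewrite f0 /flipi /= (negPf ik) andbF addbF.
- rewrite /swapi /= transp_fix //; last by rewrite eq_sym.
  by rewrite f1 /flipi /= (negPf jk) andbF addbF.
- rewrite /swapi /= transpL; case: (f _) fk => _ b /= ->.
  by rewrite /flipi /= eqxx andbT; congr (_, _); case: (b); case: (s'').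
Qed.

(** ** The commutator relations between root elements *)

Let base_comm : [~ short (0%N, true), short (1%N, false)] = A ^+ 2.
Proof. by rewrite cE /short /= expg0 conjg1 A2. Qed.

Let base_class2 : class2 (short (0%N, true)) (short (1%N, false)).
Proof.
rewrite /class2 base_comm cE /short /= expg0 conjg1.
by split; apply: commuteX; apply: commute_sym; [exact: rB_g rB|apply: commuteV].
Qed.

Lemma short_class2 x y : x.1 < n -> y.1 < n -> x.1 != y.1 ->
  class2 (short x) (short y) /\ [~ short x, short y] ^+ p = 1.
Proof.
case: x y => i s [j s'] /= ilt jlt ij.
have [g [f [gP f0 f1 _]]] := realize_pair s s' ilt jlt ij.
have [_ ex] := gP (0%N, true) (ltnW n_ge2).
have [_ ey] := gP (1%N, false) n_ge2.
rewrite f0 in ex; rewrite f1 in ey.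
have [c e] := class2_eqi ex ey (class2J g base_class2).
split=> //; have [_ ep] : True /\ eqi (A ^+ 2 ^+ p) 1.
  by split=> //; left; rewrite expgnAC (rB_Ap rB) expg1n.
rewrite -conjRg base_comm in e; case: (eqi_sym e) => ->.
  by rewrite -conjXg expgnAC (rB_Ap rB) expg1n conj1g.
by rewrite expVgn -conjXg expgnAC (rB_Ap rB) expg1n conj1g invg1.
Qed.

Lemma long_square x y : x.1 < n -> y.1 < n -> x.1 != y.1 ->
  [~ short x, short y] = long x y ^+ 2.
Proof.
move=> xn yn xy; have [_ e] := short_class2 xn yn xy.
by rewrite /long expgnAC sqrt_expg.
Qed.

Lemma long_exp x y : x.1 < n -> y.1 < n -> x.1 != y.1 -> long x y ^+ p = 1.
Proof.
move=> xn yn xy; have [_ e] := short_class2 xn yn xy.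
by rewrite /long expgnAC e expg1n.
Qed.

Lemma long_sym x y : long y x = (long x y)^-1.
Proof. by rewrite /long -invgR expVgn. Qed.

Lemma long_conj g x y x' y' : x.1 < n -> y.1 < n -> x.1 != y.1 ->
  eqi (short x ^ g) (short x') -> eqi (short y ^ g) (short y') ->
  eqi (long x y ^ g) (long x' y').
Proof.
move=> xn yn xy ex ey; have [c _] := short_class2 xn yn xy.
have [_ e] := class2_eqi ex ey (class2J g c).
by rewrite /long conjXg conjRg; apply: eqiX.
Qed.

Lemma longE : long (0%N, true) (1%N, false) = A.
Proof. by rewrite /long base_comm sqrt_expg // (rB_Ap rB). Qed.

Lemma long_short x y : x.1 < n -> y.1 < n -> x.1 != y.1 ->
  commute (long x y) (short x).
Proof.
move=> xn yn xy; have [[c _] _] := short_class2 xn yn xy.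
by apply: commute_sym; apply: commuteX.
Qed.

Lemma long_long_opp x y : x.1 < n -> y.1 < n -> x.1 != y.1 ->
  commute (long x y) (long x (opp y)).
Proof.
case: x y => i s [j s'] /= ilt jlt ij; rewrite /opp /=.
have [g [f [gP f0 f1 _]]] := realize_pair s s' ilt jlt ij.
have n0 : 0%N < n by lia.
have [_] := gP (0%N, true) n0; rewrite f0 => ex.
have [_] := gP (1%N, false) n_ge2; rewrite f1 => ey.
have [_] := gP (1%N, true) n_ge2; rewrite f1 => ey'.
apply: eqi_commute (long_conj _ _ _ ex ey) (long_conj _ _ _ ex ey') _ => //.
apply: commuteJ; rewrite longE.
apply: eqi_commute (eqi_refl _) _ (rB_e rB).
rewrite zzu -{1}longE -[v]expg1; apply: long_conj => //.
  by rewrite flip_other //; apply: eqi_V.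
by rewrite flip_same; apply: eqi_V.
Qed.

Let swap0 : swapel 0 = u. Proof. by rewrite /swapel expg0 conjg1. Qed.

Let short_v i s : short (i, s) ^ v = short (i.+1, s).
Proof. by rewrite !shortE expgSr conjgM. Qed.

Let short0 s : short (0%N, s) = base s.
Proof. by rewrite shortE expg0 conjg1. Qed.

Lemma long_long x y x' : 2 < n -> x.1 < n -> y.1 < n -> x'.1 < n ->
  x.1 != y.1 -> x.1 != x'.1 -> y.1 != x'.1 ->
  commute (long x y) (long x x').
Proof.
case: x y x' => i s [j s'] [k s''] /= n3 ilt jlt klt ij ik jk.
have [g [f [gP f0 f1 f2]]] := realize_triple s s' s'' n3 ilt jlt klt ij ik jk.
have n0 : 0%N < n by lia.
have [_] := gP (0%N, true) n0; rewrite f0 => ex.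
have [_] := gP (1%N, false) n_ge2; rewrite f1 => ey.
have [_] := gP (2, true) n3; rewrite f2 => ew.
apply: eqi_commute (long_conj _ _ _ ex ey) (long_conj _ _ _ ex ew) _ => //.
apply: commuteJ.
have e1 : eqi (A ^ (v * u^-1)) (long (0%N, true) (2, false)).
  rewrite -{1}longE; apply: long_conj => //; left.
    by rewrite short0 (conj_commute (base_vu true)).
  rewrite conjgM short_v -swap0.
  by rewrite -{1}(@swap_fix 0 2 false) // conjgK.
have e2 : eqi (long (0%N, true) (1%N, false) ^ flipel 2)
              (long (0%N, true) (1%N, false)).
  by apply: long_conj => //; rewrite flip_other //; apply: eqi_V.
rewrite longE in e2.
have e3 : eqi (long (0%N, true) (2, false) ^ flipel 2) (long (0%N, true) (2, true)).
  apply: long_conj => //; first by rewrite flip_other //; apply: eqi_V.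
  by rewrite flip_same; apply: eqi_V.
rewrite longE; apply: eqi_commute e2 e3 _; apply: commuteJ.
exact: eqi_commute (eqi_refl _) e1 (rB_b rB n3).
Qed.

Lemma long_short_disjoint x y x' : 2 < n -> x.1 < n -> y.1 < n -> x'.1 < n ->
  x.1 != y.1 -> x.1 != x'.1 -> y.1 != x'.1 -> commute (long x y) (short x').
Proof.
case: x y x' => i s [j s'] [k s''] /= n3 ilt jlt klt ij ik jk.
have [g [f [gP f0 f1 f2]]] := realize_triple s s' s'' n3 ilt jlt klt ij ik jk.
have n0 : 0%N < n by lia.
have [_] := gP (0%N, true) n0; rewrite f0 => ex.
have [_] := gP (1%N, false) n_ge2; rewrite f1 => ey.
have [_] := gP (2, true) n3; rewrite f2 => ew.
apply: eqi_commute (long_conj _ _ _ ex ey) ew _ => //.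
by apply: commuteJ; rewrite longE; exact: rB_j rB n3.
Qed.

(** The commutator of a long root element with a short root element at an
    obtuse angle, up to the signs of the four root elements involved. *)
Lemma long_short_opp x y : x.1 < n -> y.1 < n -> x.1 != y.1 ->
  exists X T Y W, [/\ eqi X (long x y), eqi T (short (opp x)),
    eqi Y (long (opp x) y), eqi W (short y) & [~ X, T] = Y * W].
Proof.
case: x y => i s [j s'] /= ilt jlt ij; rewrite /opp /=.
have [g [f [gP f0 f1 _]]] := realize_pair (~~ s) s' ilt jlt ij.
have n0 : 0%N < n by lia.
have [_] := gP (0%N, true) n0; rewrite f0 /= => ex.
have [_] := gP (0%N, false) n0; rewrite f0 /= negbK => ex'.
have [_] := gP (1%N, false) n_ge2; rewrite f1 /= => ey.
have e1 : eqi (A ^ z) (long (0%N, false) (1%N, false)).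
  rewrite -{1}longE -[z]conjg1 -[1]/(v ^+ 0); apply: long_conj => //.
    by rewrite flip_same; apply: eqi_V.
  by rewrite flip_other //; apply: eqi_V.
exists ((A ^ z) ^ g), (short (0%N, true) ^ g), (A ^ g), ((short (1%N, false))^-1 ^ g).
split.
- by apply: eqi_trans (eqiJ g e1) _; apply: long_conj.
- exact: ex.
- by rewrite -{1}longE; apply: long_conj.
- by rewrite conjVg; apply: eqi_trans ey; apply: eqi_V.
- by rewrite -conjRg -conjMg short0 (rB_h rB) cE invgK.
Qed.

(** ** The subgroups SL(2, p) of adjacent long roots *)

Lemma long_adj i : long (i, true) (i.+1, false) = A ^ (v ^+ i).
Proof.
have sv s j : short (j.+1, s) = short (1%N, s) ^ (v ^+ j).
  by rewrite !shortE -conjgM -expgnDr.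
by rewrite -longE /long !conjXg conjRg sv !shortE expg0 conjg1.
Qed.

Lemma long_adj_opp i : i.+1 < n ->
  long (i, false) (i.+1, true) = long (i, true) (i.+1, false) ^ swapel i.
Proof.
move=> lt; have ltS := ltnW lt.
rewrite /long conjXg conjRg swap_up swap_down commgV_class2 ?invgR //.
by case: (@short_class2 (i.+1, true) (i, false)); rewrite //= gtn_eqF.
Qed.

Lemma swap_word i : i.+1 < n ->
  swapel i = long (i, true) (i.+1, false) * long (i, false) (i.+1, true)
               * long (i, true) (i.+1, false).
Proof.
move=> lt; rewrite long_adj_opp // long_adj /swapel -conjJg -!conjMg.
by rewrite -(rB_uE rB).
Qed.

Lemma generators_short (H : G -> Prop) : H 1 ->
  (forall x y, H x -> H y -> H (x * y^-1)) ->
  (forall x, x.1 < n -> H (short x)) -> [/\ H A, H a, H z, H u & H v].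
Proof.
move=> H1 HB Hs.
have HV x : H x -> H x^-1 by move=> /(HB _ _ H1); rewrite mul1g.
have HM x y : H x -> H y -> H (x * y) by move=> Hx /HV/(HB _ _ Hx); rewrite invgK.
have HX k x : H x -> H (x ^+ k).
  by move=> Hx; elim: k => // k IH; rewrite expgS; apply: HM.
have Hl x y : x.1 < n -> y.1 < n -> H (long x y).
  by move=> /Hs Hx /Hs Hy; 
  exact: HX (HM _ _ (HV _ Hx) (HM _ _ (HV _ Hy) (HM _ _ Hx Hy))).
have Hr i : i.+1 < n -> H (swapel i).
  by move=> lt; rewrite swap_word //; apply: (HM); [apply: (HM)|];
    apply: Hl => //=; first [exact: ltnW|lia].
have n0 : 0%N < n by lia.
split.
- by rewrite -longE; apply: Hl.
- by have := Hs (0%N, true) n0; rewrite short0.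
- rewrite -[z]conjg1 -[1]/(v ^+ 0) -/(flipel 0) flip_word.
  by apply: (HM); [apply: (HM); last apply: (HV)|]; apply: Hs.
- by rewrite -swap0; apply: Hr.
- have E k : k < n -> H (v ^- k * (v * u) ^+ k).
    elim: k => [|k IH] lt; first by rewrite !expg0 invg1 mulg1.
    have -> : v ^- k.+1 * (v * u) ^+ k.+1 = swapel k * (v ^- k * (v * u) ^+ k).
      by rewrite (expgS (v * u)) (expgS v) invgM /swapel /conjg !gnorm.
    by apply: (HM); [apply: Hr | apply: IH; apply: ltnW].
  have vE : v ^+ n = v ^+ n.-1 * v by rewrite -expgSr prednK.
  by have := E n.-1; rewrite -(rB_vn rB) vE mulKg; apply; rewrite prednK.
Qed.

End Roots.

Section Subgroups.
Variable G : groupType.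
Implicit Types (H S : G -> Prop) (x y : G).

Record subgroup H : Prop := {
  sub1 : H 1;
  subM : forall x y, H x -> H y -> H (x * y);
  subV : forall x, H x -> H x^-1 }.

Lemma subX H x k : subgroup H -> H x -> H (x ^+ k).
Proof.
move=> sH Hx; elim: k => [|k IH]; first exact: (sub1 sH).
by rewrite expgS; apply: (subM sH).
Qed.

Lemma subJ H x y : subgroup H -> H x -> H y -> H (x ^ y).
Proof. by move=> sH Hx Hy; apply: (subM sH (subV sH Hy)); apply: (subM sH). Qed.

Lemma sub_eqi H x y : subgroup H -> eqi x y -> H y -> H x.
Proof. by move=> sH [->|->] // /(subV sH). Qed.

Variant gen S x : Prop :=
  Gen of forall H, subgroup H -> (forall y, S y -> H y) -> H x.

Lemma gen_min S H x : subgroup H -> (forall y, S y -> H y) -> gen S x -> H x.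
Proof. by move=> sH SH [genx]; apply: genx. Qed.

Lemma mem_gen S x : S x -> gen S x.
Proof. by move=> Sx; split=> H _; apply. Qed.

Lemma gen_subgroup S : subgroup (gen S).
Proof.
split=> [|x y Sx Sy|x Sx]; split=> H sH SH; first exact: (sub1 sH).
  by apply: (subM sH); apply: gen_min SH _.
by apply: (subV sH); apply: gen_min SH _.
Qed.

Definition finite_order x := exists k, x ^+ k.+1 = 1.

Lemma finite_orderV x : finite_order x -> exists k, x^-1 = x ^+ k.
Proof.
by case=> k xk; exists k; apply: (@mulgI _ x); rewrite mulgV -expgS xk.
Qed.

Lemma exp_finite_order x p : (0 < p)%N -> x ^+ p = 1 -> finite_order x.
Proof. by case: p => // p _ xp; exists p. Qed.

(** Generators of finite order generate multiplicatively. *)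
Lemma gen_right S H x : (forall y, S y -> finite_order y) -> H 1 ->
  (forall z y, H z -> S y -> H (z * y)) -> gen S x -> H x.
Proof.
move=> oS H1 HM Sx; rewrite -[x]mul1g.
suff [e _] : (forall z, H z -> H (z * x)) /\ (forall z, H z -> H (z * x^-1)) by exact: e.
apply: (gen_min (H := fun x => _) _ _ Sx).
- split=> [|y t [y1 y2] [t1 t2]|y [y1 y2]].
  + by split=> z; rewrite ?invg1 mulg1.
  + by split=> z Hz; rewrite ?invgM mulgA; auto.
  + by rewrite invgK.
- move=> y Sy; split=> z; first by move=> Hz; apply: HM.
  have [k ->] := finite_orderV (oS _ Sy); elim: k z => [|k IH] z Hz.
    by rewrite mulg1.
  by rewrite expgS mulgA; apply: IH; apply: HM.
Qed.

Definition normalises (H : G -> Prop) y := forall x, H x -> H (x ^ y).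

(* elements of finite order: conjugation need only be tested in one direction *)
Lemma normalises_gen S S' : (forall y, S' y -> finite_order y) ->
  (forall x y, S x -> S' y -> gen S (x ^ y)) ->
  forall y, gen S' y -> normalises (gen S) y.
Proof.
move=> oS' SS' y; apply: (gen_right (H := normalises (gen S))) => //.
  by move=> x; rewrite conjg1.
move=> z t nz S't x /nz; rewrite conjgM; move: (x ^ z) => {}x.
apply: (gen_min (H := fun x => gen S (x ^ t))); last by move=> r Sr; apply: SS'.
have sS := gen_subgroup S; split=> [|r q Hr Hq|r Hr].
- by rewrite conj1g; exact: (sub1 sS).
- by rewrite conjMg; apply: (subM sS).
- by rewrite conjVg; apply: (subV sS).
Qed.

Lemma normalises_one S y : (forall x, S x -> gen S (x ^ y)) -> normalises (gen S) y.
Proof.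
move=> Sy x; apply: (gen_min (H := fun x => gen S (x ^ y))) => //.
have sS := gen_subgroup S; split=> [|r q Hr Hq|r Hr].
- by rewrite conj1g; exact: (sub1 sS).
- by rewrite conjMg; apply: (subM sS).
- by rewrite conjVg; apply: (subV sS).
Qed.

Lemma conj_gen S H y : subgroup H -> (forall x, S x -> H (x ^ y)) ->
  forall x, gen S x -> H (x ^ y).
Proof.
move=> sH Sy x; apply: (gen_min (H := fun x => H (x ^ y))) => //.
split=> [|r q Hr Hq|r Hr].
- by rewrite conj1g; exact: (sub1 sH).
- by rewrite conjMg; apply: (subM sH).
- by rewrite conjVg; apply: (subV sH).
Qed.

Lemma commute_gen S S' x y : (forall x y, S x -> S' y -> commute x y) ->
  gen S x -> gen S' y -> commute x y.
Proof.
move=> c Sx; apply: (gen_min (H := commute x)) => [|{}y S'y].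
  by split=> [|r q|r]; [exact: commute1 | exact: commuteM | exact: commuteV].
apply: commute_sym; apply: (gen_min (H := commute y)) Sx => [|{}x Sx].
  by split=> [|r q|r]; [exact: commute1 | exact: commuteM | exact: commuteV].
by apply: commute_sym; apply: c.
Qed.

Lemma gen_sub S S' : (forall x, S x -> gen S' x) -> forall x, gen S x -> gen S' x.
Proof. by move=> SS' x; apply: gen_min => //; apply: gen_subgroup. Qed.

End Subgroups.

Section DerivedSubgroup.
Local Open Scope group_scope.
Variables (gT : finGroupType) (H K : {group gT}).

Lemma group_subgroup : subgroup (fun x => x \in H).
Proof. by split=> [|x y|x]; [exact: group1 | exact: groupM | rewrite groupV]. Qed.

Lemma der1_commgX x y k : x \in H -> y \in H -> [~ x, y] ^+ k \in H^`(1).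
Proof. by move=> Hx Hy; apply: groupX; apply: mem_commg. Qed.

Lemma der1_sub : (forall x y, x \in H -> y \in H -> [~ x, y] \in K) ->
  forall x, x \in H^`(1) -> x \in K.
Proof.
move=> HK; apply/fintype.subsetP; rewrite derg1 gen_subG.
by apply/fintype.subsetP=> _ /imset2P[x y Hx Hy ->]; apply: HK.
Qed.
End DerivedSubgroup.

Section RootData.
Local Notation idx := (nat * bool)%type.

(** The relations between root elements, as they are used below: t x is the
    short root element and S x y the long root element of signed indices, r i
    interchanges the indices i and i.+1, and q i changes the sign of i. *)
Record root_data (G : groupType) (n p : nat) (t : idx -> G) (S : idx -> idx -> G)
    (r q : nat -> G) : Prop := {
  rd_texp : forall x, t x ^+ p = 1;
  rd_Sdef : forall x y, S x y = [~ t x, t y] ^+ p.+1./2;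
  rd_Sexp : forall x y, x.1 < n -> y.1 < n -> x.1 != y.1 -> S x y ^+ p = 1;
  rd_Ssym : forall x y, S y x = (S x y)^-1;
  rd_Sconj : forall g x y x' y', x.1 < n -> y.1 < n -> x.1 != y.1 ->
    eqi (t x ^ g) (t x') -> eqi (t y ^ g) (t y') -> eqi (S x y ^ g) (S x' y');
  rd_tt : forall x y, x.1 < n -> y.1 < n -> x.1 != y.1 ->
    [~ t x, t y] = S x y ^+ 2;
  rd_St : forall x y, x.1 < n -> y.1 < n -> x.1 != y.1 -> commute (S x y) (t x);
  rd_SSopp : forall x y, x.1 < n -> y.1 < n -> x.1 != y.1 ->
    commute (S x y) (S x (opp y));
  rd_SS : forall x y y', x.1 < n -> y.1 < n -> y'.1 < n ->
    x.1 != y.1 -> x.1 != y'.1 -> y.1 != y'.1 -> commute (S x y) (S x y');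
  rd_St_disjoint : forall x y y', x.1 < n -> y.1 < n -> y'.1 < n ->
    x.1 != y.1 -> x.1 != y'.1 -> y.1 != y'.1 -> commute (S x y) (t y');
  rd_St_opp : forall x y, x.1 < n -> y.1 < n -> x.1 != y.1 ->
    exists X T Y W, [/\ eqi X (S x y), eqi T (t (opp x)),
      eqi Y (S (opp x) y), eqi W (t y) & [~ X, T] = Y * W];
  rd_up : forall i s, t (i, s) ^ r i = t (i.+1, s);
  rd_down : forall i s, t (i.+1, s) ^ r i = (t (i, s))^-1;
  rd_fix : forall i j s, i.+1 < n -> j < n -> j != i -> j != i.+1 ->
    t (j, s) ^ r i = t (j, s);
  rd_flip : forall i s, t (i, s) ^ q i = (t (i, ~~ s))^-1;
  rd_flip_other : forall i j s, i < n -> j < n -> j != i ->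
    t (j, s) ^ q i = (t (j, s))^-1;
  rd_q_up : forall i, q i ^ r i = q i.+1;
  rd_q_down : forall i, q i.+1 ^ r i = q i;
  rd_qq : forall i, q i * q i = 1;
  rd_q_word : forall i, q i = t (i, true) * (t (i, false))^-1 * t (i, true);
  rd_braid : forall i, i.+2 < n -> r i * r i.+1 * r i = r i.+1 * r i * r i.+1;
  rd_adj_opp : forall i, i.+1 < n ->
    S (i, false) (i.+1, true) = S (i, true) (i.+1, false) ^ r i;
  rd_r_word : forall i, i.+1 < n -> r i =
    S (i, true) (i.+1, false) * S (i, false) (i.+1, true) * S (i, true) (i.+1, false);
  rd_r4 : forall i, r i ^+ 4 = 1 }.

Lemma typeB_root_data (G : groupType) (n p : nat) (A a z u v : G) : 2 <= n -> odd p ->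
  typeB_relations n p A a z u v ->
  root_data n p (short a z v) (long p a z v) (swapel u v) (flipel z v).
Proof.
move=> n2 op rB; split=> //.
all: try by move=> *; first [exact: (short_exp rB) | exact: (long_exp n2 op rB)
  | exact: (long_sym) | exact: (long_conj n2 op rB)| exact: (long_square n2 op rB)
  | exact: (long_short n2 op rB) | exact: (long_long_opp n2 op rB)
  | exact: (long_long n2 op rB) | exact: (long_short_disjoint n2 op rB)
  | exact: (long_short_opp n2 op rB) | exact: (swap_up rB) | exact: (swap_down n2 op rB)
  | exact: (swap_fix n2 op rB) | exact: (flip_same rB) | exact: (flip_other n2 op rB)
  | exact: (flip_swap_up rB) | exact: (flip_swap_down rB) | exact: (flip_square rB)
  | exact: (flip_word rB) | exact: (swap_braid rB)
  | exact: (long_adj_opp n2 op rB) | exact: (swap_word n2 op rB)].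
- by move=> x y y' xn yn y'n xy xy' yy'; apply: (long_long n2 op rB) => //; lia.
- by move=> x y y' xn yn y'n xy xy' yy'; apply: (long_short_disjoint n2 op rB) => //; lia.
- exact: (swap_down op rB).
- exact: (swap_fix rB).
- exact: (flip_other op rB).
- exact: (swap_braid n2 op rB).
- by move=> i; rewrite /swapel -conjXg (rB_u4 rB) conj1g.
Qed.
End RootData.

Section Structure.
Local Notation idx := (nat * bool)%type.
Variables (G : groupType) (n p : nat) (t : idx -> G) (S : idx -> idx -> G).
Variables (r q : nat -> G).
Hypotheses (p_gt0 : 0 < p) (rd : root_data n p t S r q).
Implicit Types (x y : idx) (g h : G).

Let t_fin x : finite_order (t x).
Proof. exact: exp_finite_order p_gt0 (rd_texp rd x). Qed.
Let S_fin x y : x.1 < n -> y.1 < n -> x.1 != y.1 -> finite_order (S x y).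
Proof. by move=> *; apply: exp_finite_order p_gt0 (rd_Sexp rd _ _ _). Qed.

Lemma swapV i : finite_order (r i).
Proof. by exists 3; exact: (rd_r4 rd). Qed.

Lemma finite_orderVV g : finite_order g -> finite_order g^-1.
Proof. by case=> k gk; exists k; rewrite expVgn gk invg1. Qed.

(** ** The subgroups of smaller rank *)

Definition shorts l g := exists2 x, x.1 < l & g = t x.
Definition Gn l := gen (shorts l).

Lemma Gn_sub l : subgroup (Gn l). Proof. exact: gen_subgroup. Qed.
Lemma Gn_t l x : x.1 < l -> Gn l (t x). Proof. by move=> xl; apply: mem_gen; exists x. Qed.
Lemma Gn_S l x y : x.1 < l -> y.1 < l -> Gn l (S x y).
Proof.
move=> /Gn_t Gx /Gn_t Gy; rewrite (rd_Sdef rd); have sG := Gn_sub l.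
by apply: (subX _ sG); apply: (subM sG); [apply: (subV sG)|apply: (subJ sG)].
Qed.
Lemma Gn_mono l m g : l <= m -> Gn l g -> Gn m g.
Proof.
move=> lm; apply: gen_sub => _ [x xl ->]; apply: Gn_t; exact: leq_trans lm.
Qed.
Lemma shorts_fin l g : shorts l g -> finite_order g.
Proof. by case=> x _ ->. Qed.

Lemma Gn_q l i : i < l -> Gn l (q i).
Proof.
move=> il; rewrite (rd_q_word rd); have sG := Gn_sub l.
by apply: (subM sG); [apply: (subM sG); last apply: (subV sG)|]; apply: Gn_t.
Qed.
Lemma Gn_r l i : i.+1 < l -> i.+1 < n -> Gn l (r i).
Proof.
move=> il ilt; rewrite (rd_r_word rd) //; have sG := Gn_sub l; have il' := ltnW il.
by apply: (subM sG); [apply: (subM sG)|]; apply: Gn_S.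
Qed.

Lemma S_eqi x y : eqi (S x y) (S y x).
Proof. by right; rewrite (rd_Ssym rd). Qed.

Lemma opp_fst x : (opp x).1 = x.1. Proof. by []. Qed.
Lemma oppK x : opp (opp x) = x. Proof. by case: x => i s; rewrite /opp /= negbK. Qed.

(** ** The unipotent radicals *)

Definition radgen l g := (g = t (l, true)) \/ (exists2 c, c.1 < l & g = S (l, true) c).
Definition Q l := gen (radgen l).

Lemma Q_sub l : subgroup (Q l). Proof. exact: gen_subgroup. Qed.
Lemma Q_t l : Q l (t (l, true)). Proof. by apply: mem_gen; left. Qed.
Lemma Q_S l c : c.1 < l -> Q l (S (l, true) c).
Proof. by move=> cl; apply: mem_gen; right; exists c. Qed.

Lemma radgen_fin l g : l < n -> radgen l g -> finite_order g.
Proof.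
move=> ln [->|[c cl ->]] //; apply: S_fin => //=; [exact: ltn_trans ln|].
by rewrite gtn_eqF.
Qed.

Lemma radgen_exp l g : l < n -> radgen l g -> g ^+ p = 1.
Proof.
move=> ln [->|[c cl ->]]; first exact: (rd_texp rd).
by apply: (rd_Sexp rd) => //=; [exact: ltn_trans ln|rewrite gtn_eqF].
Qed.

Lemma radgen_commute l g h : l < n -> radgen l g -> radgen l h -> commute g h.
Proof.
move=> ln; have lt c : c.1 < l -> c.1 < n by move=> cl; exact: ltn_trans ln.
have ne c : c.1 < l -> l != c.1 by move=> cl; rewrite gtn_eqF.
have St c : c.1 < l -> commute (S (l, true) c) (t (l, true)).
  by move=> cl; apply: (rd_St rd) => //=; auto.
move=> [->|[c cl ->]] [->|[d dl ->]] //.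
- by apply: commute_sym; apply: St.
- exact: St.
- case: c d cl dl => i s [j s'] /= il jl.
  case: (eqVneq i j) jl => [<-|ij] jl.
    case: (eqVneq s s') => [->|ss] //.
    have -> : (i, s') = opp (i, s) by rewrite /opp /=; case: (s) (s') ss => [] [].
    by apply: (rd_SSopp rd) => //=; [exact: lt (i, s) _|exact: ne (i, s) _].
  by apply: (rd_SS rd) => //=; [exact: lt (i, s) _|exact: lt (j, s') _|
    exact: ne (i, s) _|exact: ne (j, s') _].
Qed.

Lemma Q_commute l g h : l < n -> Q l g -> Q l h -> commute g h.
Proof. by move=> ln; apply: commute_gen => x y; apply: radgen_commute. Qed.

Lemma normalisesV (H : G -> Prop) g : finite_order g -> normalises H g ->
  normalises H g^-1.
Proof.
move=> /finite_orderV[k ->] Hy; elim: k => [|k IH] h Hh; first by rewrite conjg1.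
by rewrite expgS conjgM; apply/IH/Hy.
Qed.

(* the commutator relation at an obtuse angle is known for t x or its inverse *)
Let t_norm_Q l x : l < n -> x.1 < l -> exists2 T, eqi T (t x) & normalises (Q l) T.
Proof.
move=> ln xl; have sQ := Q_sub l.
have xn : x.1 < n := ltn_trans xl ln; have nlx : l != x.1 by rewrite gtn_eqF.
have nxl : x.1 != l by rewrite ltn_eqF.
have oxl : (opp x).1 < l by [].
have [X [T [Y [W [eX eT eY eW XT]]]]] := rd_St_opp rd (x := opp x) (y := (l, true)) xn ln nxl.
rewrite oppK in eT eY; exists T => //; apply: normalises_one => g.
have tE : t (l, true) ^ t x = t (l, true) * S (l, true) x ^+ 2.
  by rewrite -(rd_tt rd) //= commgEl mulVKg.
have Stx : commute (S (l, true) x) (t x).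
  by apply: eqi_commute (S_eqi _ _) (eqi_refl _) _; apply: (rd_St rd).
case=> [->|[c cl ->]].
  case: eT => ->; first by rewrite tE; apply: (subM sQ); [exact: Q_t|apply: (subX _ sQ); exact: Q_S].
  have -> : t (l, true) ^ (t x)^-1 = t (l, true) * S (l, true) x ^- 2.
    apply: (@conjg_inj _ (t x)); rewrite conjgKV conjMg tE conjVg conjXg.
    by rewrite (conj_commute Stx) mulgK.
  by apply: (subM sQ); [exact: Q_t|apply: (subV sQ); apply: (subX _ sQ); exact: Q_S].
have cn : c.1 < n := ltn_trans cl ln; have nlc : l != c.1 by rewrite gtn_eqF.
have cQ := Q_S cl; have tQ := Q_t l.
have [cx|ncx] := eqVneq c.1 x.1; last first.
  have cST : commute (S (l, true) c) (t x) by apply: (rd_St_disjoint rd).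
  by rewrite (conj_commute (eqi_commute (eqi_refl _) (eqi_sym eT) cST)).
have [->|->] : c = x \/ c = opp x.
- case: (c) (x) cx => i s [j s'] /= ->; rewrite /opp /=.
  by case: (s) (s') => [] []; [left|right|right|left].
- by rewrite (conj_commute (eqi_commute (eqi_refl _) (eqi_sym eT) Stx)); exact: Q_S.
have XQ : Q l (X ^ T).
  rewrite (commg_eq XT); have SQ := sub_eqi sQ (S_eqi _ _) (Q_S _).
  apply: (subM sQ); first by apply: (sub_eqi sQ eX); apply: SQ.
  by apply: (subM sQ); [apply: (sub_eqi sQ eY); apply: SQ|apply: (sub_eqi sQ eW)].
apply: (sub_eqi sQ _ XQ); apply: eqiJ; apply: eqi_trans (eqi_sym eX).
exact: S_eqi.
Qed.

Lemma Gn_norm_Q l g : l < n -> Gn l g -> normalises (Q l) g.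
Proof.
move=> ln; apply: (gen_right (H := normalises (Q l))) => [y|x|h y hQ [x xl ->]].
- exact: shorts_fin.
- by rewrite conjg1.
have [T eT TQ] := t_norm_Q ln xl.
have xQ : normalises (Q l) (t x).
  case: (eqi_sym eT) => ->; first exact: TQ.
  by apply: normalisesV => //; case: eT => ->; [|apply: finite_orderVV].
by move=> k /hQ /xQ; rewrite -conjgM.
Qed.
End Structure.

Local Close Scope group_scope.

Local Open Scope ring_scope.

Section Orthogonal.
Variables n p : nat.
Local Notation dim := n.*2.+1.
Local Notation F := 'F_p.
Local Notation V := 'rV[F]_dim.
Local Notation GL := {'GL_dim[F]}.
Local Notation be := (be n p).
Local Notation bf := (bf n p).
Local Notation bw := (bw n p).
Local Notation gram := (gram_mx n p).
Implicit Types (x y u : V) (g h : GL).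

(* bas and act are opaque, lest the matrices be computed when two vectors are
   compared. *)
Fact bas_subproof : {b : nat * bool -> V | forall a, b a = if a.2 then bf a.1 else be a.1}.
Proof. by exists (fun a => if a.2 then bf a.1 else be a.1). Qed.
Definition bas : nat * bool -> V := sval bas_subproof.
Lemma basE a : bas a = if a.2 then bf a.1 else be a.1.
Proof. exact: (svalP bas_subproof). Qed.

Definition in_basis b := b = bw \/ exists2 k, (k < n)%N & b = be k \/ b = bf k.

Lemma in_basis_delta (i : 'I_dim) : in_basis (delta_mx 0 i).
Proof.
have := ltn_ord i; rewrite ltnS leq_eqVlt => /predU1P[ei|lti].
  by left; rewrite /bw; congr delta_mx; apply: val_inj.
right; have lt2 : (i./2 < n)%N by lia.
exists i./2 => //; have := odd_double_half i; case: (odd i) => ei; [right|left].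
  by rewrite /Defs.bf -[X in inord X]/(true + i./2.*2)%N ei inord_val.
by rewrite /Defs.be -[X in inord X]/(false + i./2.*2)%N ei inord_val.
Qed.

Lemma basis_ext (M N : 'M[F]_dim) : (forall b, in_basis b -> b *m M = b *m N) -> M = N.
Proof.
by move=> MN; apply/row_matrixP=> i; rewrite !rowE; apply/MN/in_basis_delta.
Qed.

Definition dot x y : F := (x *m gram *m y^T) 0 0.

Lemma dotE x y : x *m gram *m y^T = (dot x y)%:M.
Proof. by rewrite [LHS]mx11_scalar. Qed.

Lemma dotDl x y u : dot (x + y) u = dot x u + dot y u.
Proof. by rewrite /dot !mulmxDl mxE. Qed.
Lemma dotDr x y u : dot u (x + y) = dot u x + dot u y.
Proof. by rewrite /dot linearD mulmxDr mxE. Qed.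
Lemma dotZl a x y : dot (a *: x) y = a * dot x y.
Proof. by rewrite /dot -!scalemxAl mxE. Qed.
Lemma dotZr a x y : dot x (a *: y) = a * dot x y.
Proof. by rewrite /dot linearZ /= -scalemxAr mxE. Qed.
Lemma dotNl x y : dot (- x) y = - dot x y.
Proof. by rewrite -scaleN1r dotZl mulN1r. Qed.
Lemma dotNr x y : dot x (- y) = - dot x y.
Proof. by rewrite -scaleN1r dotZr mulN1r. Qed.
Definition dotB := (dotDl, dotDr, dotNl, dotNr, dotZl, dotZr).

Lemma dot_be k y : (k < n)%N -> dot (be k) y = y 0 (inord k.*2.+1).
Proof.
by move=> lt; rewrite /dot be_linmx // /Defs.bf -rowE !mxE.
Qed.
Lemma dot_bf k y : (k < n)%N -> dot (bf k) y = y 0 (inord k.*2).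
Proof. by move=> lt; rewrite /dot bf_linmx // /Defs.be -rowE !mxE. Qed.
Lemma dot_bw y : dot bw y = - 2 * y 0 ord_max.
Proof. by rewrite /dot bw_linmx -scalemxAl mxE /Defs.bw -rowE !mxE. Qed.

Let inordE (i j : nat) : (i < dim)%N -> (j < dim)%N -> (inord i == inord j :> 'I_dim) = (i == j).
Proof. by move=> ? ?; rewrite -val_eqE /= !inordK. Qed.

Lemma dot_bas a c : (a.1 < n)%N -> (c.1 < n)%N ->
  dot (bas a) (bas c) = ((a.1 == c.1) && (a.2 != c.2))%:R.
Proof.
case: a c => i s [j s'] /= ilt jlt; rewrite !basE /=.
case: s; case: s'; rewrite ?dot_be ?dot_bf // /Defs.be /Defs.bf mxE eqxx inordE; try lia.
all: by congr _%:R; lia.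
Qed.

Lemma dot_bas_w a : (a.1 < n)%N -> dot (bas a) bw = 0.
Proof.
case: a => i s /= ilt; rewrite !basE /= /Defs.bw.
have e j : (j < n.*2)%N -> (inord j == ord_max :> 'I_dim) = false.
  by move=> lt; rewrite -val_eqE /= inordK; lia.
by case: s; rewrite ?dot_be ?dot_bf // mxE e ?andbF //; lia.
Qed.

Lemma dot_w_bas a : (a.1 < n)%N -> dot bw (bas a) = 0.
Proof.
case: a => i s /= ilt; rewrite dot_bw basE /=.
have e j : (j < n.*2)%N -> (ord_max == inord j :> 'I_dim) = false.
  by move=> lt; rewrite -val_eqE /= inordK; lia.
by case: s; rewrite /Defs.be /Defs.bf mxE e ?andbF ?mulr0 //; lia.
Qed.

Lemma dot_ww : dot bw bw = - 2.
Proof. by rewrite dot_bw mxE !eqxx mulr1. Qed.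

Lemma in_basisP b : in_basis b -> b = bw \/ exists2 a, (a.1 < n)%N & b = bas a.
Proof.
by case=> [|[k lt [->|->]]]; [by left|right; exists (k, false)|right; exists (k, true)] => //; rewrite basE.
Qed.

Lemma dot_delta (M : 'M[F]_dim) i j :
  (M *m gram *m M^T) i j = dot (delta_mx 0 i *m M) (delta_mx 0 j *m M).
Proof.
pose d i : V := delta_mx 0 i; rewrite -/(d i) -/(d j).
have e : d i *m M *m gram *m (d j *m M)^T = d i *m (M *m gram *m M^T) *m (d j)^T.
  by rewrite trmx_mul !mulmxA.
by rewrite /dot e trmx_delta -rowE -colE; move: (_ *m _) => N; rewrite !mxE.
Qed.

Lemma dotC x y : dot x y = dot y x.
Proof.
suff e : gram^T = gram.
  by rewrite /dot -[in LHS](trmxK (x *m _ *m _)) mxE !trmx_mul trmxK e mulmxA.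
have gE (i j : 'I_dim) : gram i j = dot (delta_mx 0 i) (delta_mx 0 j).
  by have := dot_delta 1%:M i j; rewrite trmx1 mul1mx !mulmx1.
apply/matrixP => i j; rewrite mxE !gE.
case/in_basisP: (in_basis_delta i) => [->|[a lta ->]];
  case/in_basisP: (in_basis_delta j) => [->|[c ltc ->]].
- by [].
- by rewrite dot_bas_w ?dot_w_bas.
- by rewrite dot_bas_w ?dot_w_bas.
- by rewrite !dot_bas // eq_sym [_.2 == _]eq_sym.
Qed.

(** ** Isometries *)

Fact act_subproof : {f : V -> GL -> V | forall x g, f x g = x *m GLval g}.
Proof. by exists (fun x g => x *m GLval g). Qed.
Definition act : V -> GL -> V := sval act_subproof.
Lemma act_mul x g : act x g = x *m GLval g.
Proof. exact: (svalP act_subproof). Qed.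

Lemma actM x g h : act x (g * h)%g = act (act x g) h.
Proof. by rewrite !act_mul GL_MxE mulmxA. Qed.
Lemma act1 x : act x 1%g = x. Proof. by rewrite act_mul GL_1E mulmx1. Qed.
Lemma actK g : cancel (act^~ g) (act^~ g^-1%g).
Proof. by move=> x; rewrite -actM mulgV act1. Qed.
Lemma actKV g : cancel (act^~ g^-1%g) (act^~ g).
Proof. by move=> x; rewrite -actM mulVg act1. Qed.
Lemma actD x y g : act (x + y) g = act x g + act y g.
Proof. by rewrite !act_mul mulmxDl. Qed.
Lemma actZ k x g : act (k *: x) g = k *: act x g.
Proof. by rewrite !act_mul scalemxAl. Qed.
Lemma actN x g : act (- x) g = - act x g.
Proof. by rewrite !act_mul mulNmx. Qed.
Definition actE := (actD, actZ, actN).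

Lemma GL_inj g h : GLval g = GLval h -> g = h.
Proof. exact: val_inj. Qed.

Lemma GL_ext g h : (forall b, in_basis b -> act b g = act b h) -> g = h.
Proof. by move=> gh; apply/GL_inj/basis_ext => b /gh; rewrite !act_mul. Qed.

Definition isom g := forall x y, dot (act x g) (act y g) = dot x y.

Lemma isomP g : reflect (isom g) (GLval g *m gram *m (GLval g)^T == gram).
Proof.
apply: (iffP eqP) => [e x y|ig].
  by rewrite /dot !act_mul trmx_mul -[in RHS]e !mulmxA.
apply/matrixP=> i j; rewrite dot_delta -!act_mul ig.
by have := dot_delta 1%:M i j; rewrite trmx1 mul1mx !mulmx1.
Qed.

Lemma isom_basis g : (forall b c, in_basis b -> in_basis c ->
  dot (act b g) (act c g) = dot b c) -> isom g.
Proof.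
move=> ig; apply/isomP/eqP/matrixP=> i j; rewrite dot_delta -!act_mul ig ?in_basis_delta //.
  by have := dot_delta 1%:M i j; rewrite trmx1 mul1mx !mulmx1.
exact: in_basis_delta.
exact: in_basis_delta.
Qed.

Lemma isomM g h : isom g -> isom h -> isom (g * h)%g.
Proof. by move=> ig ih x y; rewrite !actM ih ig. Qed.
Lemma isom1 : isom 1%g. Proof. by move=> x y; rewrite !act1. Qed.
Lemma isomV g : isom g -> isom g^-1%g.
Proof. by move=> ig x y; rewrite -ig !actKV. Qed.
Lemma isomX g k : isom g -> isom (g ^+ k)%g.
Proof. by move=> ig; elim: k => [|k IH]; [exact: isom1|rewrite expgS; apply: isomM]. Qed.
Lemma isomJ g h : isom g -> isom h -> isom (g ^ h)%g.
Proof. by move=> ig ih; exact: isomM (isomV ih) (isomM ig ih). Qed.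

(** ** Eichler transformations *)

(* half the norm of u *)
Definition qf u : F := dot u u / 2.

Definition eichler_mx x u : 'M[F]_dim :=
  1%:M + gram *m x^T *m u - gram *m u^T *m x - qf u *: (gram *m x^T *m x).

Lemma mul_eichler x u y : y *m eichler_mx x u =
  y + dot y x *: u - dot y u *: x - (qf u * dot y x) *: x.
Proof.
rewrite /eichler_mx !mulmxBr mulmxDr mulmx1 -scalemxAr !mulmxA !dotE.
by rewrite !mul_scalar_mx scalerA.
Qed.

Definition adapted x u := dot x x = 0 /\ dot u x = 0.

(* An opaque constant, lest eichler x u be unfolded when it is compared with
   another transformation. *)
Fact eichler_subproof : {E : V -> V -> GL |
  forall x u, eichler_mx x u \in unitmx -> GLval (E x u) = eichler_mx x u}.
Proof. by exists (fun x u => toGL (eichler_mx x u)) => x u; apply: toGLK. Qed.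

Definition eichler : V -> V -> GL := sval eichler_subproof.

Hypotheses (p_prime : prime p) (p_odd : odd p).

Lemma two_neq0 : 2 != 0 :> F.
Proof.
have := @pchar_Fp p p_prime => ch; rewrite -(dvdn_pcharf ch) dvdn_prime2 //.
by apply: contraTneq p_odd => ->.
Qed.

Lemma qf2 u : qf u + qf u = dot u u.
Proof. by rewrite /qf -mulrDl -mulr2n -[_ *+ 2]mulr_natr mulfK // two_neq0. Qed.

Lemma qfD u u' : qf (u + u') = qf u + qf u' + dot u u'.
Proof.
apply: (mulfI two_neq0); have := qf2 (u + u').
rewrite !dotB [dot u' u]dotC -!qf2 => e.
have -> : 2 * qf (u + u') = qf (u + u') + qf (u + u') by ring.
by rewrite e; ring.
Qed.

Lemma qfZ k u : qf (k *: u) = k ^+ 2 * qf u.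
Proof. by rewrite /qf !dotB; ring. Qed.

Lemma eichler_mxM x u u' : adapted x u -> adapted x u' ->
  eichler_mx x u *m eichler_mx x u' = eichler_mx x (u + u').
Proof.
move=> [xx ux] [_ u'x]; apply: basis_ext => y _.
rewrite mulmxA (mul_eichler x u) (mul_eichler x u') (mul_eichler x (u + u')).
rewrite !dotB xx ux [dot x u']dotC u'x qfD.
by apply/rowP=> i; rewrite !mxE; ring.
Qed.

Lemma eichler_mx0 x : eichler_mx x 0 = 1%:M.
Proof.
have d0 y : dot y 0 = 0 by rewrite -(scale0r y) dotZr mul0r.
apply: basis_ext => y _; rewrite mul_eichler /qf !d0 mul0r mul0r scaler0 scale0r.
by rewrite !subr0 addr0 mulmx1.
Qed.

Lemma adapted0 x u : adapted x u -> adapted x 0.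
Proof. by case=> xx _; split; rewrite // -(scale0r x) dotZl mul0r. Qed.
Lemma adaptedD x u u' : adapted x u -> adapted x u' -> adapted x (u + u').
Proof. by move=> [xx e] [_ e']; split; rewrite // dotDl e e' addr0. Qed.
Lemma adaptedZ k x u : adapted x u -> adapted x (k *: u).
Proof. by move=> [xx e]; split; rewrite // dotZl e mulr0. Qed.
Lemma adaptedN x u : adapted x u -> adapted x (- u).
Proof. by rewrite -scaleN1r; exact: adaptedZ. Qed.

Lemma eichlerE x u : adapted x u -> GLval (eichler x u) = eichler_mx x u.
Proof.
move=> xu; have e : eichler_mx x u *m eichler_mx x (- u) = 1%:M.
  by rewrite eichler_mxM ?addrN ?eichler_mx0 //; apply: adaptedN.
by have [uM _] := mulmx1_unit e; exact: (svalP eichler_subproof _ _ uM).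
Qed.

Lemma act_eichler x u y : adapted x u ->
  act y (eichler x u) = y + dot y x *: u - dot y u *: x - (qf u * dot y x) *: x.
Proof. by move=> xu; rewrite act_mul eichlerE // mul_eichler. Qed.

Lemma eichlerM x u u' : adapted x u -> adapted x u' ->
  (eichler x u * eichler x u')%g = eichler x (u + u').
Proof.
move=> xu xu'; apply: GL_inj; rewrite GL_MxE (eichlerE xu) (eichlerE xu').
by rewrite (eichlerE (adaptedD xu xu')) eichler_mxM.
Qed.

Lemma eichler0 x u : adapted x u -> eichler x 0 = 1%g.
Proof.
by move=> xu; apply: GL_inj; rewrite (eichlerE (adapted0 xu)) eichler_mx0.
Qed.

Lemma eichlerN x u : adapted x u -> eichler x (- u) = (eichler x u)^-1%g.
Proof.
move=> xu; apply: (@mulgI _ (eichler x u)); rewrite mulgV.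
by rewrite eichlerM ?addrN ?(eichler0 xu) //; apply: adaptedN.
Qed.

Lemma eichlerX x u k : adapted x u -> (eichler x u ^+ k)%g = eichler x (k%:R *: u).
Proof.
move=> xu; elim: k => [|k IH]; first by rewrite scale0r (eichler0 xu).
rewrite expgSr IH eichlerM //; last exact: adaptedZ.
by rewrite -[k.+1]addn1 natrD scalerDl scale1r.
Qed.

Lemma isom_eichler x u : adapted x u -> isom (eichler x u).
Proof.
move=> xu y y'; rewrite !act_eichler // !dotB; case: xu => xx ux.
by rewrite xx ux [dot u y']dotC [dot x y']dotC [dot x u]dotC ux -qf2; ring.
Qed.

Lemma adapted_act x u g : isom g -> adapted x u -> adapted (act x g) (act u g).
Proof. by rewrite /adapted => ig; rewrite !ig. Qed.

Lemma eichlerJ x u g : isom g -> adapted x u ->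
  (eichler x u ^ g)%g = eichler (act x g) (act u g).
Proof.
move=> ig xu; have xu' := adapted_act ig xu.
apply: (@mulgI _ g); rewrite -conjgC; apply: GL_ext => b _.
rewrite !actM (act_eichler _ xu) (act_eichler _ xu') !actE !ig.
by rewrite /qf ig.
Qed.
End Orthogonal.

Section Matrices.
Variables n p : nat.
Hypotheses (n_ge2 : (2 <= n)%N) (p_prime : prime p) (p_odd : odd p).
Local Notation dim := n.*2.+1.
Local Notation F := 'F_p.
Local Notation V := 'rV[F]_dim.
Local Notation GL := {'GL_dim[F]}.
Local Notation be := (be n p).
Local Notation bf := (bf n p).
Local Notation w := (bw n p).
Local Notation bas := (bas n p).
Local Notation sg := (sigma n p).
Local Notation ta := (tau n p).
Local Notation ze := (zel n p).
Local Notation U := (Uel n p).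
Local Notation W := (Vel n p).
Local Notation act_eichler := (act_eichler p_prime p_odd).
Local Notation eichlerJ := (eichlerJ p_prime p_odd).
Local Notation eichlerM := (eichlerM p_prime p_odd).
Local Notation eichlerN := (eichlerN p_prime p_odd).
Local Notation eichlerX := (eichlerX p_prime p_odd).
Local Notation eichler0 := (eichler0 p_prime p_odd).
Local Notation isom_eichler := (isom_eichler p_prime p_odd).
Local Notation two_neq0 := (two_neq0 p_prime p_odd).
Implicit Types (x y u : V) (g h : GL).

Let n_gt0 : (0 < n)%N. Proof. exact: ltnW. Qed.

Definition cycle_eps : F := (-1) ^+ n.+1.
Lemma eps2 : cycle_eps * cycle_eps = 1. Proof. by rewrite -expr2 sqrr_sign. Qed.

(** ** Action of the generators on the basis *)

Lemma act_toGL (M : 'M[F]_dim) x : M \in unitmx -> act x (toGL M) = x *m M.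
Proof. by move=> uM; rewrite act_mul toGLK. Qed.

Lemma bas_linmx (E : nat -> V) (E' : nat -> V) u a : (a.1 < n)%N ->
  bas a *m linmx E E' u = if a.2 then E' a.1 else E a.1.
Proof. by case: a => i [] lt; rewrite basE /= ?bf_linmx ?be_linmx. Qed.

Lemma act_U a : (a.1 < n)%N -> act (bas a) U =
  if a.1 == 0%N then bas (1%N, a.2) else if a.1 == 1%N then - bas (0%N, a.2) else bas a.
Proof.
case: a => i s lt; rewrite act_toGL ?U_unit // bas_linmx //= /scycle !basE.
by case: i lt => [|[|i]] lt /=; rewrite ?scaleN1r; case: (s).
Qed.

Lemma act_V i s : (i.+1 < n)%N -> act (bas (i, s)) W = bas (i.+1, s).
Proof.
move=> lt; rewrite act_toGL ?V_unit // bas_linmx /=; last exact: ltnW.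
by rewrite /scycle lt basE; case: (s).
Qed.

Lemma act_V_last s : act (bas (n.-1, s)) W = cycle_eps *: bas (0%N, s).
Proof.
rewrite act_toGL ?V_unit // bas_linmx /=; last by rewrite prednK.
by rewrite /scycle prednK // ltnn eqxx basE; case: (s).
Qed.

Lemma act_z a : (a.1 < n)%N -> act (bas a) ze =
  if a.1 == 0%N then bas (0%N, ~~ a.2) else bas a.
Proof.
case: a => i s lt; rewrite act_toGL ?z_unit // bas_linmx //= /upd.
by case: eqP => _; rewrite !basE; case: (s).
Qed.

Lemma act_w_U : act w U = w.
Proof. by rewrite act_toGL ?U_unit // bw_linmx. Qed.
Lemma act_w_V : act w W = w.
Proof. by rewrite act_toGL ?V_unit // bw_linmx. Qed.
Lemma act_w_z : act w ze = - w.
Proof. by rewrite act_toGL ?z_unit // bw_linmx. Qed.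

Lemma act_fixV x g : act x g = x -> act x g^-1%g = x.
Proof. by move=> e; rewrite -{1}e actK. Qed.

Lemma adapted_bas a c : (a.1 < n)%N -> (c.1 < n)%N -> a.1 != c.1 ->
  adapted (bas a) (bas c).
Proof.
by move=> ? ? ne; split; rewrite dot_bas // ?eqxx // eq_sym (negPf ne).
Qed.

Lemma adapted_w a : (a.1 < n)%N -> adapted (bas a) w.
Proof. by move=> ?; split; rewrite ?dot_w_bas // dot_bas // !eqxx. Qed.

Lemma bas_ext g h : (forall a, (a.1 < n)%N -> act (bas a) g = act (bas a) h) ->
  act w g = act w h -> g = h.
Proof. by move=> bgh wgh; apply: GL_ext => b /in_basisP[->|[a lt ->]]; auto. Qed.

Lemma dot_basE i s j s' : (i < n)%N -> (j < n)%N ->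
  dot (bas (i, s)) (bas (j, s')) = ((i == j) && (s != s'))%:R.
Proof. by move=> *; rewrite dot_bas. Qed.

Lemma isom_bas g : (forall a c, (a.1 < n)%N -> (c.1 < n)%N ->
    dot (act (bas a) g) (act (bas c) g) = dot (bas a) (bas c)) ->
  (forall a, (a.1 < n)%N -> dot (act (bas a) g) (act w g) = 0) ->
  dot (act w g) (act w g) = - 2 -> isom g.
Proof.
move=> gb gw ww; apply: isom_basis => b c.
case/in_basisP=> [->|[a lta ->]] /in_basisP[->|[a' lta' ->]].
- by rewrite ww dot_ww.
- by rewrite dotC gw // dot_w_bas.
- by rewrite gw // dot_bas_w.
- exact: gb.
Qed.

Lemma isom_U : isom U.
Proof.
apply: isom_bas; rewrite ?act_w_U ?dot_ww //.
  case=> [i s] [j s'] ilt jlt; rewrite !act_U //=.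
  by case: i ilt => [|[|i]] ?; case: j jlt => [|[|j]] ? //=; rewrite ?dotB ?dot_basE // ?mulr0 ?mulN1r ?opprK ?oppr0.
case=> [i s] ilt; rewrite act_U //=.
by case: i ilt => [|[|i]] ? //=; rewrite ?dotNl dot_bas_w ?oppr0.
Qed.

Let vi i := if (i.+1 < n)%N then i.+1 else 0%N.
Let vc i : F := if (i.+1 < n)%N then 1 else cycle_eps.

Let act_Vc a : (a.1 < n)%N -> act (bas a) W = vc a.1 *: bas (vi a.1, a.2).
Proof.
case: a => i s /= lt; rewrite /vi /vc; case: ifP => lt'.
  by rewrite scale1r act_V.
have -> : i = n.-1 by lia.
exact: act_V_last.
Qed.

Lemma isom_V : isom W.
Proof.
have vilt i : (i < n)%N -> (vi i < n)%N by rewrite /vi; case: ifP.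
apply: isom_bas; rewrite ?act_w_V ?dot_ww //.
  case=> [i s] [j s'] /= ilt jlt; rewrite !act_Vc //= !dotB !dot_basE ?vilt //.
  have -> : (vi i == vi j) = (i == j) by rewrite /vi; do 2!case: ifP => ?; lia.
  case: eqP => [->|_]; last by rewrite !mulr0.
  by rewrite mulrA /vc; case: ifP => _; rewrite ?eps2 !mul1r.
by case=> [i s] /= ilt; rewrite act_Vc //= dotZl dot_bas_w ?mulr0 ?vilt.
Qed.

Lemma isom_z : isom ze.
Proof.
apply: isom_bas; rewrite ?act_w_z ?dotNl ?dotNr ?opprK ?dot_ww //.
  case=> [i s] [j s'] /= ilt jlt; rewrite !act_z //=.
  by case: i ilt => [|i] ?; case: j jlt => [|j] ?; rewrite !dot_basE //=; case: (s) (s') => [] [].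
case=> [i s] /= ilt; rewrite act_z //= dotNr.
by case: i ilt => [|i] ?; rewrite dot_bas_w ?oppr0.
Qed.

Lemma sigma_eichler : sg = eichler (bas (0%N, true)) (bas (1%N, false)).
Proof.
have ad : adapted (bas (0%N, true)) (bas (1%N, false)) by apply: adapted_bas.
have q0 : qf (bas (1%N, false)) = 0 by rewrite /qf dot_basE // eqxx mul0r.
apply: bas_ext => [[i s] lt|]; rewrite act_toGL ?sigma_unit // ?bas_linmx ?bw_linmx //
  (act_eichler _ ad) q0 mul0r scale0r subr0 ?dot_w_bas // ?scale0r ?addr0 ?subr0 //.
rewrite !dot_basE // /upd /= !basE /=.
case: i lt => [|[|i]] lt; case: (s); rewrite /= ?scale1r ?scale0r ?addr0 ?subr0 ?add0r //.
Qed.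

Lemma tau_eichler : ta = eichler (bas (0%N, true)) w.
Proof.
have ad : adapted (bas (0%N, true)) w by apply: adapted_w.
have q1 : qf w = - 1 by rewrite /qf dot_ww mulNr divff ?two_neq0.
apply: bas_ext => [[i s] lt|]; rewrite act_toGL ?tau_unit // ?bas_linmx ?bw_linmx //
  (act_eichler _ ad) q1 ?dot_w_bas // ?dot_bas_w // ?dot_ww.
  rewrite dot_basE // /upd scale0r subr0 !basE /=.
  case: i lt => [|i] lt; case: (s); rewrite /= ?mulr0 ?mulr1 ?scale1r ?scale0r ?addr0 ?subr0 ?scaleN1r ?opprK //.
  by rewrite addrAC.
by rewrite scale0r mulr0 scale0r addr0 subr0 scaleNr opprK basE.
Qed.

(** What is used of the five matrices; U, V, ... are then variables, which are
    cheap to compare. *)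
Record standard (s t z U W : GL) : Prop := {
  std_U : forall a, (a.1 < n)%N -> act (bas a) U =
    if a.1 == 0%N then bas (1%N, a.2) else if a.1 == 1%N then - bas (0%N, a.2) else bas a;
  std_V : forall i s, (i.+1 < n)%N -> act (bas (i, s)) W = bas (i.+1, s);
  std_V_last : forall s, act (bas (n.-1, s)) W = cycle_eps *: bas (0%N, s);
  std_z : forall a, (a.1 < n)%N -> act (bas a) z =
    if a.1 == 0%N then bas (0%N, ~~ a.2) else bas a;
  std_w_U : act w U = w;
  std_w_V : act w W = w;
  std_w_z : act w z = - w;
  std_iU : isom U;
  std_iV : isom W;
  std_iz : isom z;
  std_s : s = eichler (bas (0%N, true)) (bas (1%N, false));
  std_t : t = eichler (bas (0%N, true)) w }.

Lemma standard_generators : standard sg ta ze U W.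
Proof.
split; [exact: act_U | exact: act_V | exact: act_V_last | exact: act_z |
  exact: act_w_U | exact: act_w_V | exact: act_w_z | exact: isom_U |
  exact: isom_V | exact: isom_z | exact: sigma_eichler | exact: tau_eichler].
Qed.
End Matrices.

Section Matrices.
Variables n p : nat.
Hypotheses (n_ge2 : (2 <= n)%N) (p_prime : prime p) (p_odd : odd p).
Local Notation dim := n.*2.+1.
Local Notation F := 'F_p.
Local Notation V := 'rV[F]_dim.
Local Notation GL := {'GL_dim[F]}.
Local Notation be := (be n p).
Local Notation bf := (bf n p).
Local Notation w := (bw n p).
Local Notation bas := (bas n p).
Variables sg ta ze U W : {'GL_dim[F]}.
Hypothesis std : standard sg ta ze U W.
Local Notation act_eichler := (act_eichler p_prime p_odd).
Local Notation eichlerJ := (eichlerJ p_prime p_odd).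
Local Notation eichlerM := (eichlerM p_prime p_odd).
Local Notation eichlerN := (eichlerN p_prime p_odd).
Local Notation eichlerX := (eichlerX p_prime p_odd).
Local Notation eichler0 := (eichler0 p_prime p_odd).
Local Notation isom_eichler := (isom_eichler p_prime p_odd).
Local Notation two_neq0 := (two_neq0 p_prime p_odd).
Implicit Types (x y u : V) (g h : GL).

Let n_gt0 : (0 < n)%N. Proof. exact: ltnW. Qed.
Local Notation eps := (cycle_eps n p).
Let act_U := std_U std.
Let act_V := std_V std.
Let act_V_last := std_V_last std.
Let act_z := std_z std.
Let act_w_U := std_w_U std.
Let act_w_V := std_w_V std.
Let act_w_z := std_w_z std.
Let isom_U := std_iU std.
Let isom_V := std_iV std.
Let isom_z := std_iz std.

Lemma act_X_fix x g k : act x g = x -> act x (g ^+ k)%g = x.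
Proof. by move=> e; elim: k => [|k IH]; rewrite ?act1 // expgS actM e. Qed.

Lemma act_Vk k i s : (i + k < n)%N -> act (bas (i, s)) (W ^+ k)%g = bas (i + k, s)%N.
Proof.
elim: k => [|k IH] lt; first by rewrite act1 addn0.
by rewrite expgSr actM IH ?act_V ?addnS //; lia.
Qed.

Lemma act_Vn a : (a.1 < n)%N -> act (bas a) (W ^+ n)%g = eps *: bas a.
Proof.
case: a => i s /= lt.
have -> : (W ^+ n = W ^+ (n.-1 - i) * W * W ^+ i)%g.
  by rewrite -expgSr -expgnDr; congr (_ ^+ _)%g; lia.
rewrite !actM act_Vk; last by lia.
have -> : (i + (n.-1 - i) = n.-1)%N by lia.
by rewrite act_V_last actZ act_Vk.
Qed.

Lemma act_UV a : (a.1 < n)%N -> exists c, act (bas a) U = c *: bas (transp 0 1 a.1, a.2).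
Proof.
case: a => [[|[|i]] s] lt; rewrite act_U //=; [exists 1|exists (-1)|exists 1];
  by rewrite ?scale1r ?scaleN1r.
Qed.

Lemma gl_uvn : commute U (W ^+ n)%g.
Proof.
apply: bas_ext => [a lt|]; last by rewrite !actM !(act_X_fix _ act_w_V) act_w_U act_X_fix ?act_w_V.
rewrite !actM act_Vn // actZ; have [c ->] := act_UV lt.
rewrite !actZ act_Vn ?scalerA 1?mulrC //.
by apply: transp_lt => //.
Qed.

Lemma act_U_inv s : act (bas (0%N, s)) U^-1%g = - bas (1%N, s) /\
  act (bas (1%N, s)) U^-1%g = bas (0%N, s).
Proof.
split; last by rewrite -[RHS](actK U) act_U.
by rewrite -[RHS](actK U) actN act_U //= opprK.
Qed.

(* the conjugate of U by V^k is a signed transposition of k and k.+1 *)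
Lemma act_UVk k i s : (k.+1 < n)%N -> (i < n)%N -> act (bas (i, s)) (U ^ (W ^+ k))%g =
  if i == k then bas (k.+1, s) else if i == k.+1 then - bas (k, s) else bas (i, s).
Proof.
move=> klt ilt; case: (leqP k i) => ki.
  have -> : bas (i, s) = act (bas (i - k, s)%N) (W ^+ k)%g by rewrite act_Vk subnK.
  rewrite -actM -conjgC actM; have [j ij] : exists j, i = (j + k)%N.
    by exists (i - k)%N; rewrite subnK.
  rewrite {}ij in ilt ki *; rewrite addnK act_U /=; last by rewrite /=; lia.
  case: j ilt ki => [|[|j]] ilt ki /=; rewrite ?actN ?act_Vk /=; try lia.
  - by rewrite add0n eqxx.
  - by rewrite add1n eqxx gtn_eqF.
  - by case: eqP => ?; [lia|case: eqP => ?; [lia|]].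
have e : bas (i, s) = eps *: act (bas (i + (n - k), s)%N) (W ^+ k)%g.
  have : act (act (bas (i, s)) (W ^+ (n - k))%g) (W ^+ k)%g = eps *: bas (i, s).
    by rewrite -actM -expgnDr subnK ?act_Vn //; lia.
  by rewrite act_Vk => [->|]; [rewrite scalerA eps2 scale1r|lia].
rewrite ltn_eqF // ltn_eqF; last by lia.
rewrite {1}e actZ -actM -conjgC actM act_U /=; last by rewrite /=; lia.
case: eqP => ?; first by lia.
by case: eqP => ?; [lia|rewrite -e].
Qed.

Lemma act_w_UVk k : act w (U ^ (W ^+ k))%g = w.
Proof.
by rewrite /conjg !actM (act_fixV (act_X_fix k act_w_V)) act_w_U (act_X_fix _ act_w_V).
Qed.

Lemma gl_far k : (2 <= k)%N -> (k.+2 <= n)%N -> commute U (U ^ (W ^+ k))%g.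
Proof.
move=> k2 kn; apply: bas_ext => [[i s] lt|]; last first.
  by rewrite (actM _ U) (actM _ (U ^ _)%g) act_w_U act_w_UVk act_w_U.
rewrite (actM _ U) (actM _ (U ^ _)%g) act_U // act_UVk //=.
have [k0 k0' k1 k1'] : [/\ (0 == k)%N = false, (0 == k.+1)%N = false,
  (1 == k)%N = false & (1 == k.+1)%N = false] by split; lia.
case: i lt => [|[|i]] lt /=; rewrite ?actN ?k0 ?k0' ?k1 ?k1' act_UVk // ?k0 ?k0' ?k1 ?k1' ?act_U //.
have [ik|nik] := eqVneq i.+2 k; first by rewrite -ik act_U //= ik; lia.
have [ik|nik'] := eqVneq i.+2 k.+1; last by rewrite act_U.
have [j kE] : exists j, k = j.+2 by exists k.-2; lia.
by rewrite actN act_U kE //= -kE; lia.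
Qed.

Lemma gl_braid : (2 < n)%N -> (U * U ^ W * U = U ^ W * U * U ^ W)%g.
Proof.
move=> n3; have := @act_UVk 1; rewrite expg1 => act_UW.
have act_w_UW : act w (U ^ W)%g = w by have := act_w_UVk 1; rewrite expg1.
move: (U ^ W)%g act_UW act_w_UW => g gE wg.
apply: bas_ext => [[i s] lt|]; rewrite !actM; last by rewrite !(wg, act_w_U).
by case: i lt => [|[|[|i]]] lt; do ![rewrite act_U //= | rewrite gE //= | rewrite actN].
Qed.

(* for n = 3 the cycle V U^-1 is the signed transposition of the last two
   indices; for n = 2 it is trivial *)
Lemma gl_UV3 : n = 3%N -> (W * U^-1 = U ^ W)%g.
Proof.
move=> n3; have := @act_UVk 1; rewrite expg1 => act_UW.
have act_w_UW : act w (U ^ W)%g = w by have := act_w_UVk 1; rewrite expg1.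
move: (U ^ W)%g act_UW act_w_UW => g gE wg.
apply: bas_ext => [[i s] lt|]; rewrite !actM; last by rewrite wg act_w_V act_fixV ?act_w_U.
have [e0 e1] := act_U_inv s.
have last2 : n.-1 = 2%N by rewrite n3.
case: i lt => [|[|[|i]]] /= lt; last by exfalso; lia.
- by rewrite act_V // e1 gE //; lia.
- rewrite act_V; last by lia.
  by rewrite gE //=; try (apply: act_fixV; rewrite act_U //=); lia.
- have e := act_V_last s; rewrite last2 in e; rewrite e actZ e0 gE; try lia.
  by rewrite /cycle_eps n3 -signr_odd /= expr0 scale1r.
Qed.

Lemma gl_V2 : n = 2%N -> U = W.
Proof.
move=> n2; apply: bas_ext => [[i s] lt|]; last by rewrite act_w_U act_w_V.
have last1 : n.-1 = 1%N by rewrite n2.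
case: i lt => [|[|i]] /= lt; last by exfalso; lia.
- by rewrite act_U // act_V.
- have e := act_V_last s; rewrite last1 in e; rewrite act_U //= e /cycle_eps n2.
  by rewrite -signr_odd /= expr1 scaleN1r.
Qed.

Lemma gl_vn : (W ^+ n = (W * U) ^+ n.-1)%g.
Proof.
have wVU : act w (W * U)%g = w by rewrite actM act_w_V act_w_U.
have VU0 s : act (bas (0%N, s)) (W * U)%g = - bas (0%N, s) by rewrite actM act_V // act_U.
have VU i s : (0 < i)%N -> (i.+1 < n)%N ->
    act (bas (i, s)) (W * U)%g = bas (i.+1, s).
  by move=> i0 lt; rewrite actM act_V // act_U //=; case: i i0 {lt}.
have VUl s : act (bas (n.-1, s)) (W * U)%g = eps *: bas (1%N, s).
  by rewrite actM act_V_last actZ act_U.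
move: (W * U)%g wVU VU0 VU VUl => g wg g0 gi gl.
have gk k i s : (0 < i)%N -> (i + k < n)%N -> act (bas (i, s)) (g ^+ k)%g = bas (i + k, s)%N.
  move=> i0; elim: k => [|k IH] lt; first by rewrite act1 addn0.
  by rewrite expgSr actM IH ?gi ?addnS //; lia.
apply: bas_ext => [[i s] lt|]; last by rewrite !act_X_fix ?act_w_V.
rewrite act_Vn //; case: i lt => [|i] /= lt.
  have g0k k : act (bas (0%N, s)) (g ^+ k)%g = (-1) ^+ k *: bas (0%N, s).
    elim: k => [|k IH]; first by rewrite act1 scale1r.
    by rewrite expgSr actM IH actZ g0 exprS mulN1r scaleNr scalerN.
  rewrite g0k /cycle_eps; congr (_ *: _); have [m ->] : exists m, n = m.+1 by exists n.-1; lia.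
  by rewrite !exprS !mulN1r opprK.
have -> : (g ^+ n.-1 = g ^+ (n.-1 - i.+1) * g * g ^+ i)%g.
  by rewrite -expgSr -expgnDr; congr (_ ^+ _)%g; lia.
rewrite !actM gk //; last by lia.
have -> : (i.+1 + (n.-1 - i.+1) = n.-1)%N by lia.
by rewrite gl actZ gk.
Qed.

Lemma gl_u4 : (U ^+ 4 = 1)%g.
Proof.
rewrite !expgS expg0 mulg1; apply: bas_ext => [[i s] lt|]; rewrite !actM act1; last by rewrite !act_w_U.
by case: i lt => [|[|i]] lt; do ![rewrite act_U //= | rewrite actN | rewrite opprK].
Qed.
Local Notation b i s := (bas (i%N, s)).

Lemma actJ x g h : act (act x g) (h ^ g)%g = act (act x h) g.
Proof. by rewrite -!actM -conjgC. Qed.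

Lemma act_eichler_fix x u y : adapted x u -> dot y x = 0 -> dot y u = 0 ->
  act y (eichler x u) = y.
Proof.
by move=> xu yx yu; rewrite (act_eichler _ xu) yx yu mulr0 !scale0r addr0 !subr0.
Qed.

Lemma eichler_commute x u u' : adapted x u -> adapted x u' ->
  commute (eichler x u) (eichler x u').
Proof. by move=> xu xu'; rewrite /commute !eichlerM // addrC. Qed.

(* E(c x, u) = E(x, c u) *)
Lemma eichlerZl c x u : adapted x u -> eichler (c *: x) u = eichler x (c *: u).
Proof.
move=> xu; have cxu : adapted (c *: x) u.
  by case: xu => xx ux; split; rewrite !dotB ?xx ?ux !mulr0.
apply: GL_ext => y _; rewrite (act_eichler _ cxu) (act_eichler _ (adaptedZ c xu)).
rewrite qfZ !dotB; move: (dot y x) (dot y u) (qf u) => k l q.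
by apply/rowP=> i; rewrite !mxE; ring.
Qed.

Lemma eichler_opp x u : adapted x u -> eichler (- x) (- u) = eichler x u.
Proof.
move=> xu; rewrite -scaleN1r (eichlerZl _ (adaptedN xu)) scaleN1r opprK //.
Qed.

Lemma adapted_swap x u : adapted x u -> dot u u = 0 -> adapted u (- x).
Proof. by case=> xx ux uu; split; rewrite // dotNl dotC ux oppr0. Qed.

(* E(x, u) = E(u, - x) for orthogonal isotropic vectors *)
Lemma eichler_swap x u : adapted x u -> dot u u = 0 -> eichler x u = eichler u (- x).
Proof.
move=> xu uu; have ux := adapted_swap xu uu; case: (xu) => xx _.
apply: GL_ext => y _; rewrite (act_eichler _ xu) (act_eichler _ ux).
have -> : qf u = 0 by rewrite /qf uu mul0r.
have -> : qf (- x) = 0 by rewrite /qf !dotB xx !oppr0 mul0r.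
rewrite dotNr; move: (dot y u) (dot y x) => k l.
by apply/rowP=> i; rewrite !mxE; ring.
Qed.

(* Products of three Eichler transformations that interchange two isotropic
   lines, as in SL(2). *)
Lemma weyl_short x y u : adapted x u -> adapted y u -> dot x y = 1 ->
  qf u = - 1 -> dot u u = - 2 ->
  let g := (eichler y u * eichler x (- u) * eichler y u)%g in
  [/\ act x g = y, act y g = x, act u g = - u
    & forall v, dot v x = 0 -> dot v y = 0 -> dot v u = 0 -> act v g = v].
Proof.
move=> xu yu xy q1 uu g; have xu' := adaptedN xu.
have qN : qf (- u) = -1 by rewrite -q1 /qf dotNl dotNr opprK.
have gE v : act v g = act (act (act v (eichler y u)) (eichler x (- u))) (eichler y u).
  by rewrite /g !actM.
have [xx ux] := xu; have [yy uy] := yu.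
have [yx xu0 yu0] : [/\ dot y x = 1, dot x u = 0 & dot y u = 0].
  by split; rewrite dotC.
have E1 v := act_eichler v yu; have E2 v := act_eichler v xu'.
have dE := (xx, ux, yy, uy, yx, xu0, yu0, xy, uu, q1, qN).
split; last first.
  by move=> v vx vy vu; rewrite gE !act_eichler_fix // dotNr vu oppr0.
all: rewrite gE {g gE}.
- rewrite (E1 u) dE mulr0 !scale0r addr0 subr0 E2 !dotB !dE E1 !dotB !dE.
  by apply/rowP=> k; rewrite !mxE; ring.
- rewrite (E1 y) !dE mulr0 !scale0r addr0 !subr0 E2 !dotB !dE E1 !dotB !dE.
  by apply/rowP=> k; rewrite !mxE; ring.
- rewrite (E1 x) !dE E2 !dotB !dE E1 !dotB !dE.
  by apply/rowP=> k; rewrite !mxE; ring.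
Qed.

Lemma weyl_long x y x' y' : adapted x y -> adapted x' y' ->
  dot y y = 0 -> dot y' y' = 0 -> dot y x' = 1 -> dot x y' = 1 ->
  dot x x' = 0 -> dot y' y = 0 ->
  let g := (eichler x y * eichler x' (- y') * eichler x y)%g in
  [/\ act x g = x', act y g = - y', act x' g = - x, act y' g = y
    & forall v, dot v x = 0 -> dot v y = 0 -> dot v x' = 0 -> dot v y' = 0 ->
      act v g = v].
Proof.
move=> xy xy' yy yy' yx' xy'1 xx' y'y g; have xyN := adaptedN xy'.
have gE v : act v g = act (act (act v (eichler x y)) (eichler x' (- y'))) (eichler x y).
  by rewrite /g !actM.
have [xx yx] := xy; have [x'x' y'x'] := xy'.
have [e1 e2 e3 e4] : [/\ dot x y = 0, dot x' y' = 0, dot x' y = 1 & dot y' x = 1].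
  by split; rewrite dotC.
have [e5 e6] : dot x' x = 0 /\ dot y y' = 0 by split; rewrite dotC.
have q0 : qf y = 0 by rewrite /qf yy mul0r.
have qN : qf (- y') = 0 by rewrite /qf !dotB yy' !oppr0 mul0r.
have E1 v := act_eichler v xy; have E2 v := act_eichler v xyN.
have dE := (xx, yx, x'x', y'x', yy, yy', yx', xy'1, xx', y'y, e1, e2, e3, e4, e5, e6, q0, qN).
split; last first.
  by move=> v vx vy vx' vy'; rewrite gE !act_eichler_fix // dotNr vy' oppr0.
all: rewrite gE {g gE}.
- rewrite (E1 y') !dE E2 !dotB !dE E1 !dotB !dE.
  by apply/rowP=> k; rewrite !mxE; ring.
- rewrite (E1 x') !dE E2 !dotB !dE E1 !dotB !dE.
  by apply/rowP=> k; rewrite !mxE; ring.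
- rewrite (E1 y) !dE mulr0 !scale0r addr0 !subr0 E2 !dotB !dE E1 !dotB !dE.
  by apply/rowP=> k; rewrite !mxE; ring.
- rewrite (E1 x) !dE mulr0 !scale0r addr0 !subr0 E2 !dotB !dE E1 !dotB !dE.
  by apply/rowP=> k; rewrite !mxE; ring.
Qed.

Lemma eichler_p x u : adapted x u -> (eichler x u ^+ p = 1)%g.
Proof.
by move=> xu; rewrite (eichlerX _ xu) (pcharf0 (pchar_Fp p_prime)) scale0r (eichler0 xu).
Qed.

Let ad a c : (a.1 < n)%N -> (c.1 < n)%N -> a.1 != c.1 -> adapted (bas a) (bas c).
Proof. exact: adapted_bas. Qed.
Let adw a : (a.1 < n)%N -> adapted (bas a) w.
Proof. exact: adapted_w. Qed.
Let sE : sg = eichler (b 0 true) (b 1 false). Proof. exact: std_s std. Qed.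
Let tE : ta = eichler (b 0 true) w. Proof. exact: std_t std. Qed.
Let ad01 s s' : adapted (b 0 s) (b 1 s'). Proof. exact: ad. Qed.
Let ad10 s s' : adapted (b 1 s) (b 0 s'). Proof. exact: ad. Qed.
Let adw0 s : adapted (b 0 s) w. Proof. exact: adw. Qed.
Let adw1 s : adapted (b 1 s) w. Proof. exact: adw. Qed.
Let q1 : qf w = - 1. Proof. by rewrite /qf dot_ww mulNr divff ?two_neq0. Qed.

Lemma act_zU i s : (i < n)%N -> act (bas (i, s)) (ze ^ U)%g =
  if i == 1%N then bas (1%N, ~~ s) else bas (i, s).
Proof.
move=> lt; rewrite /conjg (actM _ U^-1%g) (actM _ ze).
have [e0 e1] := act_U_inv s.
case: i lt => [|[|i]] lt.
- by rewrite e0 !actN act_z // act_U //= opprK.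
- by rewrite e1 act_z // act_U.
- by rewrite act_fixV ?act_U // act_z // act_U.
Qed.

Lemma act_w_zU : act w (ze ^ U)%g = - w.
Proof.
by rewrite /conjg (actM _ U^-1%g) (actM _ ze) act_fixV ?act_w_U // act_w_z actN act_w_U.
Qed.

Lemma isom_zU : isom (ze ^ U)%g. Proof. exact: isomJ isom_z isom_U. Qed.
Lemma isom_s : isom sg. Proof. by rewrite sE; apply: isom_eichler. Qed.
Lemma isom_t : isom ta. Proof. by rewrite tE; apply: isom_eichler. Qed.

Lemma act_VU i s : (0 < i)%N -> (i < n)%N ->
  exists c j, [/\ act (bas (i, s)) (W * U^-1)%g = c *: bas (j, s), (0 < j)%N & (j < n)%N].
Proof.
move=> i0 lt; have [e0 _] := act_U_inv s.
case: (ltnP i.+1 n) => lt'.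
  exists 1, i.+1; rewrite scale1r actM act_V // act_fixV //.
  by rewrite act_U //=; case: (i) i0.
exists (- eps), 1%N; have -> : i = n.-1 by lia.
by rewrite actM act_V_last actZ e0 scalerN scaleNr.
Qed.

Lemma act_VU0 s : act (bas (0%N, s)) (W * U^-1)%g = bas (0%N, s).
Proof. by rewrite actM act_V //; case: (act_U_inv s). Qed.

Lemma act_w_VU : act w (W * U^-1)%g = w.
Proof. by rewrite actM act_w_V act_fixV ?act_w_U. Qed.

Let isom_VU : isom (W * U^-1)%g. Proof. exact: isomM isom_V (isomV isom_U). Qed.

(* whatever fixes the plane of the first index, and w, commutes with z and tau *)
Let commute_z g : (forall s, act (b 0 s) g = b 0 s) -> act w g = w ->
  (forall i s, (0 < i)%N -> (i < n)%N ->
    exists c j, [/\ act (bas (i, s)) g = c *: bas (j, s), (0 < j)%N & (j < n)%N]) ->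
  commute ze g.
Proof.
move=> g0 gw gi; apply: bas_ext => [[i s] lt|].
  rewrite !actM act_z //=; case: eqP => [e|ne].
    by move: lt; rewrite e => lt; rewrite !g0 act_z.
  have i0 : (0 < i)%N by lia.
  have [c [j [-> j0 jn]]] := gi i s i0 lt; rewrite actZ act_z //=.
  by case: (j) j0.
by rewrite !actM act_w_z actN gw act_w_z.
Qed.

Let commute_t g : isom g -> act (b 0 true) g = b 0 true -> act w g = w -> commute ta g.
Proof.
by move=> ig g0 gw; apply: commute_conj; rewrite tE (eichlerJ ig (adw0 _)) g0 gw.
Qed.

Let UV1 i s : (2 < n)%N -> (i < n)%N -> act (bas (i, s)) (U ^ W)%g =
  if i == 1%N then bas (2, s) else if i == 2 then - bas (1%N, s) else bas (i, s).
Proof. by move=> n3 lt; have := act_UVk (k := 1) (i := i) s n3 lt; rewrite expg1. Qed.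
Let wUV : act w (U ^ W)%g = w.
Proof. by have := act_w_UVk 1; rewrite expg1. Qed.
Let isom_UV : isom (U ^ W)%g. Proof. exact: isomJ isom_U isom_V. Qed.

Lemma gl_zuu : commute ze (U ^+ 2)%g.
Proof.
rewrite expg2; apply: bas_ext => [[i s] lt|]; last by rewrite !actM !act_w_z !actN !act_w_U !act_w_z.
rewrite !actM; case: i lt => [|[|i]] lt;
  by do ![rewrite act_U //= | rewrite act_z //= | rewrite actN].
Qed.

Lemma gl_zz : (ze ^+ 2 = 1)%g.
Proof.
rewrite expg2; apply: bas_ext => [[i s] lt|]; rewrite !actM act1.
  by rewrite act_z //=; case: eqP lt => [->|?] lt; rewrite act_z //= ?negbK //; case: eqP.
by rewrite act_w_z actN act_w_z opprK.
Qed.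

Lemma gl_zzu : commute ze (ze ^ U)%g.
Proof.
apply: bas_ext => [[i s] lt|]; rewrite (actM _ ze) (actM _ (ze ^ U)%g).
  by rewrite act_zU // act_z //=; case: i lt => [|[|i]] lt;
    do ![rewrite act_zU //= | rewrite act_z //=].
by rewrite act_w_z act_w_zU !actN act_w_z act_w_zU.
Qed.

Lemma gl_zvu : commute ze (W * U^-1)%g.
Proof. exact: commute_z act_VU0 act_w_VU act_VU. Qed.

Lemma gl_zuv : (2 < n)%N -> commute ze (U ^ W)%g.
Proof.
move=> n3; apply: commute_z => [s||i s i0 lt]; [by rewrite UV1|exact: wUV|].
rewrite UV1 //; case: eqP => _; first by exists 1, 2; rewrite scale1r.
by case: eqP => _; [exists (-1), 1%N; rewrite scaleN1r|exists 1, i; rewrite scale1r].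
Qed.

Lemma gl_avu : commute ta (W * U^-1)%g.
Proof. exact: commute_t isom_VU (act_VU0 _) act_w_VU. Qed.

Lemma gl_auv : (2 < n)%N -> commute ta (U ^ W)%g.
Proof. by move=> n3; apply: commute_t isom_UV _ wUV; rewrite UV1. Qed.

Let act_UU s : act (b 0 s) (U ^+ 2)%g = - b 0 s /\ act (b 1 s) (U ^+ 2)%g = - b 1 s.
Proof. by rewrite expg2 !actM; split; do ![rewrite act_U //= | rewrite actN]. Qed.
Let act_w_UU : act w (U ^+ 2)%g = w. Proof. by rewrite expg2 actM !act_w_U. Qed.

Lemma gl_a_cent : commute ta (U ^+ 2 * ze ^ U)%g.
Proof.
have [e0 _] := act_UU true.
have i2 : isom (U ^+ 2)%g := isomX 2 isom_U.
apply: commute_conj; rewrite conjgM tE (eichlerJ i2 (adw0 _)) e0 act_w_UU.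
have e : adapted (- b 0 true) w by rewrite -e0 -act_w_UU; apply: adapted_act.
rewrite (eichlerJ isom_zU e) actN act_zU // act_w_zU.
exact: eichler_opp.
Qed.

Lemma gl_A_cent : commute sg (U ^+ 2)%g.
Proof.
have [e0 _] := act_UU true; have [_ e1] := act_UU false.
have i2 : isom (U ^+ 2)%g := isomX 2 isom_U.
by apply: commute_conj; rewrite sE (eichlerJ i2 (ad01 _ _)) e0 e1 eichler_opp.
Qed.

Let sU : (sg ^ U = eichler (b 1 true) (- b 0 false))%g.
Proof. by rewrite sE (eichlerJ isom_U (ad01 _ _)) !act_U. Qed.
Let tU : (ta ^ U = eichler (b 1 true) w)%g.
Proof. by rewrite tE (eichlerJ isom_U (adw0 _)) act_U // act_w_U. Qed.
Let tz : (ta ^ ze = eichler (b 0 false) (- w))%g.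
Proof. by rewrite tE (eichlerJ isom_z (adw0 _)) act_z // act_w_z. Qed.

Lemma gl_zE : (ze = ta * ta ^ ze * ta)%g.
Proof.
rewrite tz tE; have qN : qf (- w) = -1 by rewrite -q1 /qf dotNl dotNr opprK.
have [hx hy hw hf] := @weyl_short (b 0 false) (b 0 true) w (adw0 _) (adw0 _)
  (dot_basE _ _ _ n_gt0 n_gt0) q1 (dot_ww n p).
apply: bas_ext => [[i s] lt|]; last by rewrite hw act_w_z.
case: i lt => [|i] lt; first by rewrite act_z //=; case: (s).
by rewrite act_z // hf // ?dot_basE ?dot_bas_w.
Qed.

Lemma gl_ap : (ta ^+ p = 1)%g.
Proof. by rewrite tE eichler_p. Qed.

Lemma gl_Ap : (sg ^+ p = 1)%g.
Proof. by rewrite sE eichler_p. Qed.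

Lemma gl_uE : (U = sg * sg ^ U * sg)%g.
Proof.
rewrite sU sE.
have [h1 h2 h3 h4 hf] := @weyl_long (b 0 true) (b 1 false) (b 1 true) (b 0 false)
  (ad01 _ _) (ad10 _ _) (dot_basE _ _ _ n_ge2 n_ge2) (dot_basE _ _ _ n_gt0 n_gt0)
  (dot_basE _ _ _ n_ge2 n_ge2) (dot_basE _ _ _ n_gt0 n_gt0)
  (dot_basE _ _ _ n_gt0 n_ge2) (dot_basE _ _ _ n_gt0 n_ge2).
apply: bas_ext => [[i s] lt|]; last by rewrite hf ?dot_w_bas.
case: i lt => [|[|i]] lt; rewrite act_U //=; last by rewrite hf ?dot_basE.
  by case: (s).
by case: (s).
Qed.

Let sJ g x y : isom g -> act (b 0 true) g = x -> act (b 1 false) g = y ->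
  (sg ^ g = eichler x y)%g.
Proof. by move=> ig <- <-; rewrite sE (eichlerJ ig (ad01 _ _)). Qed.
Let tJ g x y : isom g -> act (b 0 true) g = x -> act w g = y ->
  (ta ^ g = eichler x y)%g.
Proof. by move=> ig <- <-; rewrite tE (eichlerJ ig (adw0 _)). Qed.

Let sVU : (2 < n)%N -> (sg ^ (W * U^-1) = eichler (b 0 true) (b 2 false))%g.
Proof.
move=> n3; apply: sJ isom_VU (act_VU0 _) _; rewrite actM act_V // act_fixV //.
by rewrite act_U.
Qed.

Lemma gl_b : (2 < n)%N -> commute sg (sg ^ (W * U^-1))%g.
Proof. by move=> n3; rewrite sVU // sE; apply: eichler_commute => //; apply: ad. Qed.

Lemma gl_e : commute sg (sg ^ (ze ^ U))%g.
Proof.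
rewrite (sJ isom_zU (act_zU _ _) (act_zU _ _)) //= sE.
exact: eichler_commute.
Qed.

Lemma gl_f : ([~ ta, ta ^ U] = (sg ^+ 2) ^ (ze ^ U))%g.
Proof.
rewrite /commg tU (tJ (isom_eichler (adw1 true)) (x := b 0 true) (y := w + 2 *: b 1 true)).
- rewrite tE -(eichlerN (adw0 true)) conjXg (sJ isom_zU (act_zU _ _) (act_zU _ _)) //=.
  rewrite (eichlerX _ (ad01 true true)) eichlerM; first by rewrite addKr.
    exact/adaptedN/adw0.
  exact: adaptedD (adw0 _) (adaptedZ _ (ad01 _ _)).
- by rewrite (act_eichler_fix (adw1 _)) ?dot_basE ?dot_bas_w.
- rewrite (act_eichler _ (adw1 _)) dot_w_bas // mulr0 !scale0r addr0 subr0 dot_ww.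
  by rewrite scaleNr opprK.
Qed.

Lemma gl_g : commute sg ta.
Proof. by rewrite sE tE; apply: eichler_commute. Qed.

Lemma gl_h : ([~ sg ^ ze, ta] = sg * ta ^ (ze * U))%g.
Proof.
have e0 : (sg ^ ze = eichler (b 0 false) (b 1 false))%g.
  by apply: sJ isom_z _ _; rewrite act_z.
have ww : dot w w = - 2 by rewrite dot_ww.
have z1 : dot (b 1 false) (b 1 false) = 0 by rewrite dot_basE.
have ft0 : act (b 0 false) ta = b 0 false + w + b 0 true.
  rewrite tE (act_eichler _ (adw0 true)) dot_basE // dot_bas_w // q1.
  by rewrite scale1r scale0r subr0 mulN1r scaleN1r opprK.
have ft1 : act (b 1 false) ta = b 1 false.
  by rewrite tE (act_eichler_fix (adw0 true)) ?dot_basE ?dot_bas_w.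
have e1 : (eichler (b 0 false) (b 1 false) ^ ta =
    eichler (b 1 false) (- (b 0 false + w + b 0 true)))%g.
  rewrite (eichlerJ isom_t (ad01 _ _)) ft0 ft1 -eichler_swap // -ft0 -{1}ft1.
  exact: adapted_act isom_t (ad01 _ _).
have e2 : (ta ^ (ze * U) = eichler (b 1 false) (- w))%g.
  apply: tJ (isomM isom_z isom_U) _ _; first by rewrite actM act_z // act_U.
  by rewrite actM act_w_z actN act_w_U.
have a1 := adaptedN (ad10 false true); have a2 := adaptedN (adw1 false).
have a3 : adapted (b 1 false) (- (b 0 false + w + b 0 true)).
  by apply: adaptedN; apply: adaptedD; [apply: adaptedD|].
rewrite /commg e0 e1 e2 sE (eichler_swap (ad01 true false) z1).
rewrite -(eichlerN (ad01 _ _)) (eichler_swap (adaptedN (ad01 _ _))); last by rewrite !dotB z1 !oppr0.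
rewrite -(eichler_opp (adapted_swap (adaptedN (ad01 _ _)) _)) ?opprK; last by rewrite !dotB z1 !oppr0.
rewrite !eichlerM //; congr eichler; rewrite !opprD !addrA addrN add0r addrC //.
Qed.

Let tV2 : (2 < n)%N -> (ta ^ (W ^+ 2) = eichler (b 2 true) w)%g.
Proof.
move=> n3; apply: tJ (isomX 2 isom_V) _ _; last by rewrite expg2 actM !act_w_V.
by rewrite expg2 actM !act_V.
Qed.

Let s_fix x u : adapted x u -> dot (b 0 true) x = 0 -> dot (b 0 true) u = 0 ->
  dot (b 1 false) x = 0 -> dot (b 1 false) u = 0 -> commute sg (eichler x u).
Proof.
move=> xu *; apply: commute_conj; rewrite (sJ (isom_eichler xu)
  (act_eichler_fix xu _ _) (act_eichler_fix xu _ _)) //.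
Qed.

Lemma gl_j : (2 < n)%N -> commute sg (ta ^ (W ^+ 2))%g.
Proof. by move=> n3; rewrite tV2 //; apply: s_fix; rewrite ?dot_basE ?dot_bas_w //; apply: adw. Qed.

Let sV : (2 < n)%N -> (sg ^ W = eichler (b 1 true) (b 2 false))%g.
Proof. by move=> n3; apply: sJ isom_V _ _; rewrite act_V. Qed.

Lemma gl_a : (2 < n)%N -> ([~ sg, sg ^ W] = sg ^ (W * U^-1))%g.
Proof.
move=> n3; have a12 : adapted (b 1 true) (b 2 false) by apply: ad.
have a02 : adapted (b 0 true) (b 2 false) by apply: ad.
rewrite /commg sV // sVU // (sJ (isom_eichler a12) (x := b 0 true) (y := b 1 false + b 2 false)).
- rewrite sE -(eichlerN (ad01 _ _)) eichlerM ?addKr //; first exact: adaptedN.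
  exact: adaptedD.
- by rewrite (act_eichler_fix a12) ?dot_basE.
- rewrite (act_eichler _ a12) /qf !dot_basE //= scale1r scale0r subr0 !mul0r scale0r subr0 //.
Qed.

Lemma gl_c : (2 < n)%N -> commute sg (sg ^ (U ^ (W * U^-1)))%g.
Proof.
move=> n3; have iW : isom (U ^ (W * U^-1))%g := isomJ isom_U isom_VU.
have last s : act (bas (n.-1, s)) (W * U^-1)%g = - eps *: b 1 s.
  have [e0 _] := act_U_inv s.
  by rewrite actM act_V_last actZ e0 scalerN scaleNr.
have e1 s : act (b 1 s) (U ^ (W * U^-1))%g = b 1 s.
  have lastU : act (bas (n.-1, s)) U = bas (n.-1, s).
    rewrite act_U /=; last by rewrite prednK.
    have -> : (n.-1 == 0)%N = false by lia.
    by have -> : (n.-1 == 1)%N = false by lia.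
  have -> : b 1 s = - eps *: act (bas (n.-1, s)) (W * U^-1)%g.
    by rewrite last scalerA mulrNN eps2 scale1r.
  by rewrite actZ actJ lastU.
have e0 s : act (b 0 s) (U ^ (W * U^-1))%g = b 2 s.
  rewrite -{1}(act_VU0 s) actJ act_U //= actM act_V // act_fixV //.
  by rewrite act_U.
by rewrite (sJ iW (e0 _) (e1 _)); apply: s_fix; rewrite ?dot_basE //; apply: ad.
Qed.

Lemma gl_d : (3 < n)%N -> commute sg (sg ^ (W ^+ 2))%g.
Proof.
move=> n4; rewrite (sJ (isomX 2 isom_V) (x := b 2 true) (y := b 3 false)).
- by apply: s_fix; rewrite ?dot_basE //; first [apply: ad|lia] => //=; lia.
- by rewrite expg2 actM !act_V //; lia.
- by rewrite expg2 actM !act_V //; lia.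
Qed.

Lemma gl_vi : (2 < n)%N -> commute ta (sg ^ W)%g.
Proof.
move=> n3; have a12 : adapted (b 1 true) (b 2 false) by apply: ad.
rewrite sV //; apply: commute_conj.
rewrite (tJ (isom_eichler a12) (act_eichler_fix a12 _ _)
  (act_eichler_fix a12 _ _)) ?dot_basE ?dot_w_bas //.
Qed.

Lemma gl_relations : typeB_relations n p sg ta ze U W.
Proof.
split; [exact: gl_uvn | exact: gl_far | exact: gl_braid | exact: gl_vn
 | exact: gl_u4 | exact: gl_zz | exact: gl_zuu | exact: gl_zzu
 | exact: gl_zvu | exact: gl_zuv | exact: gl_avu | exact: gl_auv | exact: gl_a_cent
 | exact: gl_ap | exact: gl_zE | exact: gl_Ap | exact: gl_A_cent | exact: gl_uE
 | exact: gl_b | exact: gl_e | exact: gl_f | exact: gl_g | exact: gl_h | exact: gl_j].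
Qed.
End Matrices.

Local Close Scope ring_scope.

Local Open Scope group_scope.

(** * Presented groups *)

Section FreeMorphism.
Variables (T : choiceType) (K : groupType) (f : UMagmaMorphism.type (freegroup T) K).

Lemma fgword_prod (w : freegroup T) : w = feval (@fgen T) w.
Proof.
rewrite /feval; case: w => s; elim: s => [|a s IH] rs.
  by rewrite /= big_nil; apply: val_inj.
rewrite /= big_cons -(IH (reduced_tail rs)); apply: val_inj.
by case: a rs => x [] rs; rewrite /lval /= -push_cons.
Qed.

Lemma morph_feval w : f w = feval (fun x => f (fgen x)) w.
Proof.
rewrite [in LHS](fgword_prod w) /feval gmulf_prod; apply: eq_bigr => [[x []] _] //.
by rewrite /lval /= gmulfV.
Qed.

Lemma eq_feval (g h : T -> K) w : g =1 h -> feval g w = feval h w.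
Proof. by move=> gh; apply: eq_bigr => [[x b] _]; rewrite /lval /= gh. Qed.
End FreeMorphism.

Lemma feval_pair2 (H K : groupType) (f : UMagmaMorphism.type H K) x y w :
  f (feval (pair2 x y) w) = feval (pair2 (f x) (f y)) w.
Proof.
rewrite [LHS](gmulf_prod f); apply: eq_bigr => [[b e] _].
by case: b e => [] []; rewrite /lval //= gmulfV.
Qed.

Section Lift.
Variables (T : choiceType) (R : set (freegroup T)) (K : groupType).

Lemma normal_closure_kernel (h : T -> K) : (forall w, R w -> feval h w = 1) ->
  forall w, normal_closure R w -> feval h w = 1.
Proof.
move=> hR w Nw; have nK : normal_subgroup [set w | feval h w = 1]; last exact: (Nw _ nK hR).
split=> /=.
- exact: feval1.
- by move=> x y hx hy; rewrite gmulfM gmulfV /= hx hy mulgV.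
- by move=> x y hx; rewrite gmulfJ /= hx conj1g.
Qed.

Variable (h : T -> K).
Hypothesis hR : forall w, R w -> feval h w = 1.

Definition lift_fun (_ : forall w, R w -> feval h w = 1) (x : presented R) : K :=
  feval h (repr x).

Lemma lift_proj w : lift_fun hR (pres_proj R w) = feval h w.
Proof.
have : normal_closure R (repr (pres_proj R w) * w^-1).
  by apply/pres_projP; rewrite pres_projK.
move/(normal_closure_kernel hR); rewrite gmulfM gmulfV.
exact: divg1_eq.
Qed.
End Lift.

Section LiftMorphism.
Variables (T : choiceType) (R : set (freegroup T)) (K : groupType) (h : T -> K).
Hypothesis hR : forall w, R w -> feval h w = 1.

Lemma lift_funM : {morph lift_fun hR : x y / x * y}.
Proof.
move=> x y; rewrite -[x in LHS]pres_projK -[y in LHS]pres_projK.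
have -> : pres_proj R (repr x) * pres_proj R (repr y) = pres_proj R (repr x * repr y).
  by rewrite pres_projM.
by rewrite lift_proj gmulfM.
Qed.

Lemma lift_fun1 : lift_fun hR 1 = 1.
Proof. by have := lift_proj hR 1; rewrite feval1. Qed.

HB.instance Definition _ :=
  isUMagmaMorphism.Build (presented R) K (lift_fun hR) (conj lift_fun1 lift_funM).

Definition lift : UMagmaMorphism.type (presented R) K := lift_fun hR.
End LiftMorphism.

Section Projection.
Variables (T : choiceType) (R : set (freegroup T)).

Lemma pres_proj_morphM : {morph pres_proj R : x y / x * y}.
Proof. by move=> x y; rewrite pres_projM. Qed.

HB.instance Definition _ := isUMagmaMorphism.Build (freegroup T) (presented R) (pres_proj R)
  (conj (erefl : pres_proj R 1 = 1) pres_proj_morphM).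

Lemma pres_proj_rel w : R w -> pres_proj R w = 1.
Proof.
move=> Rw; have : normal_closure R (w * 1^-1).
  by move=> N _ RN; apply: RN; rewrite invg1 mulg1.
by move/pres_projP.
Qed.

Lemma presented_ind (H : presented R -> Prop) : subgroup H ->
  (forall x, H (pres_proj R (fgen x))) -> forall x, H x.
Proof.
move=> sH Hg x; rewrite -[x]pres_projK (morph_feval (pres_proj R)) /feval.
elim: (fgword _) => [|[y b] w IH]; first by rewrite big_nil; exact: sub1 sH.
rewrite big_cons; apply: (subM sH) => //; rewrite /lval /=.
by case: b; [apply: (subV sH)|].
Qed.
End Projection.

(** Relations between x and y also hold between x' and y' when the latter
    satisfy defining relations for x and y. *)
Lemma presents_transfer (K L : groupType) (x y : K) (x' y' : L) R w :
  presents (pair2 x y) R -> (forall r, R r -> feval (pair2 x' y') r = 1) ->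
  feval (pair2 x y) w = 1 -> feval (pair2 x' y') w = 1.
Proof.
move=> pR R' xyw; apply: (normal_closure_kernel R'); rewrite pR; exact: xyw.
Qed.

(** * The relations of the theorem *)

Section Relators.
Variables (n p : nat) (Rsgn RSL RPSL : set (freegroup bool)).
Hypothesis n_ge2 : (2 <= n)%N.

(** What the relators say of the images of the five generators. *)
Record defining_relations (K : groupType) (A a z u v : K) : Prop := {
  dr_sgn : 2 < n -> forall w, Rsgn w -> feval (pair2 u v) w = 1;
  dr_u4 : n = 2 -> u ^+ 4 = 1;
  dr_SL : forall w, RSL w -> feval (pair2 A u) w = 1;
  dr_PSL : forall w, RPSL w -> feval (pair2 a z) w = 1;
  dr_zuv : 2 < n -> [~ z, u ^ v] = 1;
  dr_zvu : 3 < n -> [~ z, v * u^-1] = 1;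
  dr_z2 : z ^+ 2 = 1;
  dr_zuu : [~ z, u ^+ 2] = 1;
  dr_zzu : [~ z, z ^ u] = 1;
  dr_auv : 2 < n -> [~ a, u ^ v] = 1;
  dr_avu : 3 < n -> [~ a, v * u^-1] = 1;
  dr_a_cent : [~ a, u ^+ 2 * z ^ u] = 1;
  dr_a : 2 < n -> [~ A, A ^ v] = A ^ (v * u^-1);
  dr_b : 2 < n -> [~ A, A ^ (v * u^-1)] = 1;
  dr_c : 2 < n -> [~ A, A ^ (u ^ (v * u^-1))] = 1;
  dr_d : 3 < n -> [~ A, A ^ (v ^+ 2)] = 1;
  dr_e : [~ A, A ^ (z ^ u)] = 1;
  dr_f : [~ a, a ^ u] = (A ^+ 2) ^ (z ^ u);
  dr_g : [~ A, a] = 1;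
  dr_h : [~ A ^ z, a] = A * a ^ (z * u);
  dr_j : 2 < n -> [~ A, a ^ (v ^+ 2)] = 1;
  dr_vi : n = 3 -> p = 3 -> [~ a, A ^ v] = 1 }.

Lemma defining_relations_rank2 (K : groupType) (A a z u v v' : K) : n <= 2 ->
  defining_relations A a z u v -> defining_relations A a z u v'.
Proof.
move=> n2; have n3 : (2 < n) = false by rewrite ltnNge n2.
have n4 : (3 < n) = false by apply/negbTE; rewrite -leqNgt; lia.
case=> *; split=> //; first [by rewrite n3 | by rewrite n4 | by move=> n3'; exfalso; lia].
Qed.

Local Notation F := (freegroup (gens n)).
Local Notation rels := (relators n p Rsgn RSL RPSL).

Let mem_when (b : bool) (l : seq F) x : (x \in when b l) = b && (x \in l).
Proof. by case: b. Qed.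

Lemma relatorsP (K : groupType) (f : UMagmaMorphism.type F K) :
  (forall r, rels r -> f r = 1) <->
  defining_relations (f (fgen (Gsigma n))) (f (fgen (Gtau n))) (f (fgen (Gz n)))
    (f (fgen (GU n))) (f (Vgen n)).
Proof.
pose fE := (gmulfR, gmulfM, gmulfV, gmulfJ, gmulfXn).
rewrite /relators /rels_i /rels_ii /rels_iii /rels_iv /rels_v /rels_vi.
move: (fgen (Gsigma n)) (fgen (Gtau n)) (fgen (Gz n)) (fgen (GU n)) (Vgen n).
move=> s t z u v; split=> [fR|fR r].
  have i r := fun h => fR r (or_introl (or_introl (or_introl (or_introl (or_introl h))))).
  have ii r := fun h => fR r (or_introl (or_introl (or_introl (or_introl (or_intror h))))).
  have iii r := fun h => fR r (or_introl (or_introl (or_introl (or_intror h)))).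
  have iv r := fun h => fR r (or_introl (or_introl (or_intror h))).
  have v' r := fun h => fR r (or_introl (or_intror h)).
  have vi r := fun h => fR r (or_intror h).
  have {}i' r := fun h => i r (or_intror h).
  have {}i r := fun h => i r (or_introl h).
  move: i' ii v' vi => /= i' ii v' vi.
  have eq1 (x y : K) : x * y^-1 = 1 -> x = y := @divg1_eq _ x y.
  split; rewrite -?fE.
  - move=> n3 w Rw; rewrite -feval_pair2; apply: i; rewrite n3; by exists w.
  - by move=> n2; apply: i; have -> : (2 < n) = false by rewrite n2.
  - move=> w Rw; rewrite -feval_pair2; apply: iii; by exists w.
  - move=> w Rw; rewrite -feval_pair2; apply: iv; by exists w.
  - by move=> n3; apply: i'; rewrite !mem_cat !mem_when n3 !in_cons eqxx ?orbT.
  - by move=> n3; apply: i'; rewrite !mem_cat !mem_when n3 !in_cons eqxx ?orbT.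
  - by apply: i'; rewrite !mem_cat !mem_when !in_cons eqxx ?orbT.
  - by apply: i'; rewrite !mem_cat !mem_when !in_cons eqxx ?orbT.
  - by apply: i'; rewrite !mem_cat !mem_when !in_cons eqxx ?orbT.
  - by move=> n3; apply: ii; rewrite !mem_cat !mem_when n3 !in_cons eqxx ?orbT.
  - by move=> n3; apply: ii; rewrite !mem_cat !mem_when n3 !in_cons eqxx ?orbT.
  - by apply: ii; rewrite !mem_cat !mem_when !in_cons eqxx ?orbT.
  - by move=> n3; apply: eq1; rewrite -?fE; apply: v'; rewrite !mem_cat !mem_when n3 !in_cons eqxx ?orbT.
  - by move=> n3; apply: v'; rewrite !mem_cat !mem_when n3 !in_cons eqxx ?orbT.
  - by move=> n3; apply: v'; rewrite !mem_cat !mem_when n3 !in_cons eqxx ?orbT.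
  - by move=> n3; apply: v'; rewrite !mem_cat !mem_when n3 !in_cons eqxx ?orbT.
  - by apply: v'; rewrite !mem_cat !mem_when !in_cons eqxx ?orbT.
  - by apply: eq1; rewrite -?fE; apply: v'; rewrite !mem_cat !mem_when !in_cons eqxx ?orbT.
  - by apply: v'; rewrite !mem_cat !mem_when !in_cons eqxx ?orbT.
  - by apply: eq1; rewrite -?fE; apply: v'; rewrite !mem_cat !mem_when !in_cons eqxx ?orbT.
  - by move=> n3; apply: v'; rewrite !mem_cat !mem_when n3 !in_cons eqxx ?orbT.
  - move=> n3 p3; apply: vi; rewrite mem_when; have -> : (n == 3) && (p == 3) by rewrite n3 p3.
    by rewrite in_cons eqxx.
have D := fR; case=> [[[[[[ri|]|]|[w Rw <-]]|[w Rw <-]]|]|].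
- move: ri; case: ltnP => [n3 [w Rw <-]|n2 ->]; first by rewrite feval_pair2 (dr_sgn D).
  by rewrite gmulfXn (dr_u4 D) //; lia.
- rewrite /= !mem_cat !mem_when !in_cons !in_nil !orbF.
  case/or3P=> [/andP[n3 /eqP->]|/andP[n3 /eqP->]|/or3P[/eqP->|/eqP->|/eqP->]]; rewrite !fE.
  + exact: dr_zuv D n3.
  + exact: dr_zvu D n3.
  + exact: dr_z2 D.
  + exact: dr_zuu D.
  + exact: dr_zzu D.
- rewrite /= !mem_cat !mem_when !in_cons !in_nil !orbF.
  case/or3P=> [/andP[n3 /eqP->]|/andP[n3 /eqP->]|/eqP->]; rewrite !fE.
  + exact: dr_auv D n3.
  + exact: dr_avu D n3.
  + exact: dr_a_cent D.
- by rewrite feval_pair2 (dr_SL D).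
- by rewrite feval_pair2 (dr_PSL D).
- rewrite /= !(mem_cat, mem_when, in_cons, in_nil, orbF).
  case/or3P=> [/andP[n3 /or3P[/eqP->|/eqP->|/eqP->]]|/andP[n3 /eqP->]|
    /or4P[/eqP->|/eqP->|/eqP->|/orP[/eqP->|/andP[n3 /eqP->]]]]; rewrite !fE.
  + by rewrite (dr_a D n3) mulgV.
  + exact: dr_b D n3.
  + exact: dr_c D n3.
  + exact: dr_d D n3.
  + exact: dr_e D.
  + by rewrite (dr_f D) mulgV.
  + exact: dr_g D.
  + by rewrite (dr_h D) mulgV.
  + exact: dr_j D n3.
- rewrite /= mem_when in_cons in_nil orbF => /andP[/andP[/eqP n3 /eqP p3] /eqP->].
  by rewrite !fE (dr_vi D).
Qed.

(** In rank 2, where the cycle V' is U', the fifth generator is absent. *)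
Definition cyclel (K : Type) (u v : K) := if 2 < n then v else u.

(** Von Dyck's theorem for the presented group. *)
Lemma presented_morphism (K : groupType) (A a z u v : K) : defining_relations A a z u v ->
  exists f : UMagmaMorphism.type (presented rels) K,
    let g x := pres_proj rels (fgen x) in
    [/\ f (g (Gsigma n)) = A, f (g (Gtau n)) = a, f (g (Gz n)) = z, f (g (GU n)) = u
      & f (cyclel (g (GU n)) (pres_proj rels (Vgen n))) = cyclel u v].
Proof.
move=> D; pose h (x : gens n) := match x with
  Gsigma => A | Gtau => a | Gz => z | GU => u | GV _ => v end.
have hR r : rels r -> feval h r = 1.
  apply: (proj2 (relatorsP (feval h))) => /=; rewrite !feval_gen /=.
  case: (ltnP 2 n) => [n3|n2]; first by rewrite (VgenE n3) feval_gen.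
  exact: defining_relations_rank2 n2 D.
exists (lift hR).
have E w : lift hR (pres_proj rels w) = feval h w by apply: lift_proj.
split; rewrite ?E ?feval_gen // /cyclel.
by case: (ltnP 2 n) => [n3|n2]; rewrite E ?feval_gen // (VgenE n3) feval_gen.
Qed.


Hypotheses (p_prime : prime p) (p_odd : odd p).
Hypotheses
  (Rsgn_pres : (2 < n)%N -> presents (pair2 (Uel n p) (Vel n p)) Rsgn)
  (RSL_pres : presents (pair2 (sigma n p) (Uel n p)) RSL)
  (RPSL_pres : presents (pair2 (tau n p) (zel n p)) RPSL).

Local Notation std := (standard_generators n_ge2 p_prime p_odd).

Lemma gl_defining_relations :
  defining_relations (sigma n p) (tau n p) (zel n p) (Uel n p) (Vel n p).
Proof.
have pres (x y : {'GL_n.*2.+1['F_p]}) R w : presents (pair2 x y) R -> R w ->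
    feval (pair2 x y) w = 1.
  move=> pR Rw; have : normal_closure R w by move=> N _; apply.
  by rewrite pR.
have rB := gl_relations n_ge2 p_prime p_odd std.
have c1 (x y : {'GL_n.*2.+1['F_p]}) : commute x y -> [~ x, y] = 1 by move/comm1P.
split.
- by move=> n3 w; apply: pres; apply: Rsgn_pres.
- by move=> _; exact: rB_u4 rB.
- by move=> w; apply: pres.
- by move=> w; apply: pres.
- by move=> n3; apply/c1/(rB_zuv rB).
- by move=> n3; apply/c1/(rB_zvu rB).
- exact: rB_z2 rB.
- exact/c1/(rB_zuu rB).
- exact/c1/(rB_zzu rB).
- by move=> n3; apply/c1/(rB_auv rB).
- by move=> n3; apply/c1/(rB_avu rB).
- exact/c1/(rB_a_cent rB).
- by move=> n3; apply: (gl_a n_ge2 p_prime p_odd std n3).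
- by move=> n3; apply/c1/(rB_b rB).
- by move=> n3; apply/c1/(gl_c n_ge2 p_prime p_odd std n3).
- by move=> n3; apply/c1/(gl_d n_ge2 p_prime p_odd std n3).
- exact/c1/(rB_e rB).
- exact: rB_f rB.
- exact/c1/(rB_g rB).
- exact: rB_h rB.
- by move=> n3; apply/c1/(rB_j rB).
- by move=> n3 _; apply/c1/(gl_vi n_ge2 p_prime p_odd std); rewrite n3.
Qed.

(** The presented group satisfies the relations of a group of type B: those
    between two generators are read off in the matrix groups that the generators
    present. *)
Lemma defining_typeB (K : groupType) (A a z u v : K) :
  defining_relations A a z u v -> typeB_relations n p A a z u (cyclel u v).
Proof.
move=> D; have rB := gl_relations n_ge2 p_prime p_odd std.
have c1 (x y : K) : [~ x, y] = 1 -> commute x y by move/comm1P.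
have g1 (x y : {'GL_n.*2.+1['F_p]}) : commute x y -> [~ x, y] = 1 by move/comm1P.
have eq1 (x y : K) : x * y^-1 = 1 -> x = y := @divg1_eq _ x y.
have geq1 (x y : {'GL_n.*2.+1['F_p]}) : x = y -> x * y^-1 = 1 by move=> ->; exact: mulgV.
pose X : freegroup bool := fgen false; pose Y : freegroup bool := fgen true.
have eX (L : groupType) (x y : L) : feval (pair2 x y) X = x by exact: feval_gen.
have eY (L : groupType) (x y : L) : feval (pair2 x y) Y = y by exact: feval_gen.
have SL w := @presents_transfer _ _ _ _ A u RSL w RSL_pres (dr_SL D).
have PSL w := @presents_transfer _ _ _ _ a z RPSL w RPSL_pres (dr_PSL D).
have Sgn (n3 : 2 < n) w := @presents_transfer _ _ _ _ u v Rsgn w (Rsgn_pres n3) (dr_sgn D n3).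
have u4 : u ^+ 4 = 1.
  have := SL (Y ^+ 4); rewrite !(gmulfR, gmulfM, gmulfV, gmulfJ, gmulfXn) /= !eY; apply; exact: rB_u4 rB.
have A_cent : commute A (u ^+ 2).
  apply: c1; have := SL [~ X, Y ^+ 2]; rewrite !(gmulfR, gmulfM, gmulfV, gmulfJ, gmulfXn) /= !(eX, eY); apply.
  exact/g1/(rB_A_cent rB).
have uE : u = A * A ^ u * A.
  apply: eq1; have := SL (Y * (X * X ^ Y * X)^-1); rewrite !(gmulfR, gmulfM, gmulfV, gmulfJ, gmulfXn) /= !(eX, eY); apply.
  exact/geq1/(rB_uE rB).
have Ap : A ^+ p = 1.
  have := SL (X ^+ p); rewrite !(gmulfR, gmulfM, gmulfV, gmulfJ, gmulfXn) /= !eX; apply; exact: rB_Ap rB.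
have ap : a ^+ p = 1.
  have := PSL (X ^+ p); rewrite !(gmulfR, gmulfM, gmulfV, gmulfJ, gmulfXn) /= !eX; apply; exact: rB_ap rB.
have zE : z = a * a ^ z * a.
  apply: eq1; have := PSL (Y * (X * X ^ Y * X)^-1); rewrite !(gmulfR, gmulfM, gmulfV, gmulfJ, gmulfXn) /= !(eX, eY); apply.
  exact/geq1/(rB_zE rB).
case: (ltnP 2 n) => [n3|n2]; last first.
  have {}n2 : n = 2 by lia.
  rewrite /cyclel; have -> : (2 < n) = false by rewrite n2.
  split=> //; rewrite ?n2 ?mulgV //.
  - exact: commuteX (commute_refl u).
  - by move=> k k2 k4; lia.
  - exact: dr_z2 D.
  - exact/c1/(dr_zuu D).
  - exact/c1/(dr_zzu D).
  - exact: commute1.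
  - exact: commute1.
  - exact/c1/(dr_a_cent D).
  - exact/c1/(dr_e D).
  - exact: dr_f D.
  - exact/c1/(dr_g D).
  - exact: dr_h D.
rewrite /cyclel n3.
have vu3 : n = 3 -> v * u^-1 = u ^ v.
  move=> n3'; apply: eq1; have := Sgn n3 ((Y * X^-1) * (X ^ Y)^-1).
  rewrite !(gmulfR, gmulfM, gmulfV, gmulfJ, gmulfXn) /= !(eX, eY); apply.
  exact/geq1/(gl_UV3 n_ge2 p_prime p_odd std).
have n_gt3 : n <> 3 -> 3 < n by lia.
split=> //.
- apply: c1; have := Sgn n3 [~ X, Y ^+ n].
  rewrite !(gmulfR, gmulfM, gmulfV, gmulfJ, gmulfXn) /= !(eX, eY); apply.
  exact/g1/(rB_uvn rB).
- move=> k k2 kn; apply: c1; have := Sgn n3 [~ X, X ^ (Y ^+ k)].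
  rewrite !(gmulfR, gmulfM, gmulfV, gmulfJ, gmulfXn) /= !(eX, eY); apply.
  exact/g1/(rB_far rB).
- move=> _; apply: eq1; have := Sgn n3 ((X * X ^ Y * X) * (X ^ Y * X * X ^ Y)^-1).
  rewrite !(gmulfR, gmulfM, gmulfV, gmulfJ, gmulfXn) /= !(eX, eY); apply.
  exact/geq1/(rB_braid rB).
- apply: eq1; have := Sgn n3 (Y ^+ n * ((Y * X) ^+ n.-1)^-1).
  rewrite !(gmulfR, gmulfM, gmulfV, gmulfJ, gmulfXn) /= !(eX, eY); apply.
  exact/geq1/(rB_vn rB).
- exact: dr_z2 D.
- exact/c1/(dr_zuu D).
- exact/c1/(dr_zzu D).
- apply: c1; have [n3'|n3'] := eqVneq n 3; last by apply: (dr_zvu D); apply/n_gt3/eqP.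
  by rewrite vu3 // (dr_zuv D).
- by move=> _; apply/c1/(dr_zuv D).
- apply: c1; have [n3'|n3'] := eqVneq n 3; last by apply: (dr_avu D); apply/n_gt3/eqP.
  by rewrite vu3 // (dr_auv D).
- by move=> _; apply/c1/(dr_auv D).
- exact/c1/(dr_a_cent D).
- by move=> _; apply/c1/(dr_b D).
- exact/c1/(dr_e D).
- exact: dr_f D.
- exact/c1/(dr_g D).
- exact: dr_h D.
- by move=> _; apply/c1/(dr_j D).
Qed.
End Relators.

Local Close Scope group_scope.

Local Open Scope ring_scope.

Section Faithful.
Local Notation idx := (nat * bool)%type.
Variables (n p : nat).
Hypotheses (n_ge2 : (2 <= n)%N) (p_prime : prime p) (p_odd : odd p).
Variables (G : groupType) (t : idx -> G) (S : idx -> idx -> G) (r q : nat -> G).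
Hypothesis rd : root_data n p t S r q.
Local Notation F := 'F_p.
Local Notation V := 'rV[F]_(n.*2.+1).
Local Notation GL := {'GL_n.*2.+1[F]}.
Local Notation w := (bw n p).
Local Notation bas := (bas n p).
Local Notation act_eichler := (act_eichler p_prime p_odd).
Local Notation act_eichler_fix := (act_eichler_fix p_prime p_odd).
Local Notation eichlerJ := (eichlerJ p_prime p_odd).
Local Notation eichlerM := (eichlerM p_prime p_odd).
Local Notation eichlerN := (eichlerN p_prime p_odd).
Local Notation eichlerX := (eichlerX p_prime p_odd).
Local Notation isom_eichler := (isom_eichler p_prime p_odd).
Local Notation two_neq0 := (two_neq0 p_prime p_odd).
Variable f : UMagmaMorphism.type G GL.
Hypothesis ft : forall x, (x.1 < n)%N -> f (t x) = eichler (bas x) w.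
Hypothesis fr : forall k i s, (k.+1 < n)%N -> (i < n)%N -> act (bas (i, s)) (f (r k)) =
  if i == k then bas (k.+1, s) else if i == k.+1 then - bas (k, s) else bas (i, s).
Hypothesis fr_w : forall k, (k.+1 < n)%N -> act w (f (r k)) = w.
Definition adjgen k (g : G) := g = S (k, true) (k.+1, false) \/ g = r k.
Definition adj k := gen (adjgen k).
Hypothesis ker_adj : forall k g, (k.+1 < n)%N -> adj k g -> f g = 1%g -> g = 1%g.
Hypothesis ker_G1 : forall g, Gn t 1 g -> f g = 1%g -> g = 1%g.
Local Notation Gn := (Gn t).
Local Notation Q := (Q t S).

Let p_gt0 : (0 < p)%N. Proof. exact: prime_gt0. Qed.
Let n_gt0 : (0 < n)%N. Proof. exact: ltnW. Qed.

Let q1 : qf w = - 1. Proof. by rewrite /qf dot_ww mulNr divff ?two_neq0. Qed.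

Let natF k : (k%:R == 0 :> F) = (p %| k)%N.
Proof. by rewrite -(dvdn_pcharf (pchar_Fp p_prime)). Qed.

Let exp_dvd (g : G) k : (g ^+ p = 1)%g -> k%:R = 0 :> F -> (g ^+ k = 1)%g.
Proof.
by move=> gp /eqP; rewrite natF => /dvdnP[m ->]; rewrite mulnC expgnA gp expg1n.
Qed.

Lemma nat_of_F (c : F) : exists k : nat, c = k%:R.
Proof. by exists (val c); rewrite natr_Zp. Qed.

Lemma commg_eichler_w x y : dot x x = 0 -> dot y y = 0 -> dot x y = 0 ->
  dot x w = 0 -> dot y w = 0 ->
  [~ eichler x w, eichler y w]%g = eichler x (2 *: y).
Proof.
move=> xx yy xy xw yw; have wx : dot w x = 0 by rewrite dotC.
have wy : dot w y = 0 by rewrite dotC.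
have ax : adapted x w by []. have ay : adapted y w by [].
have axy : adapted x (2 *: y) by apply: adaptedZ; split; rewrite // dotC.
rewrite /commg (eichlerJ (isom_eichler ay) ax) (act_eichler_fix ay xy xw).
have -> : act w (eichler y w) = w + 2 *: y.
  by rewrite (act_eichler _ ay) wy mulr0 !scale0r addr0 subr0 dot_ww scaleNr opprK.
by rewrite -(eichlerN ax) (eichlerM (adaptedN ax) (adaptedD ax axy)) addKr.
Qed.

Lemma fS x y : (x.1 < n)%N -> (y.1 < n)%N -> x.1 != y.1 ->
  f (S x y) = eichler (bas x) (bas y).
Proof.
move=> xn yn xy; rewrite (rd_Sdef rd) gmulfXn gmulfR !ft //.
have axy := adapted_bas p xn yn xy.
rewrite commg_eichler_w ?dot_bas_w // ?dot_bas // ?eqxx ?andbF //; last by rewrite (negPf xy).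
rewrite (eichlerX _ (adaptedZ _ axy)) scalerA; congr eichler.
rewrite -natrM muln2 even_halfK /=; last by rewrite p_odd.
by rewrite -natr1 (pcharf0 (pchar_Fp p_prime)) add0r scale1r.
Qed.

Lemma fq i : (i < n)%N -> [/\ forall s, act (bas (i, s)) (f (q i)) = bas (i, ~~ s),
  act w (f (q i)) = - w &
  forall j s, (j < n)%N -> j != i -> act (bas (j, s)) (f (q i)) = bas (j, s)].
Proof.
move=> ilt; have ad s : adapted (bas (i, s)) w by apply: adapted_w.
have e : dot (bas (i, false)) (bas (i, true)) = 1 by rewrite dot_basE // eqxx.
have [hx hy hw hf] := weyl_short p_prime p_odd (ad false) (ad true) e q1 (dot_ww n p).
have -> : f (q i) = (eichler (bas (i, true)) w * eichler (bas (i, false)) (- w) *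
    eichler (bas (i, true)) w)%g.
  by rewrite (rd_q_word rd) !gmulfM gmulfV !ft // -eichlerN.
split=> [[]|//|j s jlt ji] //.
by apply: hf; rewrite ?dot_basE ?dot_bas_w // (negPf ji).
Qed.

Lemma Gn_fix l j s g : (l <= j)%N -> (j < n)%N -> Gn l g ->
  act (bas (j, s)) (f g) = bas (j, s).
Proof.
move=> lj jn; apply: (gen_min (H := fun g => act (bas (j, s)) (f g) = bas (j, s))) => [|_ [x xl ->]].
  split=> [|x y Hx Hy|x Hx]; first by rewrite gmulf1 act1.
    by rewrite gmulfM actM Hx.
  by rewrite gmulfV act_fixV.
have xn : (x.1 < n)%N by lia.
rewrite ft // (act_eichler_fix (adapted_w p xn)) ?dot_bas_w // dot_bas //.
by rewrite gtn_eqF ?(leq_trans xl).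
Qed.

Lemma Gn_isom l g : (l <= n)%N -> Gn l g -> isom (f g).
Proof.
move=> ln; apply: (gen_min (H := fun g => isom (f g))) => [|_ [x xl ->]].
  split=> [|x y Hx Hy|x Hx]; first by rewrite gmulf1; exact: isom1.
    by rewrite gmulfM; exact: isomM.
  by rewrite gmulfV; exact: isomV.
have xn : (x.1 < n)%N by lia.
by rewrite ft //; apply: isom_eichler; apply: adapted_w.
Qed.

(** ** The radical is faithfully represented *)

(* The radical is commutative, so its elements are products of powers of the
   generators; the one with index (l, _) is the short root element. *)
Definition rad_elt l (c : idx) := if c.1 == l then t (l, true) else S (l, true) c.
Definition rad_vec l (c : idx) := if c.1 == l then w else bas c.
Definition rad_idx l : seq idx :=
  (l, true) :: [seq (i, true) | i <- iota 0 l] ++ [seq (i, false) | i <- iota 0 l].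

Let mem_pairs l b (c : idx) :
  (c \in [seq (i, b) | i <- iota 0 l]) = (c.1 < l)%N && (c.2 == b).
Proof.
apply/mapP/andP => [[i] /[!mem_iota] /andP[_ il] -> //|[cl /eqP e]].
by exists c.1; rewrite ?mem_iota // -e; case: (c).
Qed.

Lemma mem_rad_idx l c : (c \in rad_idx l) = ((c == (l, true)) || (c.1 < l)%N).
Proof.
by rewrite in_cons mem_cat !mem_pairs -andb_orr; case: (c.2); rewrite andbT.
Qed.

Lemma uniq_rad_idx l : uniq (rad_idx l).
Proof.
have inj b : injective (fun i : nat => (i, b)) by move=> i j [].
rewrite /rad_idx cons_uniq mem_cat !mem_pairs /= ltnn cat_uniq !map_inj_uniq //.
rewrite !iota_uniq /= andbT; apply/hasPn => c.
by rewrite /= !mem_pairs => /andP[_ /eqP->]; rewrite andbF.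
all: exact: inj.
Qed.

Definition rad_prod l (k : idx -> nat) := (\prod_(c <- rad_idx l) rad_elt l c ^+ k c)%g.

Lemma rad_elt_gen l c : c \in rad_idx l -> radgen t S l (rad_elt l c).
Proof.
rewrite mem_rad_idx /rad_elt => /predU1P[->|cl]; first by rewrite eqxx; left.
by rewrite ltn_eqF //; right; exists c.
Qed.

Lemma rad_prodD l k m : (l < n)%N ->
  (rad_prod l k * rad_prod l m)%g = rad_prod l (fun c => k c + m c)%N.
Proof.
move=> ln; rewrite /rad_prod.
have Q1 c : c \in rad_idx l -> Q l (rad_elt l c) by move=> /rad_elt_gen; apply: mem_gen.
elim: (rad_idx l) Q1 => [|c s IH] Qs; first by rewrite !big_nil mulg1.
rewrite !big_cons -IH; last by move=> d ds; apply: Qs; rewrite in_cons ds orbT.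
have sQ := Q_sub t S l.
have c1 : commute (\prod_(d <- s) rad_elt l d ^+ k d)%g (rad_elt l c ^+ m c)%g.
  apply: (Q_commute rd ln); last first.
    by apply: (subX _ sQ); apply: Qs; rewrite mem_head.
  elim: s {IH} Qs => [|d s IH] Qs; first by rewrite big_nil; exact: (sub1 sQ).
  rewrite big_cons; apply: (subM sQ).
    by apply: (subX _ sQ); apply: Qs; rewrite !in_cons eqxx orbT.
  by apply: IH => b; rewrite in_cons => /orP[/eqP->|bs]; apply: Qs; rewrite !in_cons ?eqxx ?bs ?orbT.
rewrite expgnDr; move: c1.
move: (\prod_(d <- s) _)%g (\prod_(d <- s) _)%g (_ ^+ k c)%g (_ ^+ m c)%g.
by move=> P2 P1 y z c1; rewrite -!mulgA (mulgA P1) c1 !mulgA.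
Qed.

Lemma Q_prod l g : (l < n)%N -> Q l g -> exists k, g = rad_prod l k.
Proof.
move=> ln; apply: (gen_right (H := fun g => exists k, g = rad_prod l k)) => [y|| _ y [k ->] yR].
- exact: (radgen_fin p_gt0 rd ln).
- by exists (fun=> 0%N); rewrite /rad_prod big1.
- have [c cI ->] : exists2 c, c \in rad_idx l & y = rad_elt l c.
    case: yR => [->|[c cl ->]]; [exists (l, true)|exists c];
      by rewrite ?mem_rad_idx /rad_elt ?eqxx ?cl ?orbT ?ltn_eqF.
  exists (fun d => k d + (d == c))%N; rewrite -rad_prodD //; congr (_ * _)%g.
  have cu : count_mem c (rad_idx l) = 1%N by rewrite count_uniq_mem ?uniq_rad_idx ?cI.
  rewrite /rad_prod; elim: (rad_idx l) cu => //= d s IH; rewrite big_cons.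
  case: (eqVneq d c) => [->|dc] /=; rewrite ?add0n => e; last by rewrite expg0 mul1g IH.
  rewrite expg1 big1_seq ?mulg1 // => b /andP[_ bs].
  have [bc|//] := eqVneq b c; suff : (0 < count_mem c s)%N by rewrite (addnI e : count_mem c s = 0%N).
  by rewrite -has_count; apply/hasP; exists b; rewrite // /= bc.
Qed.

Lemma f_rad_prod l k : (l < n)%N ->
  adapted (bas (l, true)) (\sum_(c <- rad_idx l) (k c)%:R *: rad_vec l c) /\
  f (rad_prod l k) =
    eichler (bas (l, true)) (\sum_(c <- rad_idx l) (k c)%:R *: rad_vec l c).
Proof.
move=> ln; rewrite /rad_prod.
have ad c : c \in rad_idx l -> adapted (bas (l, true)) (rad_vec l c) /\
    f (rad_elt l c) = eichler (bas (l, true)) (rad_vec l c).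
  rewrite mem_rad_idx /rad_elt /rad_vec => /predU1P[->|cl].
    by rewrite eqxx ft //; split=> //; apply: adapted_w.
  have cn : (c.1 < n)%N by lia.
  have lc : l != c.1 by rewrite gtn_eqF.
  by rewrite ltn_eqF // fS //; split=> //; apply: adapted_bas.
have a0 : adapted (bas (l, true)) w by apply: adapted_w.
elim: (rad_idx l) ad => [|c s IH] ad.
  by rewrite !big_nil gmulf1 (eichler0 p_prime p_odd a0); split=> //; exact: adapted0 a0.
have [as_ fs] := IH (fun d ds => ad d (mem_behead (s := c :: s) ds)).
have [ac fc] := ad c (mem_head c s).
have ak := adaptedZ (k c)%:R ac.
rewrite !big_cons gmulfM gmulfXn fc fs (eichlerX _ ac) (eichlerM ak as_).
by split; first exact: adaptedD ak as_.
Qed.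

Lemma dot_sum (I : Type) (s : seq I) (g : I -> V) x :
  dot (\sum_(i <- s) g i) x = \sum_(i <- s) dot (g i) x.
Proof.
elim: s => [|i s IH]; last by rewrite !big_cons dotDl IH.
by rewrite !big_nil -(scale0r x) dotZl mul0r.
Qed.

Definition rad_sum l (k : idx -> nat) : V := \sum_(c <- rad_idx l) (k c)%:R *: rad_vec l c.

Lemma rad_sum_dot l k c : (l < n)%N -> c \in rad_idx l ->
  dot (rad_sum l k) (rad_vec l (opp c)) = (k c)%:R * (if c.1 == l then - 2 else 1).
Proof.
move=> ln cI; have lt (d : idx) : (d.1 < l)%N -> (d.1 < n)%N by move=> dl; exact: ltn_trans ln.
rewrite /rad_sum dot_sum (bigD1_seq c) ?uniq_rad_idx //= big1_seq ?addr0.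
  rewrite dotZl /rad_vec; congr (_ * _); move: cI; rewrite mem_rad_idx.
  case/predU1P=> [->|cl]; first by rewrite eqxx dot_ww.
  by rewrite ltn_eqF // dot_bas ?lt // eqxx /opp /=; case: (c.2).
move=> /= d /andP[dc dI]; rewrite dotZl; move: cI dI; rewrite !mem_rad_idx /rad_vec.
case/predU1P=> [ce|cl] /predU1P[de|dl].
- by rewrite ce de eqxx in dc.
- by rewrite ce (ltn_eqF dl) eqxx dot_bas_w ?lt // mulr0.
- by rewrite de eqxx (ltn_eqF cl) dot_w_bas ?lt // mulr0.
- rewrite !ltn_eqF // dot_bas ?lt //; move: dc; case: (c) (d) => i s [j s'] /=.
  by rewrite /opp xpair_eqE /=; case: eqP => //= _; case: (s) (s') => [] [] // _; rewrite mulr0.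
Qed.

Lemma Q_inj l g : (l < n)%N -> Q l g ->
  act (bas (l, false)) (f g) = bas (l, false) -> g = 1%g.
Proof.
move=> ln Qg; have [k ->] := Q_prod ln Qg; have [au ->] := f_rad_prod k ln.
have lt (c : idx) : (c.1 < l)%N -> (c.1 < n)%N by move=> cl; exact: ltn_trans ln.
move: au; set u := \sum_(c <- _) _ => au.
have uE c : c \in rad_idx l -> dot u (rad_vec l (opp c)) =
    (k c)%:R * (if c.1 == l then - 2 else 1) by apply: rad_sum_dot.
have e1 : dot (bas (l, false)) (bas (l, true)) = 1 by rewrite dot_basE // eqxx.
rewrite (act_eichler _ au) e1 scale1r mulr1 => e.
have {e} [a ua] : exists a, u = a *: bas (l, true).
  exists (dot (bas (l, false)) u + qf u).
  have := congr1 (fun x => x - bas (l, false) + dot (bas (l, false)) u *: bas (l, true)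
    + qf u *: bas (l, true)) e.
  rewrite subrr add0r -scalerDl => <-.
  by apply/rowP=> i; rewrite !mxE; ring.
have k0 c : c \in rad_idx l -> (k c)%:R = 0 :> F.
  move=> cI; have := uE c cI; rewrite ua dotZl.
  have -> : dot (bas (l, true)) (rad_vec l (opp c)) = 0.
    rewrite /rad_vec /=; case: eqP => [_|/eqP cl]; first by rewrite dot_bas_w.
    have cn : (c.1 < n)%N.
      by move: cI; rewrite mem_rad_idx => /predU1P[ce|/lt //]; rewrite ce.
    by rewrite dot_bas //= eq_sym (negPf cl).
  rewrite mulr0 => /esym/eqP; rewrite mulf_eq0 => /predU1P[//|].
  by case: ifP => _; rewrite ?oppr_eq0 (negPf two_neq0, negPf (oner_neq0 _)).
rewrite /rad_prod big1_seq // => c /andP[_ cI].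
exact: exp_dvd (radgen_exp rd ln (rad_elt_gen cI)) (k0 c cI).
Qed.

Lemma Q_form l g : (l < n)%N -> Q l g -> exists2 u, adapted (bas (l, true)) u &
  f g = eichler (bas (l, true)) u.
Proof.
move=> ln /(Q_prod ln)[k ->]; have [au ->] := f_rad_prod k ln.
by exists (\sum_(c <- rad_idx l) (k c)%:R *: rad_vec l c).
Qed.

(** ** The three-parameter subgroup of two short root elements *)

(* T acts on the plane spanned by two short root elements modulo the long one;
   being faithfully represented, this group tells how T acts. *)
Section Heisenberg.
Variables x y : idx.
Hypotheses (xn : (x.1 < n)%N) (yn : (y.1 < n)%N) (xy : x.1 != y.1).
Definition heisgen (g : G) := [\/ g = t x, g = t y | g = S x y].
Definition heis := gen heisgen.

Let Sx : commute (S x y) (t x). Proof. by apply: (rd_St rd). Qed.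
Let Sy : commute (S x y) (t y).
Proof.
apply: eqi_commute (S_eqi rd _ _) (eqi_refl _) _.
by apply: (rd_St rd) => //; rewrite eq_sym.
Qed.

Lemma heis_form g : heis g -> exists i j k, g = (t x ^+ i * t y ^+ j * S x y ^+ k)%g.
Proof.
apply: (gen_right (H := fun g => exists i j k, g = (t x ^+ i * t y ^+ j * S x y ^+ k)%g)).
- move=> h [] ->; apply: (exp_finite_order p_gt0).
  + exact: (rd_texp rd).
  + exact: (rd_texp rd).
  + exact: (rd_Sexp rd).
- by exists 0%N, 0%N, 0%N; rewrite !expg0 !mulg1.
- move=> _ h [i [j [k ->]]] [] ->.
  + exists i.+1, j, (k + (p.-1 * 2 * j))%N.
    have e : (t y ^ t x = t y * S x y ^+ (p.-1 * 2))%g.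
      have tyx : [~ t y, t x]%g = (S x y ^+ (p.-1 * 2))%g.
        have S2p : ((S x y ^+ 2) ^+ p = 1)%g by rewrite expgnAC (rd_Sexp rd) // expg1n.
        rewrite -invgR (rd_tt rd) // mulnC expgnA; apply: (@mulgI _ (S x y ^+ 2)%g).
        by rewrite mulgV -expgS prednK.
      by rewrite (commg_eq tyx).
    rewrite expgSr; have -> : (t x ^+ i * t y ^+ j * S x y ^+ k * t x =
        t x ^+ i * (t y ^+ j * t x) * S x y ^+ k)%g.
      have Sk : commute (S x y ^+ k)%g (t x) by apply: commute_sym; apply: commuteX; apply: commute_sym.
      by rewrite -mulgA Sk !mulgA.
    rewrite (conjgC (t y ^+ j)%g) conjXg e expgMn; last by apply: commuteX; apply: commute_sym.
    by rewrite -expgnA [(k + _)%N]addnC expgnDr !mulgA.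
  + exists i, j.+1, k; have Sk : commute (S x y ^+ k)%g (t y).
      by apply: commute_sym; apply: commuteX; apply: commute_sym.
    by rewrite -mulgA Sk expgSr !mulgA.
  + by exists i, j, k.+1; rewrite expgSr !mulgA.
Qed.

Lemma heis_pow g : heis g -> forall c : F, f g = eichler (bas x) (c *: w) ->
  exists k, g = (t x ^+ k)%g.
Proof.
move=> /heis_form[i [j [k ->]]] c fg; exists i.
have ax := adapted_w p xn; have ay := adapted_w p yn; have axy := adapted_bas p xn yn xy.
have xx : dot (bas x) (bas x) = 0 by case: ax.
have xy0 : dot (bas x) (bas y) = 0 by rewrite dot_bas // (negPf xy).
have yx0 : dot (bas y) (bas x) = 0 by rewrite dotC.
have [yy xw yw] : [/\ dot (bas y) (bas y) = 0, dot (bas x) w = 0 & dot (bas y) w = 0].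
  by rewrite !dot_bas_w //; case: ay.
have [wx wy] : dot w (bas x) = 0 /\ dot w (bas y) = 0 by rewrite !dot_w_bas.
have [oyx oyw oyy] : [/\ dot (bas x) (bas (opp y)) = 0, dot w (bas (opp y)) = 0
    & dot (bas y) (bas (opp y)) = 1].
  rewrite dot_bas // dot_w_bas // dot_bas //= (negPf xy) eqxx; split=> //.
  by case: (y.2).
have axc := adaptedZ c ax; have axi := adaptedZ i%:R ax; have ayj := adaptedZ j%:R ay.
have axk := adaptedZ k%:R axy.
have hc := act_eichler w axc; have hi := act_eichler w axi.
have fE : f (t x ^+ i * t y ^+ j * S x y ^+ k)%g =
    (eichler (bas x) (i%:R *: w) * eichler (bas y) (j%:R *: w) *
     eichler (bas x) (k%:R *: bas y))%g.
  by rewrite !gmulfM !gmulfXn !ft // fS // (eichlerX _ ax) (eichlerX _ ay) (eichlerX _ axy).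
rewrite fE in fg.
have fx : act (bas x) (eichler (bas y) (j%:R *: w)) = bas x.
  by apply: (act_eichler_fix ayj); rewrite ?dotZr ?xw ?mulr0.
have [gx gy gw] : [/\ act (bas x) (eichler (bas x) (k%:R *: bas y)) = bas x,
    act (bas y) (eichler (bas x) (k%:R *: bas y)) = bas y
  & act w (eichler (bas x) (k%:R *: bas y)) = w].
  by split; apply: (act_eichler_fix axk); rewrite ?dotZr ?xx ?xy0 ?yx0 ?yy ?wx ?wy ?mulr0.
have hj := act_eichler w ayj.
have j0 : j%:R = 0 :> F.
  have := congr1 (fun h => dot (act w h) (bas (opp y))) fg; rewrite /= !actM hc hi.
  rewrite !dotZr wx dot_ww mulr0 !scale0r addr0 !subr0 -!scaleNr !actE fx hj.
  rewrite wy dotZr dot_ww mulr0 !scale0r addr0 subr0 -scaleNr !actE gx gy gw.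
  rewrite !dotDl !dotZl oyx oyw oyy !mulr0 !addr0 add0r mulr1 mulrN opprK => /eqP.
  by rewrite mulf_eq0 (negPf two_neq0) orbF => /eqP.
have k0 : k%:R = 0 :> F.
  have ozx : dot (bas (opp x)) (bas x) = 1.
    by rewrite dot_bas //= eqxx; case: (x.2).
  have zy : dot (bas (opp x)) (bas (opp y)) = 0 by rewrite dot_bas //= (negPf xy).
  move: fg; rewrite j0 scale0r (eichler0 p_prime p_odd ay) mulg1 eichlerM // => fg.
  have axik := adaptedD axi axk.
  have h1 := act_eichler (bas (opp x)) axc; have h2 := act_eichler (bas (opp x)) axik.
  have e := etrans (esym h2) (etrans (congr1 (act (bas (opp x))) fg) h1).
  have := congr1 (fun v => dot v (bas (opp y))) e.
  rewrite /= ozx !scale1r !dotDl !dotNl !dotZl.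
  rewrite oyx oyw oyy zy !mulr0 mulr1 !oppr0 !addr0 !add0r; exact.
by rewrite (exp_dvd (rd_texp rd _) j0) (exp_dvd (rd_Sexp rd xn yn xy) k0) !mulg1.
Qed.
End Heisenberg.
Lemma finite_order_eqi (x y : G) : eqi x y -> finite_order y -> finite_order x.
Proof. by case=> -> //; apply: finite_orderVV. Qed.

(** ** SL(2, p) acting on two consecutive isotropic planes *)

Section Adjacent.
Variable k : nat.
Hypothesis kn : (k.+1 < n)%N.
Let kn' : (k < n)%N. Proof. exact: ltnW. Qed.
Local Notation fk := (bas (k, true)).
Local Notation fl := (bas (k.+1, true)).
Local Notation ek := (bas (k, false)).
Local Notation el := (bas (k.+1, false)).

Let neq_k : (k == k.+1) = false. Proof. by rewrite ltn_eqF. Qed.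
Let neq_k' : (k.+1 == k) = false. Proof. by rewrite gtn_eqF. Qed.

Record sl2_action (h : GL) (a b c d : F) : Prop := {
  sl2_det : a * d - b * c = 1;
  sl2_fk : act fk h = a *: fk + b *: fl;
  sl2_fl : act fl h = c *: fk + d *: fl;
  sl2_ek : act ek h = d *: ek - c *: el;
  sl2_el : act el h = a *: el - b *: ek;
  sl2_w : act w h = w;
  sl2_fix : forall j s, (j < n)%N -> j != k -> j != k.+1 -> act (bas (j, s)) h = bas (j, s) }.

Lemma adjgen_fin g : adjgen k g -> finite_order g.
Proof.
case=> ->; last exact: swapV rd _.
by apply: (exp_finite_order p_gt0); apply: (rd_Sexp rd) => //=; rewrite neq_k.
Qed.

Lemma adj_action g : adj k g -> exists a b c d, sl2_action (f g) a b c d.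
Proof.
apply: (gen_right (H := fun g => exists a b c d, sl2_action (f g) a b c d)).
- exact: adjgen_fin.
- exists 1, 0, 0, 1; rewrite gmulf1; split=> *;
    by rewrite ?act1 ?scale0r ?scale1r ?addr0 ?add0r ?subr0 ?mulr0 ?mulr1 ?subr0.
move=> g1 g2 [a [b [c [d [g_det gfk gfl gek gel gw gfix]]]]] g2adj.
have [a' [b' [c' [d' [h_det hfk hfl hek hel hw hfix]]]]] :
    exists a' b' c' d', sl2_action (f g2) a' b' c' d'.
  case: g2adj => ->.
    have kl : (k, true).1 != (k.+1, false).1 by rewrite /= neq_k.
    exists 1, 0, (-1), 1; rewrite (fS (kn' : (k, true).1 < n)%N (kn : (k.+1, false).1 < n)%N kl).
    have ad : adapted fk el by apply: adapted_bas; rewrite //= neq_k.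
    have q0 : qf el = 0 by rewrite /qf dot_basE // eqxx mul0r.
    have d1 : dot ek fk = 1 by rewrite dot_basE // eqxx.
    have d2 : dot fl el = 1 by rewrite dot_basE // eqxx.
    split=> [||||||j s jn jk jl].
    - by rewrite mul1r mul0r subr0.
    - rewrite scale1r scale0r addr0; apply: (act_eichler_fix ad).
        by rewrite dot_basE // eqxx.
      by rewrite dot_basE // neq_k.
    - have d3 : dot fl fk = 0 by rewrite dot_basE // neq_k'.
      rewrite (act_eichler _ ad) q0 d2 d3 mul0r !scale0r subr0 addr0.
      by rewrite !scale1r scaleN1r addrC.
    - have d3 : dot ek el = 0 by rewrite dot_basE // neq_k.
      rewrite (act_eichler _ ad) q0 d1 d3 mul0r !scale0r !subr0.
      by rewrite !scale1r scaleN1r opprK.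
    - rewrite scale1r scale0r subr0; apply: (act_eichler_fix ad).
        by rewrite dot_basE // neq_k'.
      by rewrite dot_basE // eqxx.
    - by apply: (act_eichler_fix ad); rewrite dot_w_bas.
    - by apply: (act_eichler_fix ad); rewrite dot_basE // ?(negPf jk) ?(negPf jl).
  exists 0, 1, (-1), 0; split=> [||||||j s jn jk jl].
  - by rewrite mul0r mulrN1 add0r opprK.
  - by rewrite fr // eqxx scale0r add0r scale1r.
  - by rewrite fr // neq_k' eqxx scale0r addr0 scaleN1r.
  - by rewrite fr // eqxx scale0r add0r scaleN1r opprK.
  - by rewrite fr // neq_k' eqxx scale0r add0r scale1r.
  - exact: fr_w.
  - by rewrite fr // (negPf jk) (negPf jl).
exists (a * a' + b * c'), (a * b' + b * d'), (c * a' + d * c'), (c * b' + d * d').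
rewrite gmulfM; split; rewrite ?actM.
- rewrite -[1]mulr1 -{1}g_det -h_det; ring.
- by rewrite gfk !actE hfk hfl; apply/rowP=> i; rewrite !mxE; ring.
- by rewrite gfl !actE hfk hfl; apply/rowP=> i; rewrite !mxE; ring.
- by rewrite gek !actE hek hel; apply/rowP=> i; rewrite !mxE; ring.
- by rewrite gel !actE hek hel; apply/rowP=> i; rewrite !mxE; ring.
- by rewrite gw hw.
- by move=> j s jn jk jl; rewrite actM gfix // hfix.
Qed.

Lemma adj_commute g h : adj k g -> Gn k h -> commute g h.
Proof.
apply: commute_gen => _ _ [->|->] [x xk ->]; have xn : (x.1 < n)%N by lia.
  by apply: (rd_St_disjoint rd) => //=; rewrite ?neq_k //; lia.
apply: commute_sym; apply: commute_conj.
by case: x xk xn => i s /= *; apply: (rd_fix rd); lia.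
Qed.

Lemma heis_sym x y g : heis x y g -> heis y x g.
Proof.
apply: gen_sub => _ [->|->|->]; try by apply: mem_gen; constructor.
rewrite (rd_Ssym rd); apply: (subV (gen_subgroup _)); apply: mem_gen; exact: Or33.
Qed.

Lemma long_norm_heis a c : (a.1 < n)%N -> (c.1 < n)%N -> a.1 != c.1 ->
  normalises (heis a (opp c)) (S a c).
Proof.
move=> an cn ac; have ca : c.1 != a.1 by rewrite eq_sym.
have sH := gen_subgroup (heisgen a (opp c)).
have [X [T [Y [W [eX eT eY eW XT]]]]] := rd_St_opp rd cn an ca.
have HT : heis a (opp c) (t (opp c)) by apply: mem_gen; exact: Or32.
have Ha : heis a (opp c) (t a) by apply: mem_gen; exact: Or31.
have HS : heis a (opp c) (S a (opp c)) by apply: mem_gen; exact: Or33.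
have eXS : eqi X (S a c) := eqi_trans eX (S_eqi rd _ _).
have HX : normalises (heis a (opp c)) X.
  apply: normalises_one => _ [->|->|->].
  - by rewrite (conj_commute (eqi_commute (eqi_refl _) (eqi_sym eXS)
      (commute_sym (rd_St rd an cn ac)))).
  - apply: (sub_eqi sH (eqiJ X (eqi_sym eT))); rewrite (commg_eqV XT).
    apply: (subM sH); first exact: (sub_eqi sH eT).
    apply: (subV sH); apply: (subM sH); last exact: (sub_eqi sH eW).
    by apply: (sub_eqi sH eY); apply: (sub_eqi sH (S_eqi rd _ _)).
  - by rewrite (conj_commute (eqi_commute (eqi_refl _) (eqi_sym eXS)
      (commute_sym (rd_SSopp rd an cn ac)))).
case: (eqi_sym eXS) => ->; first exact: HX.
apply: normalisesV HX; apply: finite_order_eqi eXS _.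
by apply: (exp_finite_order p_gt0); apply: (rd_Sexp rd).
Qed.

Lemma adj_norm_heis b g : adj k g -> normalises (heis (k, b) (k.+1, b)) g.
Proof.
apply: (gen_right (H := fun g => normalises (heis (k, b) (k.+1, b)) g)).
- exact: adjgen_fin.
- by move=> h; rewrite conjg1.
move=> g1 g2 H1 H2 h /H1; rewrite conjgM; move: (h ^ g1)%g => {H1}h.
have kl : (k, b).1 != (k.+1, b).1 by rewrite /= neq_k.
case: H2 => ->.
  case: b {kl} h => h Hh.
    by apply: (long_norm_heis (a := (k, true)) (c := (k.+1, false))); rewrite //= neq_k.
  have nH : normalises (heis (k.+1, false) (k, false)) (S (k.+1, false) (k, true)).
    by apply: (long_norm_heis (a := (k.+1, false)) (c := (k, true))); rewrite //= neq_k'.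
  apply: heis_sym; rewrite (rd_Ssym rd); apply: normalisesV; last exact: heis_sym.
    by apply: (exp_finite_order p_gt0); apply: (rd_Sexp rd) => //=; rewrite neq_k'.
  exact: nH.
have sH := gen_subgroup (heisgen (k, b) (k.+1, b)).
apply: (conj_gen sH) => _ [] ->.
- by rewrite (rd_up rd); apply: mem_gen; exact: Or32.
- by rewrite (rd_down rd); apply: (subV sH); apply: mem_gen; exact: Or31.
- have e : eqi (S (k, b) (k.+1, b) ^ r k)%g (S (k.+1, b) (k, b)).
    apply: (rd_Sconj rd) => //; first by rewrite (rd_up rd); exact: eqi_refl.
    by rewrite (rd_down rd); right.
  by apply: (sub_eqi sH (eqi_trans e (S_eqi rd _ _))); apply: mem_gen; exact: Or33.
Qed.
End Adjacent.
Lemma dot_ext u v : (forall a, (a.1 < n)%N -> dot (bas a) u = dot (bas a) v) ->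
  dot w u = dot w v -> u = v.
Proof.
move=> uv uvw; apply/rowP=> i.
suff e b : in_basis b -> (b *m u^T) 0 0 = (b *m v^T) 0 0.
  by have := e _ (in_basis_delta p i); rewrite -!rowE !mxE.
case=> [->|[k lt [->|->]]].
- move: uvw; rewrite /dot bw_linmx -!scalemxAl mxE [RHS]mxE; apply: mulfI.
  by rewrite oppr_eq0 two_neq0.
- by have := uv (k, true) lt; rewrite /dot basE /= bf_linmx.
- by have := uv (k, false) lt; rewrite /dot basE /= be_linmx.
Qed.


Lemma bas_neq0 x : (x.1 < n)%N -> bas x != 0.
Proof.
move=> xn; apply/eqP=> e; have /eqP := dot_bas p xn (xn : (opp x).1 < n)%N.
rewrite e -(scale0r 0) dotZl mul0r /= eqxx /= eq_sym.
by case: (x.2); rewrite oner_eq0.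
Qed.

(** ** Elements that act diagonally *)

Definition diagonal (M : GL) :=
  forall x, (x.1 < n)%N -> exists c : F, act (bas x) M = c *: bas x.
Definition dia (g : G) := diagonal (f g).

Lemma dia_neq0 (M : GL) x c : (x.1 < n)%N -> act (bas x) M = c *: bas x -> c != 0.
Proof.
move=> xn e; apply/eqP=> c0; have /eqP[] := bas_neq0 xn.
by rewrite -(actK M (bas x)) e c0 -(scale0r 0) !actE !scale0r.
Qed.

Lemma act_lineV (g : G) v c : c != 0 -> act v (f g) = c *: v -> act v (f g^-1%g) = c^-1 *: v.
Proof.
move=> c0 e; rewrite gmulfV; apply: (can_inj (actK (f g))).
by rewrite actE e scalerA mulVf // scale1r -{2}(invgK (f g)) actK.
Qed.

Lemma dia_sub : subgroup dia.
Proof.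
split=> [x xn|g h dg dh x xn|g dg x xn].
- by exists 1; rewrite gmulf1 act1 scale1r.
- have [c gx] := dg x xn; have [d hx] := dh x xn.
  by exists (c * d); rewrite gmulfM actM gx actE hx scalerA.
- have [c gx] := dg x xn; exists c^-1.
  by apply: act_lineV (gx); apply: dia_neq0 gx.
Qed.

Definition monomial (g : G) := forall x, (x.1 < n)%N ->
  exists2 x', (x'.1 < n)%N & act (bas x) (f g) = bas x' \/ act (bas x) (f g) = - bas x'.

Lemma monomialX g k : monomial g -> monomial (g ^+ k)%g.
Proof.
move=> mg; elim: k => [|k IH] x xn.
  by exists x => //; left; rewrite expg0 gmulf1 act1.
have [x' x'n e'] := IH x xn; have [x'' x''n e''] := mg x' x'n.
exists x'' => //; rewrite expgSr gmulfM actM.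
by case: e' e'' => -> [] e''; rewrite ?actE e'' ?opprK; [left|right|right|left].
Qed.

Lemma dia_conjV g h : monomial g -> dia h -> dia (h ^ g^-1)%g.
Proof.
move=> mg dh x xn; have [x' x'n e] := mg x xn; have [c hx] := dh x' x'n.
exists c; rewrite /conjg invgK !gmulfM !actM gmulfV.
case: e => e; rewrite e.
  by rewrite hx actZ -e actK.
by rewrite actN hx -scalerN actZ -e actK.
Qed.

Lemma monomial_r k : (k.+1 < n)%N -> monomial (r k).
Proof.
move=> kn [i s] /= ilt; rewrite fr //; case: eqP => [_|_]; first by exists (k.+1, s); [|left].
case: eqP => [_|_]; first by exists (k, s); [exact: ltnW|right].
by exists (i, s); [|left].
Qed.

Lemma monomial_q k : (k < n)%N -> monomial (q k).
Proof.
move=> kn; have [qA _ qE] := fq kn; case=> i s /= ilt.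
case: (eqVneq i k) => [->|ik]; first by exists (k, ~~ s); [|left].
by exists (i, s); [|left; exact: qE].
Qed.

Lemma dia_r k h : (k.+1 < n)%N -> dia h -> dia (h ^ r k)%g.
Proof.
move=> kn; rewrite -(invgK (r k)); apply: dia_conjV.
by have [m ->] := finite_orderV (swapV rd k); apply/monomialX/monomial_r.
Qed.

Lemma dia_w (M : GL) : isom M -> diagonal M -> exists c, act w M = c *: w.
Proof.
move=> ig dg; exists (dot w (act w M) / - 2).
apply: dot_ext => [x xn|]; last first.
  by rewrite dotZr dot_ww divfK // oppr_eq0 two_neq0.
rewrite dotZr dot_bas_w // mulr0.
have [c gx] := dg x xn; have c0 := dia_neq0 xn gx.
apply: (mulfI c0); rewrite -dotZl -gx ig dot_bas_w //; exact: esym (mulr0 c).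
Qed.

(** ** Diagonal elements act on short root elements as powers *)

Definition powers (h : G) := forall x, (x.1 < n)%N -> exists m, (t x ^ h = t x ^+ m)%g.

Lemma powers_S h x y : (x.1 < n)%N -> (y.1 < n)%N -> x.1 != y.1 -> powers h ->
  exists m, (S x y ^ h = S x y ^+ m)%g.
Proof.
move=> xn yn xy ph; have [i ei] := ph x xn; have [j ej] := ph y yn; exists (i * j)%N.
have S2 u : commute (S x y) u -> commute (S x y ^+ 2)%g u.
  by move=> c; apply: commute_sym; apply: commuteX; apply: commute_sym.
have cx : commute [~ t x, t y]%g (t x).
  by rewrite (rd_tt rd) //; apply/S2/(rd_St rd).
have cy : commute [~ t x, t y]%g (t y).
  rewrite (rd_tt rd) //; apply: S2; apply: eqi_commute (S_eqi rd _ _) (eqi_refl _) _.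
  by apply: (rd_St rd) => //; rewrite eq_sym.
by rewrite (rd_Sdef rd) conjXg conjRg ei ej commgXX // expgnAC.
Qed.

Let f_pow x m c : (x.1 < n)%N -> c = m%:R -> f (t x ^+ m)%g = eichler (bas x) (c *: w).
Proof. by move=> xn ->; rewrite gmulfXn ft // (eichlerX _ (adapted_w p xn)). Qed.

Let f_conj h x c d : (x.1 < n)%N -> isom (f h) -> act (bas x) (f h) = c *: bas x ->
  act w (f h) = d *: w -> f (t x ^ h)%g = eichler (bas x) ((c * d) *: w).
Proof.
move=> xn ih hx hw; have ax := adapted_w p xn.
rewrite gmulfJ ft // (eichlerJ ih ax) hx hw (eichlerZl p_prime p_odd c (adaptedZ d ax)).
by rewrite scalerA.
Qed.

Lemma adj_sub k : subgroup (adj k). Proof. exact: gen_subgroup. Qed.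

Lemma adj_Gn k g : (k.+1 < n)%N -> adj k g -> Gn k.+2 g.
Proof.
move=> kn; apply: gen_min; first exact: Gn_sub.
move=> _ [->|->]; last by apply: (Gn_r rd).
by apply: (Gn_S rd) => /=; lia.
Qed.

Lemma adj_commute_t k g x : (k.+1 < n)%N -> adj k g -> (x.1 < n)%N -> x.1 != k -> x.1 != k.+1 ->
  commute (t x) g.
Proof.
move=> kn ag xn xk xl; apply: commute_sym; move: ag.
apply: (gen_min (H := fun g => commute g (t x))) => [|_ [->|->]].
- split=> [|y z cy cz|y cy]; apply: commute_sym; first exact: commute1.
    by apply: commuteM; apply: commute_sym.
  by apply: commuteV; apply: commute_sym.
- by apply: (rd_St_disjoint rd) => //=; lia.
- apply: commute_sym; apply: commute_conj.
  by case: x xn xk xl => i s /= *; apply: (rd_fix rd).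
Qed.

Lemma adj_powers k h : (k.+1 < n)%N -> adj k h -> dia h -> powers h.
Proof.
move=> kn ah dh; have kn' : (k < n)%N by exact: ltnW.
have ih := Gn_isom kn (adj_Gn kn ah).
have hw : act w (f h) = 1 *: w.
  by have [a [b [c [d [_ _ _ _ _ -> _]]]]] := adj_action kn ah; rewrite scale1r.
have kl b : (k, b).1 != (k.+1, b).1 by rewrite /= ltn_eqF.
have lk b : (k.+1, b).1 != (k, b).1 by rewrite eq_sym kl.
move=> x xn; have [c hx] := dh x xn; have e := f_conj xn ih hx hw.
case: (eqVneq x.1 k) => [xk|xk].
  case: x xk xn hx e => i b /= -> xn hx e.
  have H := adj_norm_heis kn (b := b) ah.
  apply: (heis_pow (y := (k.+1, b)) _ _ _ _ e) => //.
  by apply: H; apply: mem_gen; exact: Or31.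
case: (eqVneq x.1 k.+1) => [xl|xl].
  case: x xk xl xn hx e => i b /= xk il xn hx e; rewrite il in xk xn hx e *.
  have H := adj_norm_heis kn (b := b) ah.
  apply: (heis_pow (y := (k, b)) _ _ _ _ e) => //.
  by apply: heis_sym; apply: H; apply: mem_gen; exact: Or32.
by exists 1%N; rewrite expg1; apply/conj_commute/(adj_commute_t kn).
Qed.


Lemma G1_conj_q j h : (0 < j)%N -> (j < n)%N -> Gn 1 h -> Gn 1 (h ^ q j)%g.
Proof.
move=> j0 jn; apply: (conj_gen (Gn_sub _ _)) => _ [[i s] /= i0 ->].
have -> : i = 0%N by lia.
by rewrite (rd_flip_other rd) //; [apply: (subV (Gn_sub _ _)); apply: Gn_t|lia].
Qed.

Lemma G1_powers h : Gn 1 h -> dia h -> powers h.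
Proof.
move=> Gh dh; have ih := Gn_isom n_gt0 Gh; have [d hw] := dia_w ih dh.
have tpos g j c e : (0 < j)%N -> (j < n)%N -> Gn 1 g -> isom (f g) ->
    act (bas (j, true)) (f g) = c *: bas (j, true) -> act w (f g) = e *: w ->
    exists m, (t (j, true) ^ g = t (j, true) ^+ m)%g.
  move=> j0 jn Gg ig gx gw; have ej := @f_conj g (j, true) c e jn ig gx gw.
  have [m em] := nat_of_F (c * e); exists m; apply: mulgV1_eq.
  have sQ := Q_sub t S j.
  have Qt := Gn_norm_Q p_gt0 rd jn (Gn_mono j0 Gg) (Q_t t S j).
  apply: (Q_inj jn).
    by apply: (subM sQ) => //; apply: (subV sQ); apply: (subX _ sQ); exact: Q_t.
  have -> : f (t (j, true) ^ g * (t (j, true) ^+ m)^-1)%g = 1%g.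
    by rewrite gmulfM gmulfV ej (@f_pow (j, true) m _ jn em) mulgV.
  exact: act1.
move=> x xn; have [c hx] := dh x xn.
case: (posnP x.1) => [x0|x0].
  have e := f_conj xn ih hx hw; have [m em] := nat_of_F (c * d).
  exists m; apply: mulgV1_eq; have sG := Gn_sub t 1.
  have tG : Gn 1 (t x) by apply: Gn_t; rewrite x0.
  apply: ker_G1.
    apply: (subM sG); first exact: subJ.
    by apply: (subV sG); apply: (subX _ sG).
  by rewrite gmulfM gmulfV e (f_pow xn em) mulgV.
case: x x0 xn hx => j [] /= j0 jn hx; first exact: (tpos h j c d j0 jn Gh ih hx hw).
set g := (h ^ q j)%g; have Gg : Gn 1 g by apply: G1_conj_q.
have qV : ((q j)^-1 = q j)%g by apply: (@mulgI _ (q j)); rewrite mulgV (rd_qq rd).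
have dg : dia g.
  by rewrite /g -qV; apply: dia_conjV dh; apply: monomial_q.
have ig := Gn_isom n_gt0 Gg; have [e gw] := dia_w ig dg.
have [c' gx] := dg (j, true) jn; have [m em] := tpos g j c' e j0 jn Gg ig gx gw.
exists m; apply: (@conjg_inj _ (q j)).
by rewrite conjJg conjXg (rd_flip rd) conjVg -/g em expVgn.
Qed.
Definition mulset (A B : G -> Prop) g := exists a b, [/\ A a, B b & g = (a * b)%g].

Lemma mulset_sub A B : subgroup A -> subgroup B -> (forall b, B b -> normalises A b) ->
  subgroup (mulset A B).
Proof.
move=> sA sB nA; split.
- by exists 1%g, 1%g; rewrite mulg1; split=> //; [exact: sub1 sA|exact: sub1 sB].
- move=> _ _ [a [b [Aa Bb ->]]] [c [d [Ac Bd ->]]].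
  exists (a * c ^ b^-1)%g, (b * d)%g; split.
  + by apply: (subM sA) => //; apply: nA => //; apply: (subV sB).
  + exact: subM.
  + by rewrite conjgE invgK !mulgA mulgVK.
- move=> _ [a [b [Aa Bb ->]]]; exists (a^-1 ^ b)%g, b^-1%g; split.
  + by apply: nA => //; apply: (subV sA).
  + exact: (subV sB).
  + by rewrite invgM conjgE !mulgA mulgK.
Qed.

Lemma mulset_l A B g : subgroup B -> A g -> mulset A B g.
Proof. by move=> sB Ag; exists g, 1%g; rewrite mulg1; split=> //; exact: sub1 sB. Qed.
Lemma mulset_r A B g : subgroup A -> B g -> mulset A B g.
Proof. by move=> sA Bg; exists 1%g, g; rewrite mul1g; split=> //; exact: sub1 sA. Qed.

(** ** The stabiliser of an isotropic line *)

Definition torus l h := (if l is k.+1 then adj k h else Gn 1 h) /\ dia h.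

Lemma torus_sub l : subgroup (torus l).
Proof.
have sD := dia_sub; have sA : subgroup (fun h => if l is k.+1 then adj k h else Gn 1 h).
  by case: l => [|k]; apply: gen_subgroup.
split=> [|x y [Ax Dx] [Ay Dy]|x [Ax Dx]]; split.
- exact: (sub1 sA).
- exact: (sub1 sD).
- exact: (subM sA).
- exact: (subM sD).
- exact: (subV sA).
- exact: (subV sD).
Qed.

Lemma torus_powers l h : (l < n)%N -> torus l h -> powers h.
Proof.
case: l => [|k] ln [Ah Dh].
  exact: (G1_powers Ah Dh).
exact: (adj_powers ln Ah Dh).
Qed.

Lemma torus_Gn l h : (l < n)%N -> torus l h -> Gn l.+1 h.
Proof. by case: l => [|k] ln [Ah _]; [exact: Ah|exact: (adj_Gn ln Ah)]. Qed.

Lemma torus_norm_Gn l h : (l < n)%N -> torus l h -> normalises (Gn l) h.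
Proof.
move=> ln th; apply: normalises_one => _ [x xl ->].
have xn : (x.1 < n)%N by exact: ltn_trans ln.
have [m ->] := torus_powers ln th xn.
by apply: (subX _ (Gn_sub _ _)); apply: Gn_t.
Qed.

Lemma torus_norm_Q l h : (l < n)%N -> torus l h -> normalises (Q l) h.
Proof.
move=> ln th; have ph := torus_powers ln th; have sQ := Q_sub t S l.
apply: normalises_one => _ [->|[c cl ->]].
  by have [m ->] := ph (l, true) ln; apply: (subX _ sQ); apply: Q_t.
have cn : (c.1 < n)%N by exact: ltn_trans ln.
have lc : (l, true).1 != c.1 by rewrite /= gtn_eqF.
have [m ->] := powers_S (ln : (l, true).1 < n)%N cn lc ph.
by apply: (subX _ sQ); apply: Q_S.
Qed.

Definition P l := mulset (mulset (Q l) (Gn l)) (torus l).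

Let QG_sub l : (l < n)%N -> subgroup (mulset (Q l) (Gn l)).
Proof.
move=> ln; apply: mulset_sub; [exact: Q_sub|exact: Gn_sub|].
by move=> g; apply: (Gn_norm_Q p_gt0 rd).
Qed.

Lemma P_sub l : (l < n)%N -> subgroup (P l).
Proof.
move=> ln; apply: mulset_sub; [exact: QG_sub|exact: torus_sub|].
move=> h th _ [a [b [Qa Gb ->]]]; exists (a ^ h)%g, (b ^ h)%g; split.
- exact: torus_norm_Q.
- exact: torus_norm_Gn.
- exact: conjMg.
Qed.

Lemma P_Q l g : (l < n)%N -> Q l g -> P l g.
Proof. by move=> ln Qg; apply/mulset_l/mulset_l => //; [exact: torus_sub|exact: Gn_sub]. Qed.
Lemma P_G l g : (l < n)%N -> Gn l g -> P l g.
Proof.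
by move=> ln Qg; apply: mulset_l; [exact: torus_sub|apply: mulset_r; first exact: Q_sub].
Qed.
Lemma P_torus l g : (l < n)%N -> torus l g -> P l g.
Proof. by move=> ln Tg; apply: mulset_r; first exact: QG_sub. Qed.

Lemma Q_Gn l g : (l < n)%N -> Q l g -> Gn l.+1 g.
Proof.
move=> ln; apply: gen_min; first exact: Gn_sub.
move=> _ [->|[c cl ->]]; first exact: Gn_t.
by apply: (Gn_S rd) => /=; lia.
Qed.

Lemma P_Gn l g : (l < n)%N -> P l g -> Gn l.+1 g.
Proof.
move=> ln [_ [h [[a [b [Qa Gb ->]]] th ->]]]; have sG := Gn_sub t l.+1.
by apply: (subM sG); [apply: (subM sG); [exact: Q_Gn|exact: Gn_mono Gb]|exact: torus_Gn].
Qed.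

Lemma Q_fix l g : (l < n)%N -> Q l g -> act (bas (l, true)) (f g) = bas (l, true).
Proof.
move=> ln /(Q_form ln)[u [xx ux] ->]; apply: act_eichler_fix => //.
by rewrite dotC.
Qed.

Lemma P_line l g : (l < n)%N -> P l g ->
  exists c, act (bas (l, true)) (f g) = c *: bas (l, true).
Proof.
move=> ln [_ [h [[a [b [Qa Gb ->]]] [_ dh] ->]]]; have [c hx] := dh (l, true) ln.
by exists c; rewrite !gmulfM !actM (Q_fix ln Qa) (Gn_fix true (leqnn l) ln Gb).
Qed.

(** ** Double cosets *)

Definition dcos l s g := exists a b, [/\ P l a, P l b & g = (a * s * b)%g].
Definition D l g := [\/ P l g, dcos l (q l) g | exists2 k, l = k.+1 & dcos l (r k) g].

Lemma D_left l a g : (l < n)%N -> P l a -> D l g -> D l (a * g)%g.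
Proof.
move=> ln Pa; have sP := P_sub ln; case=> [Pg|[c [d [Pc Pd ->]]]|[k lk [c [d [Pc Pd ->]]]]].
- by constructor 1; apply: (subM sP).
- by constructor 2; exists (a * c)%g, d; rewrite !mulgA; split=> //; apply: (subM sP).
- by constructor 3; exists k => //; exists (a * c)%g, d; rewrite !mulgA; split=> //; apply: (subM sP).
Qed.

Lemma D_right l a g : (l < n)%N -> P l a -> D l g -> D l (g * a)%g.
Proof.
move=> ln Pa; have sP := P_sub ln; case=> [Pg|[c [d [Pc Pd ->]]]|[k lk [c [d [Pc Pd ->]]]]].
- by constructor 1; apply: (subM sP).
- by constructor 2; exists c, (d * a)%g; rewrite !mulgA; split=> //; apply: (subM sP).
- by constructor 3; exists k => //; exists c, (d * a)%g; rewrite !mulgA; split=> //; apply: (subM sP).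
Qed.

(** The radical moves an isotropic vector to the line of el, if it can. *)
Lemma Q_full l u : (l < n)%N -> (forall a, (l <= a.1)%N -> (a.1 < n)%N -> dot u (bas a) = 0) ->
  exists2 g, Q l g & f g = eichler (bas (l, true)) u.
Proof.
move=> ln u0; pose c0 : F := dot u w / - 2.
pose k (c : idx) := if c.1 == l then val c0 else val (dot u (bas (opp c)) : F).
have kE c : (k c)%:R = if c.1 == l then c0 else dot u (bas (opp c)).
  by rewrite /k; case: ifP; rewrite natr_Zp.
exists (rad_prod l k).
  have sQ := Q_sub t S l; rewrite /rad_prod big_seq.
  apply: big_ind => [||c cI]; [exact: sub1 sQ|exact: subM sQ|].
  by apply: (subX _ sQ); apply: mem_gen; apply: rad_elt_gen.
have [_ ->] := f_rad_prod k ln; congr eichler.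
rewrite -/(rad_sum l k); apply: dot_ext => [a an|]; rewrite ![dot _ (rad_sum _ _)]dotC ![dot _ u]dotC.
  have [al|la] := ltnP a.1 l; last first.
    rewrite u0 // dot_sum big1_seq // => c /andP[_]; rewrite mem_rad_idx /rad_vec dotZl.
    case/predU1P=> [->|cl]; first by rewrite eqxx dot_w_bas // mulr0.
    have cn : (c.1 < n)%N by exact: ltn_trans ln.
    by rewrite (ltn_eqF cl) dot_bas // (ltn_eqF (leq_trans cl la)) mulr0.
  have aI : opp a \in rad_idx l by rewrite mem_rad_idx /= al orbT.
  have := rad_sum_dot k ln aI; rewrite oppK /rad_vec kE /= (ltn_eqF al) oppK mulr1.
  exact.
have lI : (l, true) \in rad_idx l by rewrite mem_rad_idx eqxx.
have := rad_sum_dot k ln lI; rewrite /rad_vec kE /= eqxx divfK //.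
by rewrite oppr_eq0 two_neq0.
Qed.

Lemma isotropic_radical l v : (l < n)%N -> dot v v = 0 ->
  (forall a, (l < a.1)%N -> (a.1 < n)%N -> dot v (bas a) = 0) -> dot v (bas (l, true)) != 0 ->
  exists2 g, Q l g & act v (f g) = dot v (bas (l, true)) *: bas (l, false).
Proof.
move=> ln vv v0; set e := bas (l, false); set fl := bas (l, true).
have ef : dot e fl = 1 by rewrite dot_basE // eqxx.
have fe : dot fl e = 1 by rewrite dotC.
have ee : dot e e = 0 by rewrite dot_basE // eqxx.
have ff : dot fl fl = 0 by rewrite dot_basE // eqxx.
set b := dot v fl => b0; set y := v - b *: e - dot v e *: fl.
have [g Qg fg] : exists2 g, Q l g & f g = eichler fl (- b^-1 *: y).
  apply: Q_full => // [[j s] /= lj jn]; rewrite /y !dotB.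
  have [ljE|jl] := eqVneq l j; last first.
    rewrite v0 //=; last by rewrite ltn_neqAle jl.
    by rewrite !dot_basE // (negPf jl) !mulr0 !oppr0 !addr0 mulr0.
  rewrite -ljE; case: s jn => _; rewrite -/e -/fl ?ef ?ff ?ee ?fe -/b ?mulr0 ?mulr1.
    by rewrite oppr0 addr0 subrr mulr0.
  by rewrite oppr0 addr0 subrr mulr0.
have [u af fg'] := Q_form ln Qg; exists g => //.
have yf : dot y fl = 0 by rewrite /y !dotB ef ff -/b mulr1 mulr0 oppr0 addr0 subrr.
have ad : adapted fl (- b^-1 *: y) by split; rewrite // dotZl yf mulr0.
pose c := dot v (- b^-1 *: y) + qf (- b^-1 *: y) * b - dot v e.
have act_v : act v (f g) = b *: e - c *: fl.
  rewrite fg (act_eichler _ ad) -/b scalerA mulrN mulfV // scaleN1r /c /y.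
  by apply/rowP=> i; rewrite !mxE; ring.
have ig : isom (f g) by rewrite fg; apply: isom_eichler.
have : dot (act v (f g)) (act v (f g)) = 0 by rewrite ig.
rewrite act_v !dotB ef fe ee ff => cb.
have c0 : c = 0.
  apply: (mulfI (mulf_neq0 two_neq0 b0)); rewrite mulr0 -[RHS]oppr0 -cb; ring.
by rewrite c0 scale0r subr0.
Qed.

(** ** Rank one *)

Local Notation e0 := (bas (0%N, false)).
Local Notation f0 := (bas (0%N, true)).

(** An isometry of the space spanned by e0, f0 and w becomes diagonal when it is
    multiplied by an element of the first or the second Bruhat cell. *)
Lemma isom_rank1 (M : GL) : isom M -> (forall a, (0 < a.1)%N -> (a.1 < n)%N -> act (bas a) M = bas a) ->
  exists a b, [/\ Q 0 a, Q 0 b & diagonal (M * f b)%g \/ diagonal (M * f (a * q 0%N * b)%g)%g].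
Proof.
have sQ := Q_sub t S 0.
have qfix g : Q 0 g -> forall a, (0 < a.1)%N -> (a.1 < n)%N -> act (bas a) (f g) = bas a.
  by move=> Qg [j s] j0 jn; apply: (Gn_fix s j0 jn (Q_Gn n_gt0 Qg)).
have orth (N : GL) v : isom N -> (forall a, (0 < a.1)%N -> (a.1 < n)%N -> act (bas a) N = bas a) ->
    (forall a, (0 < a.1)%N -> (a.1 < n)%N -> dot v (bas a) = 0) ->
    forall a, (0 < a.1)%N -> (a.1 < n)%N -> dot (act v N) (bas a) = 0.
  by move=> iN fN v0 a a0 an; rewrite -{1}(fN a a0 an) iN v0.
have iso s : dot (bas (0%N, s)) (bas (0%N, s)) = 0 by rewrite dot_basE // !eqxx.
have b0 s a : (0 < a.1)%N -> (a.1 < n)%N -> dot (bas (0%N, s)) (bas a) = 0.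
  by case: a => j s' /= j0 jn; rewrite dot_basE // (ltn_eqF j0).
have d1 : dot e0 f0 = 1 by rewrite dot_basE // eqxx.
have d2 : dot f0 e0 = 1 by rewrite dotC.
(* f0 spans an invariant line: adjust the image of e0 *)
have stab (N : GL) c : isom N -> (forall a, (0 < a.1)%N -> (a.1 < n)%N -> act (bas a) N = bas a) ->
    act f0 N = c *: f0 -> exists2 b, Q 0 b & diagonal (N * f b)%g.
  move=> iN fN hf; have c0 : c != 0 by apply: (dia_neq0 (x := (0%N, true))) hf.
  have nz : dot (act e0 N) f0 != 0.
    apply/eqP=> z; have := iN e0 f0; rewrite hf dotZr z mulr0 d1 => /esym/eqP.
    by rewrite oner_eq0.
  have vv : dot (act e0 N) (act e0 N) = 0 by rewrite iN.
  have [b Qb eb] := isotropic_radical n_gt0 vv (orth N e0 iN fN (b0 false)) nz.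
  exists b => // [[j s]] jn; have [j0|j0] := posnP j; last first.
    by exists 1; rewrite scale1r actM fN // qfix.
  case: s jn; rewrite j0 => _; last by exists (dot (act e0 N) f0); rewrite actM eb.
  by exists c; rewrite actM hf actZ (Q_fix n_gt0 Qb).
move=> iM fM; set v := act f0 M.
have vv : dot v v = 0 by rewrite iM.
have v0 : forall a, (0 < a.1)%N -> (a.1 < n)%N -> dot v (bas a) = 0 := orth M f0 iM fM (b0 true).
have [z|nz] := eqVneq (dot v f0) 0.
  suff ve : act f0 M = dot v e0 *: f0.
    by have [b Qb Db] := stab M _ iM fM ve; exists 1%g, b; split; [exact: (sub1 sQ)| |left].
  have d3 : dot f0 f0 = 0 by apply: iso.
  set u := v - dot v e0 *: f0.
  have u0 a : (a.1 < n)%N -> dot (bas a) u = 0.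
    case: a => j s jn; rewrite dotC /u !dotB; have [j0|j0] := posnP j.
      by rewrite j0; case: s jn => _; rewrite ?z ?d2 ?d3 ?mulr0 ?mulr1 ?subrr ?subr0.
    by rewrite v0 // b0 // mulr0 subr0.
  have uw : u = (dot w u / - 2) *: w.
    apply: dot_ext => [a an|]; rewrite dotZr; first by rewrite u0 // dot_bas_w // mulr0.
    by rewrite dot_ww divfK // oppr_eq0 two_neq0.
  have uu : dot u u = 0.
    have dfv : dot f0 v = 0 by rewrite dotC.
    by rewrite /u !dotB vv z dfv d3 !(mulr0, oppr0, addr0).
  have wu : dot w u = 0.
    move: uu; rewrite {1}uw dotZl => /eqP; rewrite mulf_eq0 => /orP[|/eqP //].
    by rewrite mulf_eq0 invr_eq0 oppr_eq0 (negPf two_neq0) orbF => /eqP.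
  rewrite wu mul0r scale0r in uw.
  by apply/eqP; rewrite -subr_eq0; apply/eqP.
have [a Qa ea] := isotropic_radical n_gt0 vv v0 nz.
have [qE _ qF] := fq n_gt0; have Ga := Q_Gn n_gt0 Qa.
have Gq : Gn 1 (q 0) by apply: (Gn_q rd).
have Gaq : Gn 1 (a * q 0%N)%g by apply: (subM (Gn_sub t 1)).
have [|c c0 hf||b Qb Db] := @stab (M * f (a * q 0%N)%g)%g (dot v f0).
- by apply: isomM => //; apply: (Gn_isom n_gt0 Gaq).
- rewrite actM fM //; case: c c0 hf => j s j0 jn.
  by apply: (Gn_fix s j0 jn Gaq).
- by rewrite gmulfM !actM -/v ea actZ qE.
exists a, b; split=> //; right.
have -> : f (a * q 0%N * b)%g = (f (a * q 0%N) * f b)%g by rewrite gmulfM.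
by rewrite mulgA.
Qed.

Lemma D_rank1 g : Gn 1 g -> D 0 g.
Proof.
move=> Gg; have sG := Gn_sub t 1; have sP := P_sub n_gt0.
have ig := Gn_isom n_gt0 Gg; have Gq : Gn 1 (q 0) by apply: (Gn_q rd).
have fix_g a : (0 < a.1)%N -> (a.1 < n)%N -> act (bas a) (f g) = bas a.
  by case: a => j s j0 jn; apply: (Gn_fix s j0 jn Gg).
have [a [b [Qa Qb Dab]]] := isom_rank1 ig fix_g.
have Pa := P_Q n_gt0 Qa; have Pb := P_Q n_gt0 Qb.
have Ga := Q_Gn n_gt0 Qa; have Gb := Q_Gn n_gt0 Qb.
case: Dab => Dh.
  constructor 1; have -> : g = (g * b * b^-1)%g by rewrite mulgK.
  apply: (subM sP); last exact: (subV sP).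
  apply: P_torus => //; split; first exact: (subM sG).
  by rewrite /dia gmulfM.
constructor 2; exists (g * (a * q 0%N * b) * b^-1)%g, a^-1%g; split.
- apply: (subM sP); last exact: (subV sP).
  apply: P_torus => //; split; last by rewrite /dia gmulfM.
  by apply: (subM sG) => //; apply: (subM sG) => //; apply: (subM sG).
- exact: (subV sP).
by rewrite !mulgA mulgK -(mulgA _ (q 0) (q 0)) (rd_qq rd) mulg1 mulgK.
Qed.
(** ** From one rank to the next *)

Section Step.
Variable k : nat.
Hypothesis ln : (k.+1 < n)%N.
Hypothesis dec : forall g, Gn k.+1 g -> D k g.
Local Notation l := k.+1.
Local Notation s := (r k).
Local Notation fk := (bas (k, true)).
Local Notation fl := (bas (k.+1, true)).
Local Notation ek := (bas (k, false)).
Local Notation el := (bas (k.+1, false)).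
Local Notation X := (S (k, true) (k.+1, false)).
Local Notation Y := (S (k.+1, true) (k, false)).

Let kn : (k < n)%N. Proof. exact: ltnW. Qed.
Let sP : subgroup (P l). Proof. exact: P_sub. Qed.
Let sA : subgroup (adj k). Proof. exact: gen_subgroup. Qed.
Let sG : subgroup (Gn l). Proof. exact: Gn_sub. Qed.
Let sQ : subgroup (Q l). Proof. exact: Q_sub. Qed.
Let nkl : (k == k.+1) = false. Proof. exact: ltn_eqF. Qed.
Let nlk : (k.+1 == k) = false. Proof. exact: gtn_eqF. Qed.

Let adj_s : adj k s. Proof. by apply: mem_gen; right. Qed.
Let adj_X : adj k X. Proof. by apply: mem_gen; left. Qed.
Let adj_Y : adj k Y.
Proof.
rewrite (rd_Ssym rd) (rd_adj_opp rd) //; apply: (subV sA).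
exact: (subJ sA adj_X adj_s).
Qed.

Let Sk (x y x' y' : idx) g : (x.1 < n)%N -> (y.1 < n)%N -> x.1 != y.1 ->
  (t x ^ g = t x' \/ t x ^ g = (t x')^-1)%g ->
  (t y ^ g = t y' \/ t y ^ g = (t y')^-1)%g -> eqi (S x y ^ g)%g (S x' y').
Proof. by move=> xn yn xy ex ey; apply: (rd_Sconj rd). Qed.

Let adj_stab g : adj k g -> dot (act fl (f g)) ek = 0 ->
  dot (act fk (f g)) el = 0 -> torus l g.
Proof.
move=> ag; have [a [b [c [d [det hfk hfl hek hel hw hfix]]]]] := adj_action ln ag.
have d1 : dot fk ek = 1 by rewrite dot_basE // eqxx.
have d2 : dot fl el = 1 by rewrite dot_basE // eqxx.
have d3 : dot fl ek = 0 by rewrite dot_basE // nlk.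
have d4 : dot fk el = 0 by rewrite dot_basE // nkl.
rewrite hfl hfk !dotB d1 d2 d3 d4 !mulr0 !mulr1 add0r addr0 => c0 b0.
move: hfk hfl hek hel; rewrite b0 c0 !scale0r !addr0 !add0r !subr0 => hfk hfl hek hel.
split=> // [[i b']] ilt; case: (eqVneq i k) => [->|ik].
  by case: b' {ilt}; [exists a|exists d].
case: (eqVneq i k.+1) => [->|il]; first by case: b' {ilt}; [exists d|exists a].
by exists 1; rewrite scale1r; apply: hfix.
Qed.

Let fY m : [/\ adj k (Y ^+ m)%g, Q l (Y ^+ m)%g,
  act fl (f (Y ^+ m)%g) = fl & act fk (f (Y ^+ m)%g) = fk - m%:R *: fl].
Proof.
have QY : Q l (Y ^+ m)%g by apply: (subX _ sQ); apply: Q_S.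
have d1 : dot fk ek = 1 by rewrite dot_basE // eqxx.
have d4 : dot fk fl = 0 by rewrite dot_basE // nkl.
have lk : (k.+1, true).1 != (k, false).1 by rewrite /= nlk.
have ad := adapted_bas p (ln : (k.+1, true).1 < n)%N (kn : (k, false).1 < n)%N lk.
split=> //; [exact: (subX _ sA adj_Y)|exact: (Q_fix ln QY)|].
rewrite gmulfXn (fS (ln : (k.+1, true).1 < n)%N (kn : (k, false).1 < n)%N lk).
rewrite (eichlerX _ ad) (act_eichler _ (adaptedZ _ ad)) d4 dotZr d1.
by rewrite scale0r mulr0 scale0r addr0 subr0 mulr1.
Qed.

Let fX m : adj k (X ^+ m)%g /\ act fl (f (X ^+ m)%g) = fl - m%:R *: fk.
Proof.
have d1 : dot fl el = 1 by rewrite dot_basE // eqxx.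
have d4 : dot fl fk = 0 by rewrite dot_basE // nlk.
have kl : (k, true).1 != (k.+1, false).1 by rewrite /= nkl.
have ad := adapted_bas p (kn : (k, true).1 < n)%N (ln : (k.+1, false).1 < n)%N kl.
split=> //; first exact: (subX _ sA adj_X).
rewrite gmulfXn (fS (kn : (k, true).1 < n)%N (ln : (k.+1, false).1 < n)%N kl).
rewrite (eichlerX _ ad) (act_eichler _ (adaptedZ _ ad)) d4 dotZr d1.
by rewrite scale0r mulr0 scale0r addr0 subr0 mulr1.
Qed.

Let P_Y m : P l (Y ^+ m)%g. Proof. by have [_ QY _ _] := fY m; apply: P_Q. Qed.

(* an element of SL(2, p) that fixes a line is diagonal up to a transvection *)
Let adj_P g : adj k g -> dot (act fl (f g)) ek = 0 -> P l g.
Proof.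
move=> ag g0; have [a [b [c [d [det hfk hfl _ _ _ _]]]]] := adj_action ln ag.
have d1 : dot fk ek = 1 by rewrite dot_basE // eqxx.
have d2 : dot fl el = 1 by rewrite dot_basE // eqxx.
have d3 : dot fl ek = 0 by rewrite dot_basE // nlk.
have d4 : dot fk el = 0 by rewrite dot_basE // nkl.
have c0 : c = 0 by move: g0; rewrite hfl !dotB d1 d3 mulr0 mulr1 addr0.
have a0 : a != 0.
  by apply/eqP=> a0; move: det; rewrite a0 c0 mul0r mulr0 subrr => /esym/eqP; rewrite oner_eq0.
have [m em] := nat_of_F (b / a); have [aY _ Yl Yk] := fY m.
have tg : torus l (g * Y ^+ m)%g.
  apply: adj_stab; first exact: (subM sA ag aY).
    by rewrite gmulfM actM hfl c0 scale0r add0r actZ Yl dotZl d3 mulr0.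
  rewrite gmulfM actM hfk actE !actZ Yk Yl -em !dotB d2 d4; field; exact: a0.
have -> : g = (g * Y ^+ m * (Y ^+ m)^-1)%g by rewrite mulgK.
by apply: (subM sP); [exact: P_torus|apply: (subV sP); apply: P_Y].
Qed.

Let ss_P : P l (s * s)%g.
Proof.
apply: adj_P; first exact: (subM sA).
rewrite gmulfM actM !fr // ?eqxx ?nlk actE fr // eqxx dotNl.
by rewrite dot_basE // nlk oppr0.
Qed.

Let dcos_s g : dcos l s g -> D l g. Proof. by constructor 3; exists k. Qed.
Let D_P g : P l g -> D l g. Proof. by constructor 1. Qed.

Let adj_D g : adj k g -> D l g.
Proof.
move=> ag; have [a [b [c [d [det hfk hfl _ _ _ _]]]]] := adj_action ln ag.
have d1 : dot fk ek = 1 by rewrite dot_basE // eqxx.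
have d3 : dot fl ek = 0 by rewrite dot_basE // nlk.
case: (eqVneq c 0) => [c0|c0].
  by apply/D_P/adj_P => //; rewrite hfl c0 !dotB d3 mul0r mulr0 addr0.
have [m em] := nat_of_F (d / c); have [aY _ Yl Yk] := fY m.
have Pg : P l (g * Y ^+ m * s)%g.
  apply: adj_P; first by apply: (subM sA) => //; apply: (subM sA).
  rewrite 2!gmulfM !actM hfl actE !actZ Yk Yl -em !actE !fr // ?eqxx ?nlk.
  have d5 : dot (bas (k, true)) ek = 1 by [].
  rewrite !dotB d1 d3; field; exact: c0.
apply: dcos_s; exists (g * Y ^+ m * s * (s * s)^-1)%g, (Y ^+ m)^-1%g; split.
- by apply: (subM sP) => //; apply: (subV sP).
- by apply: (subV sP); apply: P_Y.
- by rewrite invgM !mulgA mulgK mulgVK mulgK.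
Qed.

Let sPs g : P l (g ^ s)%g -> P l (s * g * s^-1)%g.
Proof.
move=> Pg; have -> : (s * g * s^-1 = s * s * (g ^ s) * (s * s)^-1)%g.
  by rewrite conjgE invgM !mulgA mulgK mulgK.
by apply: (subM sP); [apply: (subM sP)|apply: (subV sP)].
Qed.

(* the parabolic subgroup of smaller rank stays parabolic *)
Let conj_P g : P k g -> P l (g ^ s)%g.
Proof.
case=> [_ [h [[a [b [Qa Gb ->]]] th ->]]]; rewrite 2!conjMg.
apply: (subM sP); first apply: (subM sP).
- apply: (conj_gen sP _ Qa) => _ [->|[c cl ->]].
    by rewrite (rd_up rd); apply: P_Q => //; apply: Q_t.
  apply: (sub_eqi sP (y := S (l, true) c)); last by apply: P_Q => //; apply: Q_S; lia.
  have cn : (c.1 < n)%N by lia.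
  apply: Sk => //; first by rewrite /= gtn_eqF.
    by left; exact: (rd_up rd).
  by left; case: c cl cn => i b' /= *; apply: (rd_fix rd) => //; lia.
- apply: (conj_gen sP _ Gb) => _ [[i b'] /= ik ->].
  rewrite (rd_fix rd) //; [|lia..].
  by apply: P_G => //; apply: Gn_t => /=; lia.
- have -> : (h ^ s = h * [~ h, s])%g by rewrite commgEl mulKVg.
  apply: (subM sP); first by apply: P_G => //; apply: (torus_Gn kn th).
  apply: P_torus => //; have ph := torus_powers kn th; split; last first.
    rewrite commgEl; case: th => _ dh; apply: (subM (dia_sub)); last exact: dia_r.
    exact: (subV dia_sub).
  rewrite commgEr; apply: (subM sA) => //.
  have sh : adj k (s ^ h)%g.
    have kl : (k, true).1 != (k.+1, false).1 by rewrite /= nkl.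
    have kl' : (k, false).1 != (k.+1, true).1 by rewrite /= nkl.
    have [m em] := powers_S (kn : (k, true).1 < n)%N (ln : (k.+1, false).1 < n)%N kl ph.
    have [m' em'] := powers_S (kn : (k, false).1 < n)%N (ln : (k.+1, true).1 < n)%N kl' ph.
    rewrite (rd_r_word rd) // 2!conjMg em em'; have aX : adj k (X ^+ m)%g by apply: (subX _ sA).
    apply: (subM sA) => //; apply: (subM sA) => //; apply: (subX _ sA).
    by rewrite (rd_adj_opp rd) //; apply: (subJ sA).
  by rewrite conjVg; apply: (subV sA).
Qed.

Let conjV_P g : P k g -> P l (s * g * s^-1)%g.
Proof. by move=> /conj_P /sPs. Qed.

Let PkG g : P k g -> Gn l g. Proof. exact: P_Gn. Qed.

(* the complement to Y in the radical is parabolic after conjugation *)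
Let Q_split g : Q l g -> exists c u, [/\ Q l u, P l (u ^ s)%g & g = (Y ^+ c * u)%g].
Proof.
apply: (gen_right (H := fun g => exists c u, [/\ Q l u, P l (u ^ s)%g & g = (Y ^+ c * u)%g])).
- by move=> y; exact: (radgen_fin p_gt0 rd ln).
- by exists 0%N, 1%g; rewrite mulg1 conj1g; split=> //; [exact: (sub1 sQ)|exact: (sub1 sP)].
move=> _ y [c [u [Qu Pu ->]]] Sy; have Qy : Q l y by apply: mem_gen.
have add : P l (y ^ s)%g ->
    exists c' u', [/\ Q l u', P l (u' ^ s)%g & (Y ^+ c * u * y = Y ^+ c' * u')%g].
  move=> Py; exists c, (u * y)%g; split; [exact: (subM sQ Qu Qy)| |by rewrite mulgA].
  by rewrite conjMg; exact: (subM sP Pu Py).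
case: Sy add {Qy} => [->|[[i b] /= il ->]] add.
  by apply: add; rewrite (rd_down rd); apply/(subV sP)/P_G => //; apply: Gn_t.
have [ik|ik] := eqVneq i k.
  case: b add; rewrite ik => add.
    apply: add; apply: (sub_eqi sP (y := S (k, true) (l, true))).
      by apply: Sk; rewrite //= ?nlk //; [right; exact: (rd_down rd)|left; exact: (rd_up rd)].
    by apply: (sub_eqi sP (S_eqi rd _ _)); apply: P_Q => //; apply: Q_S.
  exists c.+1, u; split=> //; rewrite expgSr -!mulgA; congr (_ * _)%g.
  by apply: (Q_commute rd ln Qu); apply: Q_S.
have ilt : (i < n)%N by lia.
apply: add; apply: (sub_eqi sP (y := S (k, true) (i, b))); last first.
  by apply: P_G => //; apply: (Gn_S rd) => /=; lia.
apply: Sk => //=; first by rewrite gtn_eqF.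
  by right; exact: (rd_down rd).
by left; apply: (rd_fix rd) => //; lia.
Qed.

Let Gq g : Gn l g -> Gn l (g ^ q l)%g.
Proof.
apply: (conj_gen sG) => _ [[i b] /= il ->].
rewrite (rd_flip_other rd) //; [|lia..].
by apply: (subV sG); apply: Gn_t.
Qed.

Let qV i : ((q i)^-1 = q i)%g.
Proof. by apply: (@mulgI _ (q i)); rewrite mulgV (rd_qq rd). Qed.

Let D_mid (u : G) : (forall c, D l (s * u * Y ^+ c * s)%g) -> forall a b c, P k a -> P k b ->
  D l (s * (a * u * b) * Y ^+ c * s)%g.
Proof.
move=> Du a b c Pa Pb; have Gb := PkG Pb.
have QY : Q l (Y ^+ c)%g by apply: (subX _ sQ); apply: Q_S.
have [d [v [Qv Pv e]]] : exists d v, [/\ Q l v, P l (v ^ s)%g &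
    (Y ^+ c) ^ b^-1 = Y ^+ d * v]%g.
  by apply: Q_split; apply: (Gn_norm_Q p_gt0 rd ln) => //; apply: (subV sG).
have -> : (s * (a * u * b) * Y ^+ c * s =
    s * a * s^-1 * (s * u * Y ^+ d * s) * (v ^ s * b ^ s))%g.
  have {}e : (b * Y ^+ c = Y ^+ d * v * b)%g by rewrite -e conjgE invgK !mulgA mulgVK.
  have -> : (v ^ s * b ^ s = s^-1 * (v * b) * s)%g by rewrite -conjMg conjgE mulgA.
  by rewrite -!mulgA (mulgA b) e !mulgA mulgVK mulgK.
apply: D_right => //; first by apply: (subM sP) => //; apply: conj_P.
by apply: D_left => //; apply: conjV_P.
Qed.

Let dcos_q g : dcos l (q l) g -> D l g. Proof. by constructor 2. Qed.

Let sGYs g c : Gn l g -> D l (s * g * Y ^+ c * s)%g.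
Proof.
case/dec=> [Pg|[a [b [Pa Pb ->]]]|[j kj [a [b [Pa Pb ->]]]]].
- have -> : (s * g * Y ^+ c * s = s * g * s^-1 * (s * Y ^+ c * s))%g.
    by rewrite !mulgA mulgVK.
  apply: D_left => //; first exact: conjV_P.
  apply: adj_D; apply: (subM sA) => //; apply: (subM sA) => //.
  by have [] := fY c.
- apply: D_mid => // d {a b Pa Pb}.
  have -> : (s * q k * Y ^+ d * s = s * (q k * Y ^+ d * (q k)^-1) * s^-1 * (s * s) * (s^-1 * q k * s))%g.
    by rewrite !mulgA mulgVK mulgK mulgVK.
  have -> : (s^-1 * q k * s = q l)%g by rewrite -(rd_q_up rd) conjgE mulgA.
  apply: dcos_q; exists (s * (q k * Y ^+ d * (q k)^-1) * s^-1 * (s * s))%g, 1%g.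
  rewrite mulg1; split=> //; last exact: (sub1 sP).
  apply: (subM sP) => //; apply: sPs.
  have -> : (q k * Y ^+ d * (q k)^-1 = (Y ^ q k) ^+ d)%g.
    by rewrite -conjXg conjgE qV mulgA.
  rewrite conjXg; apply: (subX _ sP).
  have e : eqi (Y ^ q k)%g (S (l, true) (k, true)).
    apply: Sk; rewrite //= ?nlk //; right; last exact: (rd_flip rd).
    by apply: (rd_flip_other rd); rewrite ?nlk.
  apply: (sub_eqi sP (eqiJ s e)); apply: (sub_eqi sP (y := S (k, true) (l, true))).
    by apply: Sk; rewrite //= ?nlk //; [right; exact: (rd_down rd)|left; exact: (rd_up rd)].
  by apply: (sub_eqi sP (S_eqi rd _ _)); apply: P_Q => //; apply: Q_S.
apply: D_mid => // d {a b Pa Pb}; set u := r j.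
have Gu : Gn l u by rewrite /u kj; apply: (Gn_r rd); lia.
have -> : (s * u * Y ^+ d * s = s * (u * Y ^+ d * u^-1) * s^-1 * (s * u * s))%g.
  by rewrite !mulgA mulgVK mulgVK.
have -> : (s * u * s = u * s * u)%g by rewrite /u kj (rd_braid rd) //; lia.
apply: D_left => //; last first.
  by apply: dcos_s; exists u, u; split=> //; apply: P_G.
apply: sPs; have -> : (u * Y ^+ d * u^-1 = (Y ^ u^-1) ^+ d)%g.
  by rewrite -conjXg conjgE invgK mulgA.
rewrite conjXg; apply: (subX _ sP).
have jn : (j.+1 < n)%N by lia.
have e : eqi (Y ^ u^-1)%g (S (l, true) (j, false)).
  have e : eqi (S (l, true) (j, false) ^ u)%g Y.
    apply: Sk; rewrite //=; [lia|lia| |].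
      by left; rewrite /u; apply: (rd_fix rd); lia.
    by left; rewrite /u (rd_up rd) kj.
  by have := eqi_sym (eqiJ u^-1%g e); rewrite conjgK.
apply: (sub_eqi sP (eqiJ s e)); apply: (sub_eqi sP (y := S (k, true) (j, false))).
  apply: Sk; rewrite //=; [lia|lia| |]; first by right; exact: (rd_down rd).
  by left; apply: (rd_fix rd); lia.
by apply: P_G => //; apply: (Gn_S rd) => /=; lia.
Qed.

Let qYs c : D l (q l * Y ^+ c * s)%g.
Proof.
have [c0|c0] := eqVneq (c%:R : F) 0.
  have -> : (Y ^+ c = 1)%g.
    move/eqP: c0; rewrite -(dvdn_pcharf (pchar_Fp p_prime)) => /dvdnP[m ->].
    by rewrite mulnC expgnA (rd_Sexp rd) ?expg1n //= nlk.
  rewrite mulg1; have -> : (q l * s = 1 * s * q k)%g.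
    by rewrite mul1g -(rd_q_down rd k) conjgE mulKVg.
  apply: dcos_s; exists 1%g, (q k); split=> //; first exact: (sub1 sP).
  by apply: P_G => //; apply: (Gn_q rd).
have [m em] := nat_of_F (- 1 / c%:R : F); have [aX Xl] := fX m; have [aY _ Yl Yk] := fY c.
have PX : P l (X ^+ m * Y ^+ c * s)%g.
  apply: adj_P; first by apply: (subM sA) => //; apply: (subM sA).
  have d1 : dot fk ek = 1 by rewrite dot_basE // eqxx.
  have d3 : dot fl ek = 0 by rewrite dot_basE // nlk.
  rewrite 2!gmulfM !actM Xl !actE Yl Yk !actE !fr // ?eqxx ?nlk -em !dotB d1 d3.
  by field.
have -> : (q l * Y ^+ c * s = (q l * (X ^+ m)^-1 * (q l)^-1) * q l * (X ^+ m * Y ^+ c * s))%g.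
  by rewrite !mulgA mulgVK mulgVK.
apply: dcos_q; exists (q l * (X ^+ m)^-1 * (q l)^-1)%g, (X ^+ m * Y ^+ c * s)%g; split=> //.
have -> : (q l * (X ^+ m)^-1 * (q l)^-1 = ((X ^ q l) ^+ m)^-1)%g.
  by rewrite -conjXg -conjVg conjgE qV mulgA.
apply: P_Q => //; apply: (subV sQ); apply: (subX _ sQ).
apply: (sub_eqi sQ (y := S (k, true) (l, true))).
  apply: Sk; rewrite //= ?nkl //; right; last exact: (rd_flip rd).
  by apply: (rd_flip_other rd); rewrite ?nkl.
by apply: (sub_eqi sQ (S_eqi rd _ _)); apply: Q_S.
Qed.

(* a parabolic element, with the part that s moves to a parabolic one last *)
Let P_split b : P l b -> exists g c u, [/\ Gn l g, P l (u ^ s)%g & b = (g * Y ^+ c * u)%g].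
Proof.
case=> [_ [h [[a [g [Qa Gg ->]]] [ah dh] ->]]].
have [c [u [Qu Pu e]]] : exists c u, [/\ Q l u, P l (u ^ s)%g & (a ^ g)%g = (Y ^+ c * u)%g].
  by apply: Q_split; apply: (Gn_norm_Q p_gt0 rd ln).
exists g, c, (u * h)%g; split=> //; last first.
  have -> : (a * g = g * (Y ^+ c * u))%g by rewrite -e conjgE mulKVg.
  by rewrite !mulgA.
rewrite conjMg; apply: (subM sP) => //; apply: P_torus => //.
by split; [apply: (subJ sA)|apply: dia_r].
Qed.

Let D_s g : D l g -> D l (g * s)%g.
Proof.
have sb b : P l b -> D l (s * b * s)%g.
  case/P_split=> [h [c [u [Gh Pu ->]]]].
  have -> : (s * (h * Y ^+ c * u) * s = s * h * Y ^+ c * s * u ^ s)%g.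
    by rewrite conjgE !mulgA mulgK.
  by apply: D_right => //; apply: sGYs.
have qb b : P l b -> D l (q l * b * s)%g.
  case/P_split=> [h [c [u [Gh Pu ->]]]].
  have -> : (q l * (h * Y ^+ c * u) * s = h ^ q l * (q l * Y ^+ c * s) * u ^ s)%g.
    by rewrite !conjgE qV !mulgA mulgK -(mulgA _ (q l) (q l)) (rd_qq rd) mulg1.
  by apply: D_right => //; apply: D_left => //; apply: P_G => //; apply: Gq.
case=> [Pg|[a [b [Pa Pb ->]]]|[j [<-] [a [b [Pa Pb ->]]]]].
- by apply: dcos_s; exists g, 1%g; rewrite mulg1; split=> //; exact: (sub1 sP).
- by rewrite -!mulgA; apply: D_left; rewrite // mulgA; apply: qb.
- by rewrite -!mulgA; apply: D_left; rewrite // mulgA; apply: sb.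
Qed.

Lemma D_step g : Gn l.+1 g -> D l g.
Proof.
move=> Gg; pose gens h := h = s \/ exists2 x, (x.1 < l)%N & h = t x.
have {Gg} : gen gens g.
  move: Gg; apply: gen_sub => _ [[i b] /= il ->]; have sg := gen_subgroup gens.
  have [ilk|ilk] := ltnP i l; first by apply: mem_gen; right; exists (i, b).
  have -> : i = k.+1 by lia.
  rewrite -(rd_up rd); apply: (subJ sg); apply: mem_gen; first by right; exists (k, b).
  by left.
apply: (gen_right (H := D l)) => [_ [->|[x _ ->]]|| h _ Dh [->|[x xl ->]]].
- exact: swapV rd _.
- exact: (exp_finite_order p_gt0 (rd_texp rd x)).
- by apply: D_P; exact: (sub1 sP).
- exact: D_s.
- by apply: D_right => //; apply: P_G => //; apply: Gn_t.
Qed.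
End Step.

Lemma D_all l g : (l < n)%N -> Gn l.+1 g -> D l g.
Proof.
elim: l g => [|k IH] g ln; first exact: D_rank1.
by apply: (D_step ln) => h; apply: IH; exact: ltnW.
Qed.

(** An element of the kernel fixes a line, so it lies in the stabiliser P of the
    line; there, its three factors are recognised one after the other. *)
Theorem Gn_faithful l g : (l <= n)%N -> Gn l g -> f g = 1%g -> g = 1%g.
Proof.
elim: l g => [|[|k] IH] g ln.
- by move=> G0 _; move: G0; apply: (gen_min (H := fun g => g = 1%g)) => [|_ [x //]];
    split=> [//|_ _ -> ->|_ ->]; rewrite ?mulg1 ?invg1.
- by move=> Gg; apply: ker_G1.
move=> Gg fg; have ln' : (k.+1 < n)%N by [].
have kn : (k < n)%N := ltnW ln'.
pose fl := bas (k.+1, true); pose el := bas (k.+1, false).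
have nlk : (k.+1 == k) = false by rewrite gtn_eqF.
have absurd a b s v : P k.+1 a -> P k.+1 b -> g = (a * s * b)%g ->
    act fl (f s) = v -> (exists x, dot v x != 0 /\ dot fl x = 0) -> False.
  move=> Pa Pb e sv [x [vx fx]]; have [c ac] := P_line ln' Pa.
  have [d bd] := P_line ln' (subV (P_sub ln') Pb).
  have c0 : c != 0 by apply: (dia_neq0 (x := (k.+1, true))) ac.
  have : act fl (f (a * s)%g) = d *: fl.
    have -> : (a * s = g * b^-1)%g by rewrite e mulgK.
    by rewrite gmulfM fg mul1g.
  rewrite gmulfM actM ac actZ sv => /(congr1 (fun u => dot u x)); rewrite /= !dotZl fx mulr0 => /eqP.
  by rewrite mulf_eq0 (negPf c0) (negPf vx).
have fle : dot fl el = 1 by rewrite dot_basE // eqxx.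
have elf : dot el fl = 1 by rewrite dotC.
have flf : dot fl fl = 0 by rewrite dot_basE // eqxx.
case: (D_all ln' Gg) => [|[a [b [Pa Pb e]]]|[j [jk] [a [b [Pa Pb e]]]]].
- case=> [_ [h [[a [b [Qa Gb ->]]] [ah dh] ge]]].
  have [x [y [z [d [det hfk hfl hek hel hw hfix]]]]] := adj_action ln' ah.
  have d1 : dot (bas (k, true)) (bas (k, false)) = 1 by rewrite dot_basE // eqxx.
  have d2 : dot fl (bas (k, false)) = 0 by rewrite dot_basE // nlk.
  have d3 : dot (bas (k, true)) el = 0 by rewrite dot_basE // eq_sym nlk.
  have fix_fl : act fl (f h) = fl.
    have : act fl (f g) = fl by rewrite fg act1.
    by rewrite ge !gmulfM !actM (Q_fix ln' Qa) (Gn_fix true (leqnn k.+1) ln' Gb).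
  have z0 : z = 0.
    have := congr1 (fun u => dot u (bas (k, false))) fix_fl.
    by rewrite /= hfl !dotB d1 d2 mulr1 mulr0 addr0.
  have de : d = 1.
    have := congr1 (fun u => dot u el) fix_fl.
    by rewrite /= hfl !dotB d3 fle mulr1 mulr0 add0r.
  have y0 : y = 0.
    have [c hc] := dh (k, true) kn; have := congr1 (fun u => dot u el) hc.
    by rewrite /= hfk !dotB d3 fle mulr1 !mulr0 add0r.
  have xe : x = 1 by move: det; rewrite y0 de mul0r mulr1 subr0.
  have fh : f h = 1%g.
    rewrite y0 z0 de xe !scale0r !scale1r ?addr0 ?add0r ?subr0 in hfk hfl hek hel.
    apply: bas_ext => [[i b'] ilt|]; rewrite act1 //.
    case: (eqVneq i k) => [->|ik]; first by case: b' {ilt}.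
    case: (eqVneq i k.+1) => [->|il]; first by case: b' {ilt}.
    exact: hfix.
  have h1 : h = 1%g := ker_adj ln' ah fh.
  rewrite h1 mulg1 in ge.
  have a1 : a = 1%g.
    apply: (Q_inj ln' Qa); have -> : a = (g * b^-1)%g by rewrite ge mulgK.
    rewrite gmulfM fg mul1g.
    exact: (Gn_fix false (leqnn k.+1) ln' (subV (Gn_sub t k.+1) Gb)).
  rewrite a1 mul1g in ge; rewrite ge; apply: IH; first exact: ltnW.
    exact: Gb.
  by rewrite -ge.
- have [qE _ _] := fq ln'; case: (absurd a b (q k.+1) el Pa Pb e).
    exact: qE.
  by exists fl; rewrite elf flf oner_eq0.
- rewrite -jk in e; case: (absurd a b (r k) (- bas (k, true)) Pa Pb e).
    by rewrite fr // nlk eqxx.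
  exists (bas (k, false)); rewrite dotNl !dot_basE // eqxx nlk; split=> //.
  by rewrite oppr_eq0 oner_eq0.
Qed.
(** * The image is Omega *)


(** ** Isometries *)

Lemma gram_unit : gram_mx n p \in unitmx.
Proof.
have e : gram_mx n p *m linmx (bf n p) (be n p) ((- 2)^-1 *: w) = 1%:M; last first.
  exact: (proj1 (mulmx1_unit e)).
rewrite /gram_mx linmx_mul; apply: linmx1 => [k kn|k kn|].
- exact: bf_linmx.
- exact: be_linmx.
- by rewrite -scalemxAl bw_linmx scalerA divff ?scale1r // oppr_eq0 two_neq0.
Qed.

Lemma isom_det (g : GL) : isom g -> \det (GLval g) * \det (GLval g) = 1.
Proof.
move=> /isomP /eqP /(congr1 determinant); rewrite !det_mulmx det_tr => e.
have g0 : \det (gram_mx n p) != 0 by rewrite -unitfE -unitmxE gram_unit.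
by apply: (mulIf g0); rewrite mul1r mulrAC e.
Qed.

Lemma isom_SO (g : GL) : isom g -> \det (GLval g) = 1 -> g \in SO n p.
Proof. by move=> /isomP ig dg; rewrite inE dg eqxx andbT. Qed.

Lemma det_GLM (g h : GL) : \det (GLval (g * h)%g) = \det (GLval g) * \det (GLval h).
Proof. by rewrite GL_MxE det_mulmx. Qed.

Lemma det_GLX (g : GL) k : \det (GLval (g ^+ k)%g) = \det (GLval g) ^+ k.
Proof.
elim: k => [|k IH]; first by rewrite expg0 GL_1E det1.
by rewrite expgS det_GLM IH exprS.
Qed.

Lemma isom_odd_SO (g : GL) : isom g -> (g ^+ p = 1)%g -> g \in SO n p.
Proof.
move=> ig gp; apply: (isom_SO ig); have d2 := isom_det ig.
have dp := det_GLX g p; rewrite gp GL_1E det1 in dp.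
have pE : p = (2 * p./2).+1 by have := odd_double_half p; rewrite p_odd; lia.
move: d2 dp; move: (\det _) => d d2 ->; have -> : d ^+ p = d ^+ (2 * p./2).+1 by congr (_ ^+ _).
by rewrite exprS exprM expr2 d2 expr1n mulr1.
Qed.

Lemma isom_sqr_SO (g : GL) : isom g -> (g ^+ 2)%g \in SO n p.
Proof. by move=> ig; apply: (isom_SO (isomX 2 ig)); rewrite det_GLX expr2 isom_det. Qed.

Lemma commg_Omega (g h : GL) k : g \in SO n p -> h \in SO n p ->
  ([~ g, h] ^+ k)%g \in Omega n p.
Proof. exact: (@der1_commgX _ (SO n p)). Qed.

Lemma short_Omega x : (x.1 < n)%N -> f (t x) \in Omega n p.
Proof.
move=> xn; have [k kn tk] : exists2 k, (k.+1 < n)%N & (t x ^ (r k ^+ 2) = (t x)^-1)%g.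
  case: x xn => i s /= ilt; have [i1|i1] := ltnP i.+1 n.
    by exists i; rewrite // expg2 conjgM (rd_up rd) (rd_down rd).
  case: i ilt i1 => [|i] ilt i1; first by lia.
  by exists i; rewrite // expg2 conjgM (rd_down rd) conjVg (rd_up rd).
have tE : (t x = [~ t x, r k ^+ 2] ^+ p.-1./2)%g.
  rewrite commgEl tk -expg2 -expgnA mul2n even_halfK; last by case: (p) p_odd.
  apply: (@mulIg _ (t x)^-1%g); rewrite mulgV -expgSr prednK //.
  by rewrite expgVn (rd_texp rd) invg1.
have tn := Gn_t t xn; have rn := Gn_r rd kn kn.
have ft_SO : f (t x) \in SO n p.
  apply: isom_odd_SO; first exact: (Gn_isom (leqnn n) tn).
  by rewrite -gmulfXn (rd_texp rd) gmulf1.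
have fr_SO : (f (r k) ^+ 2)%g \in SO n p.
  by apply: isom_sqr_SO; exact: (Gn_isom (leqnn n) rn).
have e : f (t x) = ([~ f (t x), f (r k) ^+ 2] ^+ p.-1./2)%g.
  by rewrite {1}tE gmulfXn gmulfR gmulfXn.
move: (f (t x)) (f (r k) ^+ 2)%g ft_SO fr_SO e => g h gSO hSO ->.
exact: commg_Omega.
Qed.

Lemma Gn_Omega g : Gn n g -> f g \in Omega n p.
Proof.
have sO := group_subgroup (Omega n p).
apply: (gen_right (H := fun g => f g \in Omega n p)) => [y||z _ Oz [x xn ->]].
- exact: (shorts_fin p_gt0 rd).
- by rewrite gmulf1; exact: (sub1 sO).
- by rewrite gmulfM; exact: (subM sO Oz (short_Omega xn)).
Qed.

(** ** Transitivity on isotropic vectors *)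

Lemma weyl_transitive i j s : (i < n)%N -> (j <= i)%N ->
  exists2 g, Gn i.+1 g & act (bas (j, s)) (f g) = bas (i, true).
Proof.
move=> ilt ji; have sG := Gn_sub t i.+1; rewrite -(subKn ji).
have := leq_subr j i; elim: (i - j)%N => [|m IH] mi.
  rewrite subn0; case: s; first by exists 1%g; [exact: (sub1 sG)|rewrite gmulf1 act1].
  exists (q i); first exact: (Gn_q rd).
  by have [-> _ _] := fq ilt.
have [g Gg eg] := IH (ltnW mi); exists (r (i - m.+1)%N * g)%g.
  by apply: (subM sG) => //; apply: (Gn_r rd); lia.
rewrite gmulfM actM fr ?eqxx; [|lia..].
by rewrite -subSn // subSS.
Qed.

Lemma isotropic_transitive i v : (0 < i)%N -> (i < n)%N -> v != 0 -> dot v v = 0 ->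
  (forall a, (i < a.1)%N -> (a.1 < n)%N -> dot v (bas a) = 0) ->
  exists2 g, Gn i.+1 g & act v (f g) = bas (i, true).
Proof.
move=> i0 ilt vn0 vv v0; have sG := Gn_sub t i.+1.
have [x xi vx] : exists2 x, (x.1 <= i)%N & dot v (bas x) != 0.
  case: (boolP [exists x : 'I_i.+1 * bool, dot v (bas (x.1 : nat, x.2)) != 0]).
    by case/existsP=> [[x s] vx]; exists (x : nat, s); rewrite //= -ltnS ltn_ord.
  move/existsPn=> vx; case/eqP: vn0.
  have vw : v = (dot v w / - 2) *: w.
    apply: dot_ext => [[j s] jn|]; rewrite dotZr ?dot_bas_w // ?mulr0 dotC; last first.
      by rewrite dot_ww divfK // oppr_eq0 two_neq0.
    have [ij|ji] := ltnP i j; first exact: v0.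
    have := vx (Ordinal (ji : (j < i.+1)%N), s).
    by rewrite negbK => /eqP.
  move: vv; rewrite {1}vw dotZl => /eqP; rewrite mulf_eq0 => e.
  have vw0 : dot v w = 0.
    case/orP: e => [|/eqP]; last by rewrite dotC.
    by rewrite mulf_eq0 invr_eq0 oppr_eq0 (negPf two_neq0) orbF => /eqP.
  by rewrite vw vw0 mul0r scale0r.
have [g1 G1 e1] : exists2 g, Gn i.+1 g & act (bas x) (f g) = bas (i, true).
  by case: (x) xi => j s; apply: weyl_transitive.
have ig1 := Gn_isom ilt G1; set v1 := act v (f g1).
have vv1 : dot v1 v1 = 0 by rewrite ig1.
have v10 a : (i < a.1)%N -> (a.1 < n)%N -> dot v1 (bas a) = 0.
  move=> ia an; rewrite -(v0 a ia an) -[RHS]ig1; congr dot.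
  by case: (a) ia an => j s ij jn; rewrite (Gn_fix s ij jn G1).
have nz : dot v1 (bas (i, true)) != 0 by rewrite -e1 ig1.
have [g2 Q2 e2] := isotropic_radical ilt vv1 v10 nz.
set b := dot v1 (bas (i, true)) in nz e2.
have k1 : exists k, i = k.+1 by exists i.-1; rewrite prednK.
case: k1 => k ik; have kn : (k.+1 < n)%N by rewrite -ik.
have kn' : (k < n)%N := ltnW kn.
have nik : (i == k) = false by rewrite ik gtn_eqF.
have nki : (k == i) = false by rewrite eq_sym.
have ei a : (i <= a.1)%N -> (a.1 < n)%N -> dot (b^-1 *: bas (k, false)) (bas a) = 0.
  move=> ia an; rewrite dotZl dot_bas //= ltn_eqF ?mulr0 //.
  by apply: leq_trans ia; rewrite ik.
have [g3 Q3 e3] := Q_full ilt ei.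
have [m em] := nat_of_F (- b).
have ki : (k, true).1 != (i, false).1 by rewrite /= nki.
have ad : adapted (bas (k, true)) (bas (i, false)) := adapted_bas p (kn' : (k, true).1 < n)%N (ilt : (i, false).1 < n)%N ki.
have ad3 : adapted (bas (i, true)) (b^-1 *: bas (k, false)).
  by split; rewrite ?ei // dot_basE // eqxx.
exists (g1 * g2 * g3 * S (k, true) (i, false) ^+ m * r k * q i)%g.
  have G2 := Q_Gn ilt Q2; have G3 := Q_Gn ilt Q3.
  have Gr : Gn i.+1 (r k) by apply: (Gn_r rd); rewrite // ik.
  have Gq : Gn i.+1 (q i) by apply: (Gn_q rd).
  have GS : Gn i.+1 (S (k, true) (i, false) ^+ m)%g.
    by apply: (subX _ sG); apply: (Gn_S rd); rewrite //= ik; exact: ltnW.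
  do 4![apply: (subM sG) => //]; exact: (subM sG).
have a3 : act (b *: bas (i, false)) (f g3) = b *: bas (i, false) + bas (k, false).
  have d1 : dot (bas (i, false)) (bas (i, true)) = 1 by rewrite dot_basE // eqxx.
  have d2 : dot (bas (i, false)) (b^-1 *: bas (k, false)) = 0.
    by rewrite dotZr dot_basE // nik mulr0.
  have d3 : qf (b^-1 *: bas (k, false)) = 0.
    by rewrite qfZ /qf dot_basE // eqxx mul0r mulr0.
  rewrite actZ e3 (act_eichler _ ad3) d1 d2 d3 scale1r scale0r mul0r scale0r !subr0.
  by rewrite scalerDr scalerA divff // scale1r.
have a4 : act (b *: bas (i, false) + bas (k, false)) (f (S (k, true) (i, false) ^+ m)%g) =
    bas (k, false).
  have d1 : dot (bas (k, false)) (bas (k, true)) = 1 by rewrite dot_basE // eqxx.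
  have d2 : dot (bas (i, false)) (bas (k, true)) = 0 by rewrite dot_basE // nik.
  have d3 : dot (bas (i, false)) (bas (i, false)) = 0 by rewrite dot_basE // eqxx.
  have d4 : dot (bas (k, false)) (bas (i, false)) = 0 by rewrite dot_basE // nki.
  rewrite gmulfXn (fS (kn' : (k, true).1 < n)%N (ilt : (i, false).1 < n)%N ki) (eichlerX _ ad).
  have adm := adaptedZ m%:R ad; rewrite actD actZ (act_eichler _ adm) (act_eichler _ adm) -em.
  rewrite !dotB d1 d2 d3 d4 qfZ /qf d3.
  by apply/rowP=> c; rewrite !mxE; ring.
rewrite !gmulfM !actM -/v1 e2 a3 a4 fr // eqxx -ik.
by have [-> _ _] := fq ilt.
Qed.

Lemma isom_step i (M : GL) : (0 < i)%N -> (i < n)%N -> isom M ->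
  (forall a, (i < a.1)%N -> (a.1 < n)%N -> act (bas a) M = bas a) ->
  exists2 g, Gn i.+1 g & forall a, (i <= a.1)%N -> (a.1 < n)%N -> act (bas a) (M * f g)%g = bas a.
Proof.
move=> i0 ilt iM fM; have sG := Gn_sub t i.+1.
have fG g a : Gn i.+1 g -> (i < a.1)%N -> (a.1 < n)%N -> act (bas a) (f g) = bas a.
  by case: a => j s Gg ij jn; apply: (Gn_fix s ij jn Gg).
have orth (N : GL) s a : isom N -> (forall a, (i < a.1)%N -> (a.1 < n)%N -> act (bas a) N = bas a) ->
    (i < a.1)%N -> (a.1 < n)%N -> dot (act (bas (i, s)) N) (bas a) = 0.
  by move=> iN fN ia an; rewrite -(fN a ia an) iN dot_bas //= (ltn_eqF ia).
have iso s : dot (bas (i, s)) (bas (i, s)) = 0 by rewrite dot_basE // !eqxx.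
have d1 : dot (bas (i, false)) (bas (i, true)) = 1 by rewrite dot_basE // eqxx.
have [g Gg eg] : exists2 g, Gn i.+1 g & act (act (bas (i, true)) M) (f g) = bas (i, true).
  apply: isotropic_transitive => //; last 2 first.
  - by rewrite iM.
  - by move=> a; apply: orth.
  apply/eqP=> z; have := iM (bas (i, false)) (bas (i, true)); rewrite z d1.
  by rewrite -(scale0r (0 : V)) dotZr mul0r => /esym/eqP; rewrite oner_eq0.
have ig := Gn_isom ilt Gg; have iN := isomM iM ig.
have fN a : (i < a.1)%N -> (a.1 < n)%N -> act (bas a) (M * f g)%g = bas a.
  by move=> ia an; rewrite actM fM // fG.
have eN : act (bas (i, true)) (M * f g)%g = bas (i, true) by rewrite actM.
move: (M * f g)%g iN fN eN (mulgA M (f g)) => N iN fN eN NA.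
have vt : dot (act (bas (i, false)) N) (bas (i, true)) = 1 by rewrite -eN iN.
have vv : dot (act (bas (i, false)) N) (act (bas (i, false)) N) = 0 by rewrite iN.
have nz : dot (act (bas (i, false)) N) (bas (i, true)) != 0 by rewrite vt oner_eq0.
have [h Qh eh] := isotropic_radical ilt vv (fun a => orth N false a iN fN) nz.
exists (g * h)%g; first by apply: (subM sG) => //; apply: Q_Gn.
move=> a ia an; rewrite gmulfM NA actM.
have [aE|ai] := eqVneq i a.1; last first.
  have {}ia : (i < a.1)%N by rewrite ltn_neqAle ai.
  by rewrite fN // fG //; apply: Q_Gn.
case: a aE ia an => j [] /= <- _ _; first by rewrite eN; apply: Q_fix.
by rewrite eh vt scale1r.
Qed.

Lemma isom_diagonal (M : GL) : isom M -> exists2 g, Gn n g & diagonal (M * f g)%g.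
Proof.
move=> iM; have sG := Gn_sub t n.
have [g Gg fg] : exists2 g, Gn n g & forall a, (0 < a.1)%N -> (a.1 < n)%N ->
    act (bas a) (M * f g)%g = bas a.
  suff H m : (m < n)%N -> exists2 g, Gn n g & forall a, (n - m <= a.1)%N -> (a.1 < n)%N ->
      act (bas a) (M * f g)%g = bas a.
    have [|g Gg fg] := H n.-1; first by rewrite prednK.
    exists g => // a a0; apply: fg; lia.
  elim: m => [|m IH] mn.
    by exists 1%g; [exact: (sub1 sG)|move=> a; rewrite subn0 => na an; lia].
  have [g Gg fg] := IH (ltnW mn).
  have i0 : (0 < n - m.+1)%N by lia.
  have ilt : (n - m.+1 < n)%N by lia.
  have iN := isomM iM (Gn_isom (leqnn n) Gg).
  have [a ia an|h Gh fh] := isom_step i0 ilt iN; first by apply: fg => //; lia.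
  exists (g * h)%g; first by apply: (subM sG) => //; apply: Gn_mono Gh.
  by move=> a ia an; rewrite gmulfM mulgA; apply: fh.
have iN := isomM iM (Gn_isom (leqnn n) Gg).
have [a [b [Qa Qb Dab]]] := isom_rank1 iN fg.
have Ga := Gn_mono n_gt0 (Q_Gn n_gt0 Qa); have Gb := Gn_mono n_gt0 (Q_Gn n_gt0 Qb).
case: Dab => Dab; [exists (g * b)%g|exists (g * (a * q 0%N * b))%g].
- exact: (subM sG).
- by rewrite gmulfM mulgA.
- apply: (subM sG) => //; apply: (subM sG) => //; apply: (subM sG) => //.
  exact: (Gn_q rd).
- by rewrite gmulfM mulgA.
Qed.

(** ** The derived subgroup *)

Definition image (M : GL) := exists2 g, Gn n g & f g = M.

Lemma image_sub : subgroup image.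
Proof.
have sG := Gn_sub t n; split=> [|_ _ [g Gg <-] [h Gh <-]|_ [g Gg <-]].
- by exists 1%g; [exact: (sub1 sG)|rewrite gmulf1].
- by exists (g * h)%g; [exact: (subM sG)|rewrite gmulfM].
- by exists g^-1%g; [exact: (subV sG)|rewrite gmulfV].
Qed.

Lemma diagonal_normalises (M : GL) : isom M -> diagonal M -> normalises image M.
Proof.
move=> iM dM _ [g Gg <-]; have sI := image_sub; have [d hw] := dia_w iM dM.
move: Gg; apply: (gen_min (H := fun g => image (f g ^ M)%g)) => [|_ [x xn ->]].
  split=> [|x y Ix Iy|x Ix].
  - by rewrite gmulf1 conj1g; exact: (sub1 sI).
  - by rewrite gmulfM conjMg; exact: (subM sI).
  - by rewrite gmulfV conjVg; exact: (subV sI).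
have [c hx] := dM x xn; have [m em] := nat_of_F (c * d).
have ax := adapted_w p xn.
exists (t x ^+ m)%g; first by apply: (subX _ (Gn_sub t n)); apply: Gn_t.
rewrite gmulfXn ft // (eichlerX _ ax) (eichlerJ iM ax) hx hw.
by rewrite (eichlerZl p_prime p_odd c (adaptedZ d ax)) scalerA em.
Qed.

Lemma diagonal_commute (M N : GL) : isom M -> isom N -> diagonal M -> diagonal N -> commute M N.
Proof.
move=> iM iN dM dN; have [c hM] := dia_w iM dM.
have [d hN] := dia_w iN dN.
apply: bas_ext => [a an|]; rewrite (actM _ M) (actM _ N); last by rewrite hM hN !actZ hM hN !scalerA mulrC.
have [c' hM'] := dM a an; have [d' hN'] := dN a an.
by rewrite hM' hN' !actZ hM' hN' !scalerA mulrC.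
Qed.

Lemma comm_image D1 D2 k1 k2 : image k1 -> image k2 -> normalises image D1 ->
  normalises image D2 -> commute D1 D2 -> image [~ D1 * k1, D2 * k2]%g.
Proof.
move=> I1 I2 n1 n2 cDD; have sI := image_sub.
rewrite commgMl 2!commgMr; move/comm1P: cDD => ->; rewrite conj1g mulg1.
have I3 : image [~ D1, k2]%g.
  by rewrite commgEr; apply: (subM sI) => //; apply: n1; exact: (subV sI).
have I4 : image [~ k1, D2]%g.
  by rewrite commgEl; apply: (subM sI) => //; [exact: (subV sI)|apply: n2].
have I5 : image [~ k1, k2]%g.
  by rewrite commgEl; apply: (subM sI) => //; [exact: (subV sI)|exact: subJ].
apply: (subM sI); first exact: subJ.
by apply: (subM sI) => //; apply: subJ.
Qed.

Lemma image_Omega (M : GL) : image M <-> M \in Omega n p.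
Proof.
split=> [[g Gg <-]|]; first exact: Gn_Omega.
have sI := image_sub.
pose K := [set M : GL | `[< image M >]]%SET.
have KP N : reflect (image N) (N \in K) by rewrite inE; apply: asboolP.
have gK : group_set K.
  apply/group_setP; split=> [|x y /KP Kx /KP Ky]; apply/KP; [exact: (sub1 sI)|exact: (subM sI)].
move=> OM; apply/KP; move: M OM; apply: (@der1_sub _ (SO n p) (group gK)).
move=> x y xS yS; apply/KP.
have split N : N \in SO n p -> exists D k, [/\ isom D, diagonal D, image k & N = (D * k)%g].
  rewrite inE => /andP[/isomP iN _]; have [g Gg Dg] := isom_diagonal iN.
  exists (N * f g)%g, (f g)^-1%g; rewrite mulgK; split=> //.
    by apply: isomM => //; apply: (Gn_isom (leqnn n) Gg).
  by apply: (subV sI); exists g.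
have [D1 [k1 [i1 d1 I1 ->]]] := split x xS; have [D2 [k2 [i2 d2 I2 ->]]] := split y yS.
have n1 := diagonal_normalises i1 d1; have n2 := diagonal_normalises i2 d2.
have cDD := diagonal_commute i1 i2 d1 d2.
move: D1 D2 k1 k2 I1 I2 n1 n2 cDD {d1 d2 i1 i2} => D1 D2 k1 k2 I1 I2 n1 n2 cDD.
exact: comm_image.
Qed.
End Faithful.

Local Close Scope ring_scope.

Local Open Scope group_scope.

Section TypeB.
Variables (n p : nat).
Hypotheses (n_ge2 : (2 <= n)%N) (p_prime : prime p) (p_odd : odd p).
Local Notation GL := {'GL_n.*2.+1['F_p]}.
Local Notation bas := (bas n p).
Local Notation w := (bw n p).
Variables (sg ta ze U W : GL).
Hypothesis std : standard sg ta ze U W.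
Variables (G : groupType) (A a z u v : G) (f : UMagmaMorphism.type G GL).
Hypothesis rB : typeB_relations n p A a z u v.
Hypothesis G_gen : forall H : G -> Prop, subgroup H ->
  H A -> H a -> H z -> H u -> H v -> forall x, H x.
Hypotheses (fA : f A = sg) (fa : f a = ta) (fz : f z = ze) (fu : f u = U) (fv : f v = W).
Variables (RSL RPSL : set (freegroup bool)).
Hypotheses (SL_pres : presents (pair2 sg U) RSL) (PSL_pres : presents (pair2 ta ze) RPSL).
Hypotheses (SL_rel : forall r, RSL r -> feval (pair2 A u) r = 1)
  (PSL_rel : forall r, RPSL r -> feval (pair2 a z) r = 1).

Let n_gt0 : (0 < n)%N. Proof. exact: ltnW. Qed.

Let t := short a z v.
Let S := long p a z v.
Let r := swapel u v.
Let q := flipel z v.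

Let rd : root_data n p t S r q. Proof. exact: (typeB_root_data n_ge2 p_odd rB). Qed.

Let ft x : (x.1 < n)%N -> f (t x) = eichler (bas x) w.
Proof.
case: x => i s /= ilt; have iV := isomX i (std_iV std); have iz := std_iz std.
have ad b : adapted (bas (0%N, b)) w by apply: adapted_w.
have wV : act w (W ^+ i) = w by apply: act_X_fix; exact: std_w_V std.
have bV b : act (bas (0%N, b)) (W ^+ i) = bas (i, b).
  by rewrite (act_Vk n_ge2 p_prime p_odd std) ?add0n.
rewrite /t /short /= gmulfJ gmulfXn fv.
have -> : f (if s then a else (a ^ z)^-1) = eichler (bas (0%N, s)) w; last first.
  by rewrite (eichlerJ p_prime p_odd iV (ad s)) bV wV.
case: s; first by rewrite fa (std_t std).
rewrite gmulfV gmulfJ fa fz (std_t std) (eichlerJ p_prime p_odd iz (ad true)).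
have az : adapted (bas (0%N, false)) (- w)%R by apply: adaptedN.
by rewrite (std_z std) // (std_w_z std) /= -(eichlerN p_prime p_odd az) opprK.
Qed.

Let fr_mx k : f (r k) = U ^ (W ^+ k).
Proof. by rewrite /r /swapel gmulfJ gmulfXn fu fv. Qed.

Let fr k i s : (k.+1 < n)%N -> (i < n)%N -> act (bas (i, s)) (f (r k)) =
  (if i == k then bas (k.+1, s) else if i == k.+1 then - bas (k, s) else bas (i, s))%R.
Proof. by move=> kn ilt; rewrite fr_mx (act_UVk n_ge2 p_prime p_odd std). Qed.

Let fr_w k : (k.+1 < n)%N -> act w (f (r k)) = w.
Proof. by move=> kn; rewrite fr_mx (act_w_UVk std). Qed.

(** An element of a conjugate of the group that x and y generate is a conjugated
    word in x and y; when it acts trivially, this word is a consequence of the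
    relations between x and y. *)
Let ker_pair (R : set (freegroup bool)) (x y c g : G) (gens : G -> Prop) :
  presents (pair2 (f x) (f y)) R -> (forall e, R e -> feval (pair2 x y) e = 1) ->
  (forall h, gens h -> exists e, h = feval (pair2 x y) e ^ c) ->
  gen gens g -> f g = 1 -> g = 1.
Proof.
move=> pR rel gE gg fg.
have [e ge] : exists e, g = feval (pair2 x y) e ^ c.
  move: gg; apply: (gen_min (H := fun g => exists e, g = feval (pair2 x y) e ^ c)) => //.
  split=> [|_ _ [d ->] [e ->]|_ [e ->]].
  - by exists 1; rewrite gmulf1 conj1g.
  - by exists (d * e); rewrite gmulfM conjMg.
  - by exists e^-1; rewrite gmulfV conjVg.
have fe : feval (pair2 (f x) (f y)) e = 1.
  rewrite -feval_pair2; apply: (@conjg_inj _ (f c)).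
  by rewrite -gmulfJ -ge fg conj1g.
have Ne : normal_closure R e by rewrite pR.
by rewrite ge (normal_closure_kernel rel Ne) conj1g.
Qed.

Let ker_adj k g : (k.+1 < n)%N -> adj S r k g -> f g = 1 -> g = 1.
Proof.
move=> kn; apply: (@ker_pair RSL A u (v ^+ k)) => //; first by rewrite fA fu.
move=> _ [->|->].
  by exists (fgen false); rewrite feval_gen /= /S (long_adj p_odd rB).
by exists (fgen true); rewrite feval_gen.
Qed.

Let ker_G1 g : Gn t 1 g -> f g = 1 -> g = 1.
Proof.
apply: (@ker_pair RPSL a z 1) => //; first by rewrite fa fz.
move=> _ [[i s] /= i0 ->]; have -> : i = 0%N by lia.
rewrite /t /short /= expg0 conjg1; case: s.
  by exists (fgen false); rewrite feval_gen conjg1.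
exists ((fgen false ^ fgen true)^-1); rewrite gmulfV gmulfJ /= !feval_gen /=.
by rewrite conjg1.
Qed.

Let all_Gn x : Gn t n x.
Proof.
have sG := Gn_sub t n.
have [GA Ga Gz' Gu Gv] : [/\ Gn t n A, Gn t n a, Gn t n z, Gn t n u & Gn t n v].
  apply: (generators_short n_ge2 p_odd rB) => [|y1 y2 G1 G2|y yn].
  - exact: (sub1 sG).
  - by apply: (subM sG) => //; apply: (subV sG).
  - exact: Gn_t.
exact: (G_gen sG).
Qed.

Lemma typeB_faithful : injective f.
Proof.
apply: gmulf_inj => x fx.
exact: (Gn_faithful n_ge2 p_prime p_odd rd ft fr fr_w ker_adj ker_G1 (leqnn n) (all_Gn x) fx).
Qed.

Lemma typeB_image M : (exists x, f x = M) <-> M \in Omega n p.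
Proof.
have I := image_Omega n_ge2 p_prime p_odd rd ft fr M.
split=> [[x fx]|/I [x _ fx]]; last by exists x.
by apply/I; exists x.
Qed.
End TypeB.

Lemma cyclel_standard n p (n_ge2 : 2 <= n) (p_prime : prime p) (p_odd : odd p)
  (sg ta ze U W : {'GL_n.*2.+1['F_p]}) : standard sg ta ze U W -> cyclel n U W = W.
Proof.
move=> std; rewrite /cyclel; case: (ltnP 2 n) => [//|n2].
by apply: (gl_V2 n_ge2 p_prime p_odd std); apply/eqP; rewrite eqn_leq n2 n_ge2.
Qed.

(** A homomorphism is an isomorphism onto its image. *)
Lemma isomorphic_image (G : groupType) (gT : finGroupType) (H : {group gT})
  (f : G -> gT) : {morph f : x y / x * y} -> injective f -> (forall y, (exists x, f x = y) <-> y \in H) ->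
  isomorphic G (subg_of H).
Proof.
move=> fM f_inj fH; have fHx x : f x \in H by apply/fH; exists x.
pose F x : subg_of H := Subg (fHx x).
have FM : {morph F : x y / x * y} by move=> x y; apply: val_inj; rewrite /= fM.
pose Fm := HB.pack_for {multiplicative G -> subg_of H} F
  (isMultiplicative.Build G (subg_of H) F FM).
exists Fm; pose inv (y : subg_of H) : G := sval (cid (proj2 (fH (sgval y)) (subgP y))).
have invK y : f (inv y) = sgval y by rewrite /inv; case: (cid _).
exists inv => [x|y]; last by apply: val_inj; rewrite /= invK.
by apply: f_inj; rewrite invK.
Qed.

Local Close Scope group_scope.

Theorem theorem10p5 (n p : nat) (Rsgn RSL RPSL : set (freegroup bool))
    (n_ge2 : (2 <= n)%N) (p_prime : prime p) (p_odd : odd p)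
    (Rsgn_pres : (2 < n)%N -> presents (pair2 (Uel n p) (Vel n p)) Rsgn)
    (RSL_pres : presents (pair2 (sigma n p) (Uel n p)) RSL)
    (RPSL_pres : presents (pair2 (tau n p) (zel n p)) RPSL) :
  isomorphic (presented (relators n p Rsgn RSL RPSL)) (subg_of (Omega n p)).
Proof.
have std := standard_generators n_ge2 p_prime p_odd.
have D := gl_defining_relations n_ge2 p_prime p_odd Rsgn_pres RSL_pres RPSL_pres.
have [f [fA fa fz fu fv]] := presented_morphism n_ge2 D.
rewrite (cyclel_standard n_ge2 p_prime p_odd std) in fv.
pose pi := pres_proj (relators n p Rsgn RSL RPSL).
have dr := proj1 (relatorsP p Rsgn RSL RPSL n_ge2 pi) (@pres_proj_rel _ _).
have rB := defining_typeB n_ge2 p_prime p_odd Rsgn_pres RSL_pres RPSL_pres dr.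
have gen (H : presented (relators n p Rsgn RSL RPSL) -> Prop) : subgroup H ->
    H (pi (fgen (Gsigma n))) -> H (pi (fgen (Gtau n))) -> H (pi (fgen (Gz n))) ->
    H (pi (fgen (GU n))) -> H (cyclel n (pi (fgen (GU n))) (pi (Vgen n))) -> forall x, H x.
  move=> sH HA Ha Hz Hu Hv; apply: (presented_ind sH) => -[||||n3] //.
  by move: Hv; rewrite /cyclel n3 (VgenE n3).
have inj := typeB_faithful n_ge2 p_prime p_odd std rB gen fA fa fz fu fv RSL_pres RPSL_pres
  (dr_SL dr) (dr_PSL dr).
have im := typeB_image n_ge2 p_prime p_odd std rB gen fa fz fu fv.
have fM : {morph (fun x => f x) : x y / (x * y)%g} by move=> x y; exact: gmulfM.
exact: (@isomorphic_image (presented (relators n p Rsgn RSL RPSL)) _ (Omega n p)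
  (fun x => f x) fM inj im).
Qed.
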